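(* Let $s>1$. Then there exists a constant $c>0$ with the following property: for every sufficiently large $\mathcal{K}\gg 1$ there exist a global solution $u(t,x)$, not identically zero, of the cubic defocusing nonlinear Schrödinger equation $$-i\,\partial_t u+\Delta u=|u|^2u,\qquad x\in\mathbb{T}^2=\mathbb{R}^2/(2\pi\mathbb{Z})^2,\ t\in\mathbb{R},$$ and a time $T$ satisfying $$0<T\le \mathcal{K}^c$$ such that $$\|u(T)\|_{H^s(\mathbb{T}^2)}\ge \mathcal{K}\,\|u(0)\|_{H^s(\mathbb{T}^2)}.$$ Moreover, this solution can be chosen to satisfy $$\|u(0)\|_{L^2(\mathbb{T}^2)}\le \mathcal{K}^{-(s-1)c/4+2/(s-1)}.$$
   Context: Here $u:\mathbb{R}\times\mathbb{T}^2\to\mathbb{C}$. For $n\in\mathbb{Z}^2$ put $\hat u(t,n)=\int_{\mathbb{T}^2}u(t,x)e^{-in\cdot x}\,dx$ and $\langle n\rangle=(1+|n|^2)^{1/2}$. The Sobolev norm is $\|u(t)\|_{H^s(\mathbb{T}^2)}=\left(\sum_{n\in\mathbb{Z}^2}\langle n\rangle^{2s}|\hat u(t,n)|^2\right)^{1/2}$, and $\|u(t)\|_{L^2}^2=\int_{\mathbb{T}^2}|u(t,x)|^2dx$. A global solution is a solution defined for all times $t\in\mathbb{R}$ (the equation is globally well posed for smooth initial data). *)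

(* Defs.v *)
From mathcomp Require Import all_boot all_order all_algebra.
From mathcomp Require Export complex.
From mathcomp Require Import all_classical all_reals all_analysis.

Set Implicit Arguments.
Unset Strict Implicit.
Unset Printing Implicit Defensive.

Import Order.TTheory GRing.Theory Num.Theory.
Import numFieldNormedType.Exports.

Local Open Scope classical_set_scope.
Local Open Scope ring_scope.

Definition iter_derive (R : realType) (V W : normedModType R)
  (vs : seq V) (f : V -> W) : V -> W :=
  foldr (fun v g => 'D_v g) f vs.

Definition smooth (R : realType) (V W : normedModType R) (f : V -> W) : Prop :=
  forall vs : seq V, continuous (iter_derive vs f) /\
    (forall v p, derivable (iter_derive vs f) p v).

Section Complex_valued.
Context {R : realType}.

(* R[i] carries no normed module structure over R, so differentiation and
   integration of complex-valued functions are componentwise. *)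

Definition csmooth (V : normedModType R) (f : V -> R[i]) : Prop :=
  smooth (fun p => complex.Re (f p) : R^o) /\
  smooth (fun p => complex.Im (f p) : R^o).

Definition cderive (V : normedModType R) (v : V) (f : V -> R[i]) : V -> R[i] :=
  fun p => ('D_v (fun q => complex.Re (f q) : R^o) p +i*
            'D_v (fun q => complex.Im (f q) : R^o) p)%C.

Definition cintegral d (T : measurableType d) (mu : {measure set T -> \bar R})
  (D : set T) (f : T -> R[i]) : R[i] :=
  (Rintegral mu D (fun x => complex.Re (f x)) +i*
   Rintegral mu D (fun x => complex.Im (f x)))%C.

(* e^{i theta} *)
Definition cis (theta : R) : R[i] := (cos theta +i* sin theta)%C.

End Complex_valued.

(* Functions on T^2 = R^2/(2 pi Z)^2 are functions on R^2 that are
   2 pi-periodic in each variable, integrated over one period square. *)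
Section Torus.
Context {R : realType}.

Definition periodic2 (f : R * R -> R[i]) : Prop :=
  forall (x : R * R) (n : int * int),
    f (x.1 + 2 * pi * n.1%:~R, x.2 + 2 * pi * n.2%:~R) = f x.

Definition lebesgue2 :
    {measure set (measurableTypeR R * measurableTypeR R) -> \bar R} :=
  ((@lebesgue_measure R) \x (@lebesgue_measure R))%E.

Definition period_square : set (R * R) :=
  `[0, 2 * pi]%classic `*` `[0, 2 * pi]%classic.

Definition fourier_coef (f : R * R -> R[i]) (n : int * int) : R[i] :=
  cintegral lebesgue2 period_square
    (fun x => f x * cis (- (n.1%:~R * x.1 + n.2%:~R * x.2))).

Definition japanese_bracket (n : int * int) : R :=
  Num.sqrt (1 + (n.1%:~R ^+ 2 + n.2%:~R ^+ 2)).

Definition sobolev_norm (s : R) (f : R * R -> R[i]) : \bar R :=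
  sqrte (\esum_(n in [set: int * int])
    (japanese_bracket n `^ (2 * s) *
     Normc.normc (fourier_coef f n) ^+ 2)%R%:E)%E.

Definition L2_norm (f : R * R -> R[i]) : \bar R :=
  sqrte (\int[lebesgue2]_(x in period_square)
    (Normc.normc (f x) ^+ 2)%R%:E)%E.

End Torus.

Section NLS.
Context {R : realType}.

(* Space-time points are (t, (x1, x2)). *)
Definition spacetime (u : R -> R * R -> R[i]) : R * (R * R) -> R[i] :=
  fun p => u p.1 p.2.

Definition dir_t : R * (R * R) := (1, (0, 0)).
Definition dir_x1 : R * (R * R) := (0, (1, 0)).
Definition dir_x2 : R * (R * R) := (0, (0, 1)).

Definition time_derivative (u : R -> R * R -> R[i]) (t : R) (x : R * R) : R[i] :=
  cderive dir_t (spacetime u) (t, x).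

Definition laplacian (u : R -> R * R -> R[i]) (t : R) (x : R * R) : R[i] :=
  cderive dir_x1 (cderive dir_x1 (spacetime u)) (t, x) +
  cderive dir_x2 (cderive dir_x2 (spacetime u)) (t, x).

(* In the equation, `|z| is the modulus of z as an element of R[i]. *)
Definition global_solution_NLS (u : R -> R * R -> R[i]) : Prop :=
  [/\ csmooth (spacetime u),
      forall t, periodic2 (u t) &
      forall t x, - 'i%C * time_derivative u t x + laplacian u t x =
                  `|u t x| ^+ 2 * u t x].

End NLS.

(* Main.v *)
(* Take u(t,x) = v(t,x_1), where v solves the one-dimensional equation with the large
   datum A cos x_1 and A is of order K^(1/s); the L^2 bound allows this, since its exponent
   is 1/(s-1) > 1/s when c = 4/(s-1)^2. Let Z be the integral of |v|^2 cos 2x and J that of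
   Im(conj(v) v_x) sin 2x, over a period. Then Z' = 4 J, and J' is the sum
   of minus the integral of |v|^4 cos 2x, of -4 Z, and of a term bounded by four times the
   kinetic energy.

   Suppose that the kinetic energy stayed below 10^-6 A^4 for 0 <= t <= 1/A. Cauchy-Schwarz
   makes J small compared with A^3, so Z is nearly constant, and conservation of mass and
   energy then keeps |v|^2 close to A^2 cos^2 x in L^2. Hence J' <= - (pi/4) A^4, so that J
   moves by (pi/4) A^3 in time 1/A: a contradiction. The kinetic energy thus reaches
   10^-6 A^4 at a time T <= 1/A, while the mass is A^2. Most of it is carried by frequencies
   above r, with A = 10^4 r, so the H^s norm at time T is at least of order r^s A.

   The solution v is a limit, along an ultrafilter, of Galerkin truncations in the basis
   cos((2l+1)x). Energy conservation bounds the sum of the absolute values of the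
   coefficients, and Gronwall then bounds every Sobolev norm on bounded time intervals,
   uniformly in the truncation. All space-time derivatives are polynomials in the space
   derivatives up to an error that tends to 0, so smoothness and the equation pass to the
   limit. *)

(* For a datum [A cos x] with [A] large, the potential energy is of order [A^4] and the kinetic
   energy only [A^2], so on the time scale [1/A] dispersion is negligible and the flow behaves like
   a compressible fluid: the pressure gradient must set mass in motion, and [J] detects that motion.
   Since [T <= 1], the time bound [K^c] has ample room. The constants fit together as follows. A
   kinetic energy below [10^-6 A^4] costs [10^-3] after Cauchy-Schwarz. With [A = 10^4 r] it equals
   [100 r^2 A^2]; half of it survives the limit, still 50 times what frequencies below [r] can hold.
   Combinations of odd cosines are stable under the cubic term, and their coefficients satisfy a
   Hamiltonian system whose truncations conserve mass and energy exactly. The local laws for density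
   and current hold only up to the modes of the cubic term that the truncation discards, an error
   [O(1/n)]. No uniqueness is used: all that is claimed about the solution passes to limits, and a
   single ultrafilter supplies the limits at all times, points and orders of derivative together. *)
Require Import Defs.
From mathcomp Require Import all_boot all_order all_algebra.
From mathcomp Require Import all_classical all_reals all_analysis.
From mathcomp Require Import measurable_realfun.
From mathcomp Require Import ring lra zify.

Set Implicit Arguments.
Unset Strict Implicit.
Unset Printing Implicit Defensive.

Import Order.TTheory GRing.Theory Num.Theory.
Import numFieldNormedType.Exports.

Local Open Scope ring_scope.

(** * Calculus on the line *)

Section Calculus.
Context {R : realType}.
Local Open Scope classical_set_scope.

Section Rules.
Context {V : normedModType R}.
Implicit Types (f g : V -> R) (x v : V).

Lemma der_eq f x v (df df' : R) : is_derive x v f df -> df = df' ->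
  is_derive x v f df'.
Proof. by move=> + <-. Qed.

Lemma der_cst (c : R) x v : is_derive x v (fun _ : V => c) 0.
Proof. exact: is_derive_cst. Qed.

Lemma der_add f g x v df dg : is_derive x v f df -> is_derive x v g dg ->
  is_derive x v (fun y => f y + g y) (df + dg).
Proof. exact: is_deriveD. Qed.

Lemma der_opp f x v df : is_derive x v f df -> is_derive x v (fun y => - f y) (- df).
Proof. exact: is_deriveN. Qed.

Lemma der_sub f g x v df dg : is_derive x v f df -> is_derive x v g dg ->
  is_derive x v (fun y => f y - g y) (df - dg).
Proof. by move=> hf hg; apply: der_add => //; apply: der_opp. Qed.

Lemma der_mul f g x v df dg : is_derive x v f df -> is_derive x v g dg ->
  is_derive x v (fun y => f y * g y) (df * g x + f x * dg).
Proof.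
move=> hf hg; have := is_deriveM hf hg.
rewrite [X in is_derive _ _ _ X](_ : _ = df * g x + f x * dg); first exact.
by rewrite addrC [g x *: _]mulrC.
Qed.

Lemma der_scale f (c : R) x v df : is_derive x v f df ->
  is_derive x v (fun y => c * f y) (c * df).
Proof.
by move=> hf; apply: (der_eq (der_mul (der_cst c x v) hf)); rewrite mul0r add0r.
Qed.

Lemma der_sum (I : Type) (r : seq I) (P : pred I) (f : I -> V -> R) (df : I -> R) x v :
  (forall i, P i -> is_derive x v (f i) (df i)) ->
  is_derive x v (fun y => \sum_(i <- r | P i) f i y) (\sum_(i <- r | P i) df i).
Proof.
move=> h; elim: r => [|i r IH].
  rewrite big_nil (_ : (fun _ => _) = (fun _ => 0)); first exact: der_cst.
  by apply/funext => y; rewrite big_nil.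
rewrite big_cons (_ : (fun _ => _) = (fun y => if P i then
  f i y + \sum_(j <- r | P j) f j y else \sum_(j <- r | P j) f j y)); last first.
  by apply/funext => y; rewrite big_cons.
by case: ifP => // Pi; apply: der_add => //; exact: h.
Qed.

Lemma der_sum_ord n (f : nat -> V -> R) (df : nat -> R) x v :
  (forall l, is_derive x v (f l) (df l)) ->
  is_derive x v (fun y => \sum_(l < n) f l y) (\sum_(l < n) df l).
Proof. by move=> h; apply: der_sum. Qed.

(** An error bound quadratic in [h] survives a pointwise limit, unlike differentiability itself.
    Both the limit of Picard iterates and the limit of truncations are differentiated through it. *)
Lemma der_of_quadratic_bound f x v (d C : R) :
  (forall h : R, `|h| <= 1 -> `|f (h *: v + x) - f x - h * d| <= C * h ^+ 2) ->
  is_derive x v f d.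
Proof.
move=> H.
have L : (fun h => h^-1 *: ((f \o shift x) (h *: v) - f x)) @ 0^' --> d.
  apply/cvgrPdist_le => e e0; near=> h.
  have h0 : h != 0 by near: h; exact: nbhs_dnbhs_neq.
  have hn : 0 < `|h| by rewrite normr_gt0.
  have h1 : `|h| <= 1 by near: h; apply: dnbhs0_le.
  have hC : `|h| <= e / (`|C| + 1).
    by near: h; apply: dnbhs0_le; rewrite divr_gt0// ltr_pwDr.
  rewrite /= -(@ler_pM2l _ `|h|)// -normrM mulrBr /shift /=.
  rewrite [h * (_ *: _)](_ : _ = f (h *: v + x) - f x); last first.
    by rewrite [_ *: _]/GRing.scale/= mulrA mulfV// mul1r.
  rewrite distrC; apply: le_trans (H h h1) _.
  rewrite -normr_id -real_normK ?num_real// expr2 normr_id mulrCA ler_pM2l//.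
  apply: le_trans (_ : (`|C| + 1) * `|h| <= _).
    by rewrite ler_wpM2r// (le_trans (ler_norm C))// lerDl.
  by rewrite mulrC -ler_pdivlMr// ltr_pwDr.
by apply: DeriveDef; [apply/cvg_ex; exists d | exact/cvg_lim].
Unshelve. all: by end_near. Qed.

End Rules.

Implicit Types (f g : R -> R) (a b x : R).

Lemma der_comp f g (x : R) (a b : R) : is_derive (g x) 1 f a -> is_derive x 1 g b ->
  is_derive x 1 (fun y => f (g y)) (a * b).
Proof. exact: is_derive1_comp. Qed.

Lemma der_id (x : R) : is_derive x 1 (fun y : R => y) (1 : R).
Proof. exact: is_derive_id. Qed.

Lemma der_continuous f (x : R) d : is_derive x 1 f d -> {for x, continuous f}.
Proof.
by move=> [fd _]; exact/differentiable_continuous/derivable1_diffP.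
Qed.

Lemma mean_value f (f' : R -> R) a b : a <= b -> (forall x, is_derive x 1 f (f' x)) ->
  exists2 c, a <= c <= b & f b - f a = f' c * (b - a).
Proof.
move=> ab df; have [|c cab E] := @MVT_segment _ f f' a b ab (fun x _ => df x).
  by apply/continuous_subspaceT => x; exact: der_continuous (df x).
by exists c => //; move: cab; rewrite in_itv.
Qed.

Lemma mean_value_norm f (f' : R -> R) a b : (forall x, is_derive x 1 f (f' x)) ->
  exists2 c, `|c - a| <= `|b - a| & f b - f a = f' c * (b - a).
Proof.
move=> df; have [ab|/ltW ba] := leP a b.
  have [c /andP[ac cb] E] := mean_value ab df; exists c => //.
  by rewrite !ger0_norm ?subr_ge0// lerD2r.
have [c /andP[bc ca] E] := mean_value ba df; exists c.
  by rewrite !ler0_norm ?subr_le0// lerN2 lerD2r.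
by rewrite -opprB E -mulrN opprB.
Qed.

Lemma ler_increment f f' g g' a b : a <= b ->
  (forall x, is_derive x 1 f (f' x)) -> (forall x, is_derive x 1 g (g' x)) ->
  (forall x, a <= x <= b -> f' x <= g' x) -> f b - f a <= g b - g a.
Proof.
move=> ab df dg le; rewrite -subr_ge0.
have [c cab] := mean_value ab (fun x => der_sub (dg x) (df x)).
rewrite (_ : _ - (_ - _) = g b - f b - (g a - f a)); last by ring.
by move=> ->; rewrite mulr_ge0 ?subr_ge0// le.
Qed.

Lemma ler_norm_increment f f' g g' a b : a <= b ->
  (forall x, is_derive x 1 f (f' x)) -> (forall x, is_derive x 1 g (g' x)) ->
  (forall x, a <= x <= b -> `|f' x| <= g' x) -> `|f b - f a| <= g b - g a.
Proof.
move=> ab df dg le; rewrite ler_norml; apply/andP; split.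
  rewrite lerNl.
  have := @ler_increment (fun x => - f x) _ g g' a b ab (fun x => der_opp (df x)) dg.
  rewrite opprB opprK addrC => -> // x /le; rewrite ler_norml => /andP[+ _].
  by rewrite lerNl.
by apply: (ler_increment ab df dg) => x /le; rewrite ler_norml => /andP[].
Qed.

Lemma der_exp (c x : R) : is_derive x 1 (fun y : R => expR (c * y)) (c * expR (c * x)).
Proof.
apply: (der_eq (der_comp (is_derive_expR _) (der_scale c (der_id x)))).
by rewrite mulr1 mulrC.
Qed.

Lemma der_reverse f f' (x : R) : (forall x, is_derive x 1 f (f' x)) ->
  is_derive x 1 (fun y => f (- y)) (- f' (- x)).
Proof.
move=> df; apply: (der_eq (der_comp (df _) (der_opp (der_id x)))).
by rewrite mulrN1.
Qed.

(* Integrating a bound [L C exp (2 L |t|)] halves the constant: Picard's map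
   contracts by 1/2 in the norm weighted by [exp (- 2 L |t|)]. *)
Lemma increment_le_exp f f' (L C t : R) : 0 < L ->
  (forall x, is_derive x 1 f (f' x)) ->
  (forall x, `|x| <= `|t| -> `|f' x| <= L * C * expR (2 * L * `|x|)) -> f 0 = 0 ->
  `|f t| <= C / 2 * expR (2 * L * `|t|).
Proof.
move=> L0; wlog t0 : f f' t / 0 <= t => [H df bf f0|df bf f0].
  have [t0|/ltW t0] := leP 0 t; first exact: (H _ _ _ _ df bf f0).
  have := @H (fun y => f (- y)) _ (- t) _ (fun x => der_reverse x df).
  rewrite oppr_ge0 opprK normrN oppr0; apply => // x xt.
  by rewrite normrN; rewrite -(normrN x); apply: bf; rewrite normrN.
have L2 : 2 * L != 0 by rewrite mulf_neq0 ?pnatr_eq0// gt_eqF.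
have C0 : 0 <= C.
  have := bf 0; rewrite normr0 normr_ge0 mulr0 expR0 mulr1 => /(_ isT).
  by move/(le_trans (normr_ge0 _)); rewrite pmulr_rge0.
have := @ler_norm_increment f f' (fun y => C / 2 * expR (2 * L * y))
  (fun y => C / 2 * (2 * L * expR (2 * L * y))) 0 t t0 df.
rewrite f0 subr0 mulr0 expR0 (ger0_norm t0) => H; apply: le_trans (H _ _) _.
- by move=> x; apply: der_scale; exact: der_exp.
- move=> x /andP[x0 xt].
  have := bf x; rewrite (ger0_norm x0) (ger0_norm t0) => /(_ xt) /le_trans; apply.
  by rewrite le_eqVlt; apply/orP; left; apply/eqP; field.
- by rewrite lerBlDr lerDl mulr1 divr_ge0.
Qed.

Lemma gronwall f f' (C t : R) :
  (forall x, is_derive x 1 f (f' x)) -> (forall x, `|f' x| <= C * f x) ->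
  f t <= f 0 * expR (C * `|t|).
Proof.
wlog t0 : f f' t / 0 <= t => [H df bf|df bf].
  have [t0|/ltW t0] := leP 0 t; first exact: (H _ _ _ _ df bf).
  have := @H (fun y => f (- y)) _ (- t) _ (fun x => der_reverse x df).
  by rewrite oppr_ge0 opprK normrN oppr0; apply => // x; rewrite normrN.
have := @ler_increment (fun y => f y * expR (- C * y)) _ (fun=> 0) (fun=> 0) 0 t t0
  (fun x => der_mul (df x) (der_exp (- C) x)) (der_cst 0 ^~ 1).
rewrite subr0 mulr0 expR0 mulr1 subr_le0 => H.
rewrite ger0_norm// -ler_pdivrMr ?expR_gt0// -expRN -mulNr; apply: H => x _.
rewrite mulrCA mulrA -mulrDl mulNr pmulr_lle0 ?expR_gt0// subr_le0.
exact: le_trans (ler_norm _) (bf x).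
Qed.

Lemma antiderivative_ge f (a : R) : continuous f ->
  exists F : R -> R, forall x, a < x -> is_derive x 1 F (f x).
Proof.
move=> cf; exists (fun x => Rintegral lebesgue_measure `[a, x] f) => x ax.
have [||||F1 F2] := @continuous_FTC1 R f (BLeft a) x (x + 1).
- by rewrite ltrDl.
- apply: continuous_compact_integrable; first exact: segment_compact.
  exact/continuous_subspaceT.
- by [].
- exact: cf.
- by apply: DeriveDef => //; rewrite -derive1E.
Qed.

(** The integral from a base point [a] is differentiable only to the right of [a]. The integrals
    from [-n], normalised to vanish at 0, agree wherever two of them are primitives, so they glue to
    a primitive on the whole line. *)
Lemma antiderivative f : continuous f ->
  exists F : R -> R, F 0 = 0 /\ forall x, is_derive x 1 F (f x).
Proof.
move=> cf; pose G a := projT1 (cid (antiderivative_ge a cf)).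
have dG a x : a < x -> is_derive x 1 (G a) (f x).
  by rewrite /G; case: cid => F /= h /h.
pose H n x := G (- n%:R) x - G (- n%:R) 0.
have dH n x : `|x| < n%:R -> is_derive x 1 (H n) (f x).
  rewrite ltr_norml => /andP[nx _]; rewrite -[f x]subr0.
  exact: (der_sub (dG _ _ nx) (der_cst _ _ _)).
have HH n m x : `|x| < n%:R -> `|x| < m%:R -> H n x = H m x.
  move=> xn xm.
  have n0 : (0 : R) < n%:R by apply: le_lt_trans xn.
  have m0 : (0 : R) < m%:R by apply: le_lt_trans xm.
  have D (y : R) : `|y| <= `|x| -> is_derive y 1 (fun y => H n y - H m y) 0.
    move=> yx; rewrite -(subrr (f y)).
    exact: (der_sub (dH _ _ (le_lt_trans yx xn)) (dH _ _ (le_lt_trans yx xm))).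
  have E0 : H n 0 - H m 0 = 0 by rewrite /H !subrr.
  suff: H n x - H m x = 0 by move/eqP; rewrite subr_eq0 => /eqP.
  have cD (y : R) : `|y| <= `|x| -> {for y, continuous (fun y => H n y - H m y)}.
    by move/D; exact: der_continuous.
  have [x0|/ltW x0] := leP 0 x.
    have [y yx||c cx] := @MVT_segment _ (fun y => H n y - H m y) (fun=> 0) 0 x x0.
    - move: yx; rewrite in_itv => /andP[y0 yx]; apply: D.
      by rewrite !ger0_norm// ltW.
    - apply: continuous_in_subspaceT => y; rewrite inE/= in_itv/= => /andP[y0 yx].
      by apply: cD; rewrite !ger0_norm.
    - by rewrite mul0r => /eqP; rewrite subr_eq0 => /eqP ->.
  have [y yx||c cx] := @MVT_segment _ (fun y => H n y - H m y) (fun=> 0) x 0 x0.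
  - move: yx; rewrite in_itv => /andP[y0 yx]; apply: D.
    by rewrite !ler0_norm// ?lerN2 ltW.
  - apply: continuous_in_subspaceT => y; rewrite inE/= in_itv/= => /andP[y0 yx].
    by apply: cD; rewrite !ler0_norm// lerN2.
  - by rewrite mul0r => /eqP; rewrite subr_eq0 => /eqP <-.
pose N x := (Num.truncn `|x| + 1)%N.
have NP x : `|x| < (N x)%:R :> R by rewrite /N addn1; exact: truncnS_gt.
exists (fun x => H (N x) x); split; first by rewrite /H subrr.
move=> x; pose n := (N x + 1)%N.
have xn : `|x| < n%:R.
  by apply: lt_trans (NP x) _; rewrite /n ltr_nat addn1.
apply: near_eq_is_derive (dH n x xn); near=> y; apply: HH; last exact: NP.
by near: y; exact: (@cvgr_norm_lt _ _ _ (nbhs x) _ id x cvg_id).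
Unshelve. all: by end_near. Qed.

End Calculus.

(** * Limits along an ultrafilter *)

Section UltraLimit.
Context {R : realType}.
Local Open Scope classical_set_scope.

(** Fixing one free ultrafilter replaces all extraction of subsequences: every bounded sequence
    converges along it, and limits commute with sums and products. *)
Definition ultra : set_system nat := projT1 (cid (ultraFilterLemma eventually_filter)).

Lemma ultra_ultra : UltraFilter ultra.
Proof. by rewrite /ultra; case: cid => G []. Qed.

Lemma ultra_eventually : eventually `<=` ultra.
Proof. by rewrite /ultra; case: cid => G []. Qed.

Instance ultra_properfilter : ProperFilter ultra.
Proof. exact: (@ultra_proper _ _ ultra_ultra). Qed.

Definition ucvg (f : nat -> R) (l : R) : Prop := f @ ultra --> l.

Implicit Types (f g : nat -> R) (a b : R).

Lemma ucvg_bounded f (C : R) : (forall n, `|f n| <= C) -> exists l, ucvg f l.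
Proof.
move=> fC; have := @segment_compact R (- C) C.
rewrite compact_ultra => /(_ (f @ ultra)) [||l [_ H]]; last by exists l.
- split=> [|G PG sG]; first exact: fmap_proper_filter.
  apply/seteqP; split=> // A GA.
  have [//|nA] := pselect ((f @ ultra) A).
  have UC : ultra (~` (f @^-1` A)).
    have [UA|//] := @in_ultra_setVsetC _ ultra (f @^-1` A) ultra_ultra.
    by case: nA.
  have GC : G (~` A) by apply: sG; rewrite nbhs_simpl.
  have := @filter_ex _ G PG (A `&` ~` A) (filterI GA GC).
  by move=> [y [Ay /(_ Ay)]].
- rewrite nbhs_simpl/=; apply: (filterS _ (@filterT _ ultra _)) => n _ /=.
  by rewrite in_itv/= -ler_norml.
Qed.

Lemma ucvg_unique f a b : ucvg f a -> ucvg f b -> a = b.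
Proof. exact: (@cvg_unique R (@Rhausdorff R) (f @ ultra)). Qed.

Lemma ucvg_cst a : ucvg (fun=> a) a.
Proof. exact: cvg_cst. Qed.

Lemma ucvg_eventually f a : f @ \oo --> a -> ucvg f a.
Proof. by move=> fa A /fa; exact: ultra_eventually. Qed.

Lemma ucvgD f g a b : ucvg f a -> ucvg g b -> ucvg (fun n => f n + g n) (a + b).
Proof. exact: cvgD. Qed.

Lemma ucvgN f a : ucvg f a -> ucvg (fun n => - f n) (- a).
Proof. exact: cvgN. Qed.

Lemma ucvgB f g a b : ucvg f a -> ucvg g b -> ucvg (fun n => f n - g n) (a - b).
Proof. exact: cvgB. Qed.

Lemma ucvgM f g a b : ucvg f a -> ucvg g b -> ucvg (fun n => f n * g n) (a * b).
Proof. exact: cvgM. Qed.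

Lemma ucvg_sum (J : Type) (r : seq J) (P : pred J) (f : J -> nat -> R) (a : J -> R) :
  (forall j, ucvg (f j) (a j)) ->
  ucvg (fun n => \sum_(j <- r | P j) f j n) (\sum_(j <- r | P j) a j).
Proof.
move=> fa; elim: r => [|j r IH].
  rewrite big_nil; rewrite (_ : (fun _ => _) = fun=> 0); first exact: ucvg_cst.
  by apply/funext => n; rewrite big_nil.
rewrite big_cons (_ : (fun _ => _) = (fun n => if P j then
  f j n + \sum_(i <- r | P i) f i n else \sum_(i <- r | P i) f i n)); last first.
  by apply/funext => y; rewrite big_cons.
by case: ifP => // _; exact: ucvgD.
Qed.

Lemma ultra_ge N : ultra [set n | (N <= n)%N].
Proof. by apply: ultra_eventually; exists N. Qed.

Lemma ucvg_le N f g a b : ucvg f a -> ucvg g b ->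
  (forall n, (N <= n)%N -> f n <= g n) -> a <= b.
Proof.
move=> fa gb le; apply: (@ler_cvg_to _ ultra _ _ f g) => //.
by apply: (filterS _ (ultra_ge N)) => n /= /le.
Qed.

Lemma ucvg_norm f a : ucvg f a -> ucvg (fun n => `|f n|) `|a|.
Proof. exact: cvg_norm. Qed.

Lemma ucvg_norm_le N f a b : ucvg f a -> (forall n, (N <= n)%N -> `|f n| <= b) ->
  `|a| <= b.
Proof.
move=> fa H; exact: (ucvg_le (ucvg_norm fa) (@ucvg_cst b) H).
Qed.

Lemma ucvg_inv_nat (c : R) : ucvg (fun n => c / n.+1%:R) 0.
Proof.
rewrite -(mulr0 c); apply: ucvgM; first exact: ucvg_cst.
exact/ucvg_eventually/cvg_harmonic.
Qed.

Lemma ucvg_squeeze N f a (e : nat -> R) : ucvg e 0 ->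
  (forall n, (N <= n)%N -> `|f n - a| <= e n) -> ucvg f a.
Proof.
move=> e0 fe; have H : ucvg (fun n => f n - a) 0.
  have e0' := ucvgN e0; rewrite oppr0 in e0'.
  apply: (squeeze_cvgr _ e0' e0).
  by apply: (filterS _ (ultra_ge N)) => n /= /fe; rewrite ler_norml.
have := ucvgD H (@ucvg_cst a); rewrite add0r.
by rewrite (_ : (fun n => _) = f)//; apply/funext => n; rewrite subrK.
Qed.

Lemma ucvg_ext N f g a : ucvg f a -> (forall n, (N <= n)%N -> g n = f n) -> ucvg g a.
Proof.
move=> fa gf; have H : ucvg (fun n => g n - f n) 0.
  apply: (@ucvg_squeeze N _ _ (fun=> 0)); first exact: ucvg_cst.
  by move=> n /gf ->; rewrite subrr subr0 normr0.
have := ucvgD H fa; rewrite add0r.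
by rewrite (_ : (fun n => _) = g)//; apply/funext => n; rewrite subrK.
Qed.

End UltraLimit.

(** * Ordinary differential equations *)

Section Picard.
Context {R : realType} {I : Type}.
Local Open Scope classical_set_scope.
Variables (X : (I -> R) -> I -> R) (L c : R) (x0 : I -> R).
Hypothesis L0 : 0 < L.
Hypothesis c0 : 0 <= c.
Hypothesis XL : forall x y (m : R), (forall j, `|x j - y j| <= m) ->
  forall i, `|X x i - X y i| <= L * m.
Hypothesis XB : forall i, `|X x0 i| <= L * c.

Let Lge0 : 0 <= L := ltW L0.
Let E (t : R) := expR (2 * L * `|t|).

Let E1 t : 1 <= E t.
Proof. by rewrite -expR0 ler_expR mulr_ge0// mulr_ge0// ltW. Qed.

Let E0 t : 0 <= E t.
Proof. exact: expR_ge0. Qed.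

Let E_le (s t : R) : `|s| <= t -> E s <= E t.
Proof.
move=> st; rewrite ler_expR ler_pM2l ?mulr_gt0//.
by rewrite (le_trans st)// ler_norm.
Qed.

(** The iterates have to be defined before their continuity is known, hence the default value on
    discontinuous functions. *)
Let primitive (f : R -> R) : R -> R :=
  match pselect (continuous f) with
  | left cf => projT1 (cid (antiderivative cf))
  | right _ => fun=> 0
  end.

Let primitiveP f : continuous f ->
  primitive f 0 = 0 /\ forall x, is_derive x (1 : R) (primitive f) (f x).
Proof.
by move=> cf; rewrite /primitive; case: pselect => // cf'; case: cid.
Qed.

Fixpoint picard_iter (k : nat) : R -> I -> R :=
  if k is k'.+1 then
    fun t i => x0 i + primitive (fun s => X (picard_iter k' s) i) t
  else fun=> x0.

Let X_le x t : (forall i, `|x i - x0 i| <= c * E t) ->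
  forall i, `|X x i| <= L * (2 * c) * E t.
Proof.
move=> H i; rewrite -(subrK (X x0 i) (X x i)).
apply: le_trans (ler_normD _ _) _.
have := XL H i; have := XB i.
have : L * c <= L * (c * E t) by rewrite mulrA ler_peMr// mulr_ge0.
lra.
Qed.

Let iter_continuous k : (forall s i, `|picard_iter k s i - x0 i| <= c * E s) ->
  (forall (S s t : R) i, `|s| <= S -> `|t| <= S ->
    `|picard_iter k t i - picard_iter k s i| <= L * (2 * c) * E S * `|t - s|) ->
  forall i, continuous (fun s => X (picard_iter k s) i).
Proof.
move=> _ H i t; apply/cvgrPdist_le => e e0.
pose D := L * (2 * c) * E (`|t| + 1).
have D0 : 0 <= D.
  by rewrite /D; rewrite !mulr_ge0.
near=> s.
have ts1 : `|t - s| <= 1.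
  by near: s; exact: (@cvgr_dist_le _ _ _ (nbhs t) _ id t cvg_id _ ltr01).
have s1 : `|s| <= `|t| + 1.
  by have := ler_normD (s - t) t; rewrite subrK distrC; lra.
have st : `|t - s| <= e / (L * D + 1).
  near: s; apply: (@cvgr_dist_le _ _ _ (nbhs t) _ id t cvg_id); by rewrite divr_gt0// ltr_wpDl// mulr_ge0.
have H' j : `|picard_iter k t j - picard_iter k s j| <= D * `|t - s|.
  by apply: H => //; rewrite lerDl.
apply: le_trans (XL H' i) _.
rewrite mulrA (@le_trans _ _ ((L * D + 1) * `|t - s|))// ?ler_wpM2r// ?lerDl//.
by rewrite mulrC -ler_pdivlMr// ltr_wpDl// mulr_ge0.
Unshelve. all: by end_near. Qed.

(** The three facts are proved together because they feed one another: confinement bounds the speed,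
    the speed bound makes the integrand of the next iterate continuous, and continuity gives its
    derivative. *)
Let iterP k :
  [/\ forall s i, `|picard_iter k s i - x0 i| <= c * E s,
      forall (S s t : R) i, `|s| <= S -> `|t| <= S ->
        `|picard_iter k t i - picard_iter k s i| <= L * (2 * c) * E S * `|t - s| &
      forall s i, is_derive s (1 : R) (picard_iter k.+1 ^~ i) (X (picard_iter k s) i)].
Proof.
have next k' : (forall s i, `|picard_iter k' s i - x0 i| <= c * E s) ->
    (forall (S s t : R) i, `|s| <= S -> `|t| <= S ->
      `|picard_iter k' t i - picard_iter k' s i| <= L * (2 * c) * E S * `|t - s|) ->
    forall s i, is_derive s (1 : R) (picard_iter k'.+1 ^~ i) (X (picard_iter k' s) i).
  move=> H1 H2 s i; have [_ D] := primitiveP (@iter_continuous _ H1 H2 i).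
  by rewrite -[X _ _]add0r; exact: (der_add (der_cst _ _ _) (D s)).
elim: k => [|k [H1 H2 H3]].
  suff H : [/\ forall s i, `|picard_iter 0 s i - x0 i| <= c * E s &
      forall (S s t : R) i, `|s| <= S -> `|t| <= S ->
      `|picard_iter 0 t i - picard_iter 0 s i| <= L * (2 * c) * E S * `|t - s|].
    by have [? ?] := H; split=> //; exact: next.
  split=> [s i|S s t i _ _].
    by rewrite /= subrr normr0; rewrite !mulr_ge0.
    by rewrite /= subrr normr0; rewrite !mulr_ge0.
suff H : [/\ forall s i, `|picard_iter k.+1 s i - x0 i| <= c * E s &
      forall (S s t : R) i, `|s| <= S -> `|t| <= S ->
      `|picard_iter k.+1 t i - picard_iter k.+1 s i| <= L * (2 * c) * E S * `|t - s|].
  by have [? ?] := H; split=> //; exact: next.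
split=> [s i|S s t i sS tS].
  have := @increment_le_exp _ (fun s => picard_iter k.+1 s i - x0 i)
    (fun s => X (picard_iter k s) i) L (2 * c) s L0.
  rewrite (_ : 2 * c / 2 = c); last by field.
  apply.
  - by move=> x; rewrite -[X _ _]subr0; exact: (der_sub (H3 x i) (der_cst _ _ _)).
  - by move=> x _; apply: X_le => j; exact: H1.
  - have [P0 _] := primitiveP (@iter_continuous _ H1 H2 i).
    by rewrite /= P0 addr0 subrr.
wlog st : s t sS tS / s <= t => [W|].
  have [st|/ltW ts] := leP s t; first exact: W.
  by rewrite distrC [`|t - s|]distrC; exact: W.
have [e /andP[se et] ->] := mean_value st (fun x => H3 x i).
rewrite normrM ler_wpM2r//; apply: le_trans (X_le (H1 e) i) _.
rewrite ler_wpM2l ?mulr_ge0//.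
apply: E_le.
move: sS tS; rewrite !ler_norml => /andP[sS _] /andP[_ tS].
by rewrite (le_trans sS se) (le_trans et tS).
Qed.

Let iter_diff k t i :
  `|picard_iter k.+1 t i - picard_iter k t i| <= c * 2^-1 ^+ k * E t.
Proof.
elim: k t i => [|k IH] t i.
  by rewrite expr0 mulr1; have [H _ _] := iterP 1; exact: H.
have [_ _ D1] := iterP k; have [_ _ D2] := iterP k.+1.
rewrite (_ : c * _ ^+ k.+1 = c * 2^-1 ^+ k / 2); last by rewrite exprSr mulrA.
have := @increment_le_exp _ (fun s => picard_iter k.+2 s i - picard_iter k.+1 s i)
    (fun s => X (picard_iter k.+1 s) i - X (picard_iter k s) i) L (c * 2^-1 ^+ k) t L0.
apply.
- by move=> x _; rewrite -mulrA; apply: XL => j; exact: IH.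
- rewrite /=.
  have [P1 _] := primitiveP (@iter_continuous _ (let: And3 a _ _ := iterP k in a)
    (let: And3 _ b _ := iterP k in b) i).
  have [P2 _] := primitiveP (@iter_continuous _ (let: And3 a _ _ := iterP k.+1 in a)
    (let: And3 _ b _ := iterP k.+1 in b) i).
  by rewrite P1 [primitive _ 0]P2 subrr.
Qed.

Let iter_cauchy k m t i :
  `|picard_iter (k + m) t i - picard_iter k t i| <= 2 * c * 2^-1 ^+ k * E t.
Proof.
(* Keeping the exact partial geometric sum makes the induction on [m] close with equality. *)
suff : `|picard_iter (k + m) t i - picard_iter k t i| <=
    2 * c * 2^-1 ^+ k * (1 - 2^-1 ^+ m) * E t.
  move/le_trans; apply; rewrite ler_wpM2r//.
  by rewrite ler_piMr ?mulr_ge0// ?exprn_ge0// gerBl exprn_ge0.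
elim: m => [|m IH].
  by rewrite addn0 subrr normr0 expr0 subrr mulr0 mul0r.
rewrite addnS -(subrK (picard_iter (k + m) t i) (picard_iter (k + m).+1 t i)) -addrA.
apply: le_trans (ler_normD _ _) _; apply: le_trans (lerD (iter_diff _ t i) IH) _.
rewrite exprD exprSr le_eqVlt; apply/orP; left; apply/eqP; by field.
Qed.

(** In the weight [exp (2 L |t|)] successive iterates approach one another by the factor 1/2 on the
    whole line, so the solution is global without continuation. *)
Theorem picard : exists x : R -> I -> R, x 0 = x0 /\
  forall t i, is_derive t (1 : R) (x ^~ i) (X (x t) i).
Proof.
have lim t i : exists l, ucvg (fun k => picard_iter k t i) l.
  apply: (@ucvg_bounded _ _ (c * E t + `|x0 i|)) => k.
  rewrite -(subrK (x0 i) (picard_iter k t i)) (le_trans (ler_normD _ _))// lerD2r.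
  by have [H _ _] := iterP k.
pose x t i := projT1 (cid (lim t i)).
have xl t i : ucvg (fun k => picard_iter k t i) (x t i) by rewrite /x; case: cid.
have xk k t i : `|picard_iter k t i - x t i| <= 2 * c * 2^-1 ^+ k * E t.
  rewrite distrC; apply: (@ucvg_norm_le _ k (fun m => picard_iter m t i - picard_iter k t i)).
    exact: (ucvgB (xl t i) (@ucvg_cst _ _)).
  by move=> m km; have := iter_cauchy k (m - k) t i; rewrite subnKC.
have half0 (a : R) : ucvg (fun k => a * 2^-1 ^+ k) 0.
  rewrite -(mulr0 a); apply: ucvgM; first exact: ucvg_cst.
  apply: ucvg_eventually; apply: cvg_expr.
  by rewrite ger0_norm// invf_lt1// ltr1n.
exists x; split.
  apply/funext => i; apply: (ucvg_unique (xl 0 i)).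
  apply: (@ucvg_ext _ 0 (fun=> x0 i)); first exact: ucvg_cst.
  move=> [//|n] _; have [H1 H2 _] := iterP n.
  by have [P0 _] := primitiveP (@iter_continuous _ H1 H2 i); rewrite /= P0 addr0.
move=> t i.
have XX s : ucvg (fun k => X (picard_iter k s) i) (X (x s) i).
  apply: (@ucvg_squeeze _ 0 _ _ (fun k => L * (2 * c * E s) * 2^-1 ^+ k)); first exact: half0.
  move=> k _; rewrite (_ : _ * _ = L * (2 * c * 2^-1 ^+ k * E s)); last by ring.
  by apply: XL => j; exact: xk.
(* [L] times the speed bound of all iterates on [[-|t|-1, |t|+1]]: the mean value theorem then gives
   a quadratic error uniform in the iterate. *)
pose D := L * (L * (2 * c) * E (`|t| + 1)).
apply: (@der_of_quadratic_bound _ _ _ _ _ _ D) => h h1.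
rewrite [h *: 1](_ : _ = h); last by rewrite /GRing.scale/= mulr1.
have xS k : ucvg (fun n => picard_iter n.+1 k i) (x k i).
  apply: (@ucvg_squeeze _ 0 _ _ (fun n => (2 * c * 2^-1 * E k) * 2^-1 ^+ n)); first exact: half0.
  move=> n _; apply: le_trans (xk n.+1 k i) _.
  by rewrite exprS le_eqVlt; apply/orP; left; apply/eqP; ring.
apply: (@ucvg_norm_le _ 0 (fun n => picard_iter n.+1 (h + t) i - picard_iter n.+1 t i -
   h * X (picard_iter n t) i)).
  apply: ucvgB; last by apply: ucvgM; [exact: ucvg_cst|exact: XX].
  by apply: ucvgB; exact: xS.
move=> n _; have [_ H2 H3] := iterP n.
have [e eh ->] := mean_value_norm t (h + t) (fun x => H3 x i).
rewrite addrK in eh *; rewrite mulrC -mulrBr normrM.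
have -> : D * h ^+ 2 = `|h| * (L * (L * (2 * c) * E (`|t| + 1) * `|h|)).
  by rewrite /D -[h ^+ 2]real_normK ?num_real//; ring.
rewrite ler_wpM2l//; apply: XL => j.
apply: le_trans (H2 (`|t| + 1) t e j _ _) _; first by rewrite lerDl.
  rewrite -(subrK t e) (le_trans (ler_normD _ _))// addrC lerD2l.
  exact: le_trans eh h1.
by rewrite ler_wpM2l//; rewrite !mulr_ge0.
Qed.

End Picard.

(** * Global solutions of locally Lipschitz systems that conserve the Euclidean norm *)

Section ConservativeODE.
Context {R : realType} {I : finType}.
Implicit Types (x y : I -> R) (f g : (I -> R) -> R) (m M : R).

(** Bounded and Lipschitz on every cube. The bound is carried along so that the class is stable
    under products and contains all polynomials. *)
Definition blip f := forall M, exists2 L, 0 <= L &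
  (forall x, (forall i, `|x i| <= M) -> `|f x| <= L) /\
  (forall x y m, 0 <= m -> (forall i, `|x i| <= M) -> (forall i, `|y i| <= M) ->
     (forall i, `|x i - y i| <= m) -> `|f x - f y| <= L * m).

Lemma blip_cst (c : R) : blip (fun=> c).
Proof.
move=> M; exists `|c| => //; split=> // x y m m0 _ _ _.
by rewrite subrr normr0 mulr_ge0.
Qed.

Lemma blip_coord i : blip (fun x => x i).
Proof.
move=> M; exists (`|M| + 1); first by rewrite addr_ge0.
split=> [x xM|x y m m0 _ _ xy].
  by rewrite (le_trans (xM i))// (le_trans (ler_norm M))// lerDl.
by rewrite (le_trans (xy i))// ler_peMl// lerDr.
Qed.

Lemma blip_add f g : blip f -> blip g -> blip (fun x => f x + g x).
Proof.
move=> bf bg M; have [L1 L10 [B1 D1]] := bf M; have [L2 L20 [B2 D2]] := bg M.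
exists (L1 + L2); first exact: addr_ge0.
split=> [x xM|x y m m0 xM yM xy].
  by rewrite (le_trans (ler_normD _ _))// lerD ?B1 ?B2.
rewrite (_ : _ - _ = f x - f y + (g x - g y)); last by ring.
by rewrite (le_trans (ler_normD _ _))// mulrDl lerD ?D1 ?D2.
Qed.

Lemma blip_mul f g : blip f -> blip g -> blip (fun x => f x * g x).
Proof.
move=> bf bg M; have [L1 L10 [B1 D1]] := bf M; have [L2 L20 [B2 D2]] := bg M.
exists (L1 * L2 + L1 * L2); first by rewrite addr_ge0 ?mulr_ge0.
split=> [x xM|x y m m0 xM yM xy].
  rewrite normrM (@le_trans _ _ (L1 * L2))// ?ler_pM ?B1 ?B2//.
  by rewrite lerDl mulr_ge0.
rewrite (_ : _ - _ = (f x - f y) * g x + f y * (g x - g y)); last by ring.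
rewrite (le_trans (ler_normD _ _))// !normrM mulrDl lerD//.
  by rewrite mulrAC ler_pM// ?D1 ?B2.
by rewrite -mulrA ler_pM// ?D2 ?B1.
Qed.

Lemma blip_opp f : blip f -> blip (fun x => - f x).
Proof.
move=> bf; have := blip_mul (blip_cst (-1)) bf.
by rewrite (_ : (fun x => -1 * _) = fun x => - f x)//; apply/funext => x; rewrite mulN1r.
Qed.

Lemma blip_sum (J : Type) (r : seq J) (P : pred J) (f : J -> (I -> R) -> R) :
  (forall j, blip (f j)) -> blip (fun x => \sum_(j <- r | P j) f j x).
Proof.
move=> bf; elim: r => [|j r IH].
  rewrite (_ : (fun x => _) = fun=> 0); first exact: blip_cst.
  by apply/funext => x; rewrite big_nil.
rewrite (_ : (fun x => _) = (fun x => (if P j then f j x else 0) +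
    \sum_(j <- r | P j) f j x)).
  by apply: blip_add => //; case: (P j) => //; exact: blip_cst.
by apply/funext => x; rewrite big_cons; case: (P j); rewrite ?add0r.
Qed.

Section RadialCutoff.
Variable rho : R.
Hypothesis rho1 : 1 <= rho.
Let rho0 : 0 < rho := lt_le_trans ltr01 rho1.

(** Dividing by [radial] is the identity on the ball where the squared norm is at most [rho], and
    maps the whole space into a cube. The squared norm avoids the square root. *)
Definition radial x : R := Num.max 1 ((\sum_i x i ^+ 2) / rho).
Definition retract x : I -> R := fun i => x i / radial x.

Let radial_gt0 x : 0 < radial x.
Proof. by rewrite (lt_le_trans ltr01)// le_max lexx. Qed.

Lemma coord_le_radial x i : `|x i| <= rho * radial x.
Proof.
have [x1|x1] := leP `|x i| 1.
  rewrite (le_trans x1)// (le_trans rho1)// ler_peMr//; first exact: ltW.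
  by rewrite le_max lexx.
apply: (@le_trans _ _ (rho * ((\sum_i x i ^+ 2) / rho))); last first.
  by rewrite ler_pM2l// le_max lexx orbT.
rewrite mulrC divfK ?gt_eqF// (bigD1 i)//= -real_normK ?num_real//.
apply: (@le_trans _ _ (`|x i| ^+ 2)).
  by rewrite expr2 ler_peMl// ltW.
by rewrite lerDl sumr_ge0// => j _; rewrite sqr_ge0.
Qed.

Lemma retract_le x i : `|retract x i| <= rho.
Proof.
rewrite /retract normrM normfV (gtr0_norm (radial_gt0 x)).
by rewrite ler_pdivrMr// coord_le_radial.
Qed.

Let radial_lip x y m : 0 <= m -> (forall i, `|x i - y i| <= m) ->
  `|radial x - radial y| <= #|I|%:R * m * (radial x + radial y).
Proof.
move=> m0 xy.
have H a b : `|Num.max 1 a - Num.max 1 b| <= `|a - b| :> R.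
  by rewrite /Num.max; case: ltP => h1; case: ltP => h2; rewrite !ler_norml;
    have := ler_norm (a - b); have := ler_norm (b - a);
    rewrite [`|b - a|]distrC => ? ?; apply/andP; split; lra.
apply: le_trans (H _ _) _; rewrite -mulrBl normrM normfV (gtr0_norm rho0).
rewrite ler_pdivrMr// -sumrB; apply: le_trans (ler_norm_sum _ _ _) _.
rewrite (_ : _ * rho = \sum_(i : I) m * (rho * radial x + rho * radial y)); last first.
  by rewrite sumr_const -[in RHS]mulr_natl; ring.
apply: ler_sum => i _; rewrite subr_sqr normrM ler_pM//.
by rewrite (le_trans (ler_normD _ _))// lerD// coord_le_radial.
Qed.

Lemma retract_lip x y m : 0 <= m -> (forall i, `|x i - y i| <= m) ->
  forall i, `|retract x i - retract y i| <= (1 + 2 * rho * #|I|%:R) * m.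
Proof.
wlog le : x y / radial y <= radial x => [W|] m0 xy i.
  have [le|/ltW le] := leP (radial y) (radial x); first exact: W.
  by rewrite distrC; apply: W => // j; rewrite distrC.
have X0 := radial_gt0 x; have Y0 := radial_gt0 y.
(* The change of [radial] is compared with the larger of the two values, so [radial x + radial y]
   costs only a factor 2. *)
rewrite /retract (_ : _ - _ = (x i - y i) / radial x +
  (y i / radial y) * ((radial y - radial x) / radial x)); last first.
  by field; rewrite !gt_eqF.
rewrite (le_trans (ler_normD _ _))// [X in _ <= X]mulrDl mul1r lerD//.
  rewrite normrM normfV (gtr0_norm X0) ler_pdivrMr// (le_trans (xy i))//.
  by rewrite ler_peMr// le_max lexx.
rewrite normrM (_ : _ * m = rho * (#|I|%:R * m * 2)); last by ring.
rewrite ler_pM//; first exact: retract_le.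
rewrite normrM normfV (gtr0_norm X0) ler_pdivrMr// distrC.
apply: le_trans (radial_lip m0 xy) _.
rewrite -[X in _ <= X]mulrA ler_wpM2l ?mulr_ge0//.
by rewrite mulr_natl mulr2n lerD2l.
Qed.

End RadialCutoff.

(** Composing [X] with [retract] makes it globally Lipschitz. As [retract x] is a positive multiple
    of [x], the modified field is still orthogonal to [x], so the norm is conserved and the solution
    never leaves the ball where the modification is the identity. *)
Theorem conservative_ode (X : (I -> R) -> I -> R) (x0 : I -> R) :
  (forall i, blip (X ^~ i)) -> (forall x, \sum_i x i * X x i = 0) ->
  exists x : R -> I -> R, [/\ x 0 = x0,
    forall t i, is_derive t (1 : R) (x ^~ i) (X (x t) i) &
    forall t, \sum_i x t i ^+ 2 = \sum_i x0 i ^+ 2].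
Proof.
move=> bX X0; pose rho := \sum_i x0 i ^+ 2 + 1.
have rho1 : 1 <= rho by rewrite lerDr sumr_ge0// => i _; exact: sqr_ge0.
have LX i : exists L, 0 <= L /\ forall x y m, 0 <= m -> (forall i, `|x i| <= rho) ->
    (forall i, `|y i| <= rho) -> (forall i, `|x i - y i| <= m) ->
    `|X x i - X y i| <= L * m.
  by have [L L0 [_ H]] := bX i rho; exists L.
pose Li i := projT1 (cid (LX i)).
have Li0 i : 0 <= Li i by rewrite /Li; case: cid => L [].
have LiP i : forall x y m, 0 <= m -> (forall i, `|x i| <= rho) ->
    (forall i, `|y i| <= rho) -> (forall i, `|x i - y i| <= m) ->
    `|X x i - X y i| <= Li i * m by rewrite /Li; case: cid => L [].
pose A := \sum_i Li i + 1; pose K := 1 + 2 * rho * #|I|%:R.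
have A0 : 0 < A by rewrite ltr_pwDr// sumr_ge0.
have LiA i : Li i <= A.
  by rewrite /A (bigD1 i)//= -addrA lerDl addr_ge0// sumr_ge0.
have K0 : 0 < K by rewrite ltr_pwDl// !mulr_ge0// (le_trans ler01).
pose Y x := X (retract rho x).
have [x [x00 xD]] : exists x : R -> I -> R, x 0 = x0 /\
    forall t i, is_derive t (1 : R) (x ^~ i) (Y (x t) i).
  apply: (@picard _ _ Y (A * K) (\sum_i `|Y x0 i| / (A * K))); first exact: mulr_gt0.
  - by apply: sumr_ge0 => i _; rewrite divr_ge0// mulr_ge0// ltW.
  - move=> x y m xy i; have m0 : 0 <= m by apply: le_trans (xy i).
    rewrite -mulrA (@le_trans _ _ (Li i * (K * m)))//; last first.
      by rewrite ler_wpM2r// mulr_ge0// ltW.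
    apply: LiP; [by rewrite mulr_ge0// ltW|exact: retract_le|exact: retract_le|].
    exact: retract_lip.
  - move=> i; rewrite -mulr_suml mulrC divfK ?mulf_neq0 ?gt_eqF//.
    by rewrite (bigD1 i)//= lerDl sumr_ge0.
have mass t : \sum_i x t i ^+ 2 = \sum_i x0 i ^+ 2.
  rewrite -x00; apply: (@is_derive_0_is_cst R (fun t => \sum_i x t i ^+ 2)) => s.
  have H i : true -> is_derive s (1 : R) (fun t => x t i ^+ 2) (2 * (x s i * Y (x s) i)).
    move=> _; rewrite (_ : (fun t => _) = fun t => x t i * x t i); last first.
      by apply/funext => u; rewrite expr2.
    by apply: (der_eq (der_mul (xD s i) (xD s i))); ring.
  apply: (der_eq (der_sum (index_enum I) (P := xpredT) H)).
  rewrite -mulr_sumr (_ : \sum_(i <- _ | _) _ = 0) ?mulr0//.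
  have rx0 : radial rho (x s) != 0.
    by rewrite gt_eqF// (lt_le_trans ltr01)// le_max lexx.
  apply: (mulfI (invr_neq0 rx0)); rewrite mulr0 mulr_sumr -[RHS](X0 (retract rho (x s))).
  by apply: eq_bigr => i _; rewrite /Y /retract mulrA [_^-1 * _]mulrC.
exists x; split => // t i.
rewrite (_ : X (x t) i = Y (x t) i); first exact: xD.
congr (X _ i); apply/funext => j; rewrite /retract (_ : radial _ _ = 1) ?divr1//.
apply/max_idPl; rewrite mass ler_pdivrMr ?(lt_le_trans ltr01)// mul1r.
by rewrite lerDl.
Qed.

End ConservativeODE.

(** * Galerkin truncations in the basis cos((2l+1)x) *)

Section Tensor.
Context {R : realType}.
Implicit Types (f g h w : nat -> R) (i j k l n : nat).

(* The interaction coefficients of the basis [cos ((2 i + 1) x)]: [4 T i j k l] counts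
   the sign patterns with [(2i+1) +- (2j+1) +- (2k+1) +- (2l+1) = 0]. *)
Definition T i j k l : R :=
  ((i + j + k + 1 == l)%N%:R + (i + j + l + 1 == k)%N%:R +
   (i + k + l + 1 == j)%N%:R + (j + k + l + 1 == i)%N%:R +
   (i + j == k + l)%N%:R + (i + k == j + l)%N%:R + (j + k == i + l)%N%:R) / 4.

Lemma T_ge0 i j k l : 0 <= T i j k l.
Proof. by rewrite /T divr_ge0// !addr_ge0. Qed.

Lemma T_swap12 i j k l : T i j k l = T j i k l.
Proof.
rewrite /T (addnC j i).
by congr (_ / 4); ring.
Qed.

Lemma T_swap23 i j k l : T i j k l = T i k j l.
Proof.
rewrite /T (_ : (i + k + j = i + j + k)%N); last by lia.
rewrite (addnC k j).
by congr (_ / 4); ring.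
Qed.

Lemma T_swap34 i j k l : T i j k l = T i j l k.
Proof.
rewrite /T (_ : (i + l + k = i + k + l)%N); last by lia.
rewrite (_ : (j + l + k = j + k + l)%N); last by lia.
rewrite (addnC l k).
rewrite [(i + l == j + k)%N]eq_sym [(j + l == i + k)%N]eq_sym.
by congr (_ / 4); ring.
Qed.

Let ind_le1 (a : nat) n : \sum_(l < n) (a == l)%N%:R <= 1 :> R.
Proof.
have [an|na] := ltnP a n.
  rewrite (bigD1 (Ordinal an))//= eqxx big1 ?addr0// => l.
  by rewrite -val_eqE/= eq_sym => /negPf ->.
rewrite big1// => l _; rewrite (_ : (_ == _) = false)//.
by apply/eqP => E; have := ltn_ord l; rewrite -E ltnNge na.
Qed.

Let ind_le1' (b a : nat) n : \sum_(l < n) (b + l == a)%N%:R <= 1 :> R.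
Proof.
have [ba|ab] := leqP b a.
  rewrite (eq_bigr (fun l : 'I_n => (a - b == l)%N%:R)) ?ind_le1// => l _.
  by congr (_%:R); congr nat_of_bool; apply/eqP/eqP; lia.
rewrite big1// => l _; rewrite (_ : (_ == _) = false)//.
by apply/eqP; lia.
Qed.

(** Each of the seven resonance conditions determines [l] from [i], [j], [k], so the sum is at most
    7/4. *)
Lemma T_sum_le i j k n : \sum_(l < n) T i j k l <= 2.
Proof.
rewrite /T -mulr_suml !big_split /= ler_pdivrMr//.
have h1 := ind_le1 (i + j + k + 1) n.
have h2 : \sum_(l < n) (i + j + l + 1 == k)%N%:R <= 1 :> R.
  rewrite (eq_bigr (fun l : 'I_n => (i + j + 1 + l == k)%N%:R)) ?ind_le1'// => l _.
  by rewrite addnAC.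
have h3 : \sum_(l < n) (i + k + l + 1 == j)%N%:R <= 1 :> R.
  rewrite (eq_bigr (fun l : 'I_n => (i + k + 1 + l == j)%N%:R)) ?ind_le1'// => l _.
  by rewrite addnAC.
have h4 : \sum_(l < n) (j + k + l + 1 == i)%N%:R <= 1 :> R.
  rewrite (eq_bigr (fun l : 'I_n => (j + k + 1 + l == i)%N%:R)) ?ind_le1'// => l _.
  by rewrite addnAC.
have h5 : \sum_(l < n) (i + j == k + l)%N%:R <= 1 :> R.
  by under eq_bigr do rewrite eq_sym; exact: ind_le1'.
have h6 : \sum_(l < n) (i + k == j + l)%N%:R <= 1 :> R.
  by under eq_bigr do rewrite eq_sym; exact: ind_le1'.
have h7 : \sum_(l < n) (j + k == i + l)%N%:R <= 1 :> R.
  by under eq_bigr do rewrite eq_sym; exact: ind_le1'.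
lra.
Qed.

Lemma T_le2 i j k l : T i j k l <= 2.
Proof.
apply: le_trans (T_sum_le i j k l.+1).
by rewrite big_ord_recr/= lerDr sumr_ge0// => *; exact: T_ge0.
Qed.

Lemma T_support i j k l : T i j k l != 0 -> (l <= i + j + k + 1)%N.
Proof.
apply: contra_neqT; rewrite -ltnNge => H; rewrite /T.
by do 7 (case: eqP => [?|_]; first by lia); rewrite !add0r mul0r.
Qed.

Definition freq l : R := (2 * l + 1)%:R.

Lemma freq_ge1 l : 1 <= freq l.
Proof. by rewrite /freq natrD lerDr. Qed.

Lemma freq_gt0 l : 0 < freq l.
Proof. exact: lt_le_trans ltr01 (freq_ge1 l). Qed.

Lemma freqX_gt0 m l : 0 < freq l ^+ m.
Proof. by rewrite exprn_gt0// freq_gt0. Qed.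

(** The output frequency is at most three times the largest input frequency. All [m] derivatives
    fall on a single factor, which keeps the Sobolev estimate linear in the squared norm. *)
Lemma T_freq_add m i j k l : T i j k l * freq l ^+ m <=
  T i j k l * (3 ^+ m * (freq i ^+ m + freq j ^+ m + freq k ^+ m)).
Proof.
have [->|/T_support H] := eqVneq (T i j k l) 0; first by rewrite !mul0r.
rewrite ler_wpM2l ?T_ge0//.
have K a : (l <= 3 * a + 1)%N -> freq l ^+ m <= 3 ^+ m * freq a ^+ m.
  move=> la; rewrite -exprMn lerXn2r ?nnegrE ?mulr_ge0 ?(ltW (freq_gt0 _))//.
  by rewrite /freq -natrM ler_nat; lia.
have P a : 0 <= freq a ^+ m by exact/ltW/freqX_gt0.
have M : 0 <= 3 ^+ m :> R by rewrite exprn_ge0.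
have [a aP] : exists2 a, a \in [:: i; j; k] & (l <= 3 * a + 1)%N.
  have [h|h] := leqP l (3 * i + 1); first by exists i; rewrite // !inE eqxx.
  have [h'|h'] := leqP l (3 * j + 1); first by exists j; rewrite // !inE eqxx ?orbT.
  by exists k; [rewrite !inE eqxx ?orbT|lia].
move/K/le_trans; apply; rewrite ler_wpM2l//.
move: aP; rewrite !inE => /or3P[] /eqP ->; have := P i; have := P j; have := P k; lra.
Qed.

(** Cruder than [T_freq_add], using that frequencies are at least 1, but factorised, so that the
    triple sum becomes a cube. *)
Lemma T_freq_mul m i j k l : T i j k l * freq l ^+ m <=
  T i j k l * (3 ^+ m * (freq i ^+ m * freq j ^+ m * freq k ^+ m)).
Proof.
have [->|/T_support H] := eqVneq (T i j k l) 0; first by rewrite !mul0r.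
rewrite ler_wpM2l ?T_ge0// -!exprMn lerXn2r ?nnegrE ?mulr_ge0 ?(ltW (freq_gt0 _))//.
by rewrite /freq -!natrM ler_nat; nia.
Qed.

Definition quad n (F : nat -> nat -> nat -> nat -> R) : R :=
  \sum_(x : 'I_n * 'I_n * 'I_n * 'I_n)
    T x.1.1.1 x.1.1.2 x.1.2 x.2 * F x.1.1.1 x.1.1.2 x.1.2 x.2.

Lemma quad_swap12 n F : quad n F = quad n (fun i j k l => F j i k l).
Proof.
rewrite /quad (reindex_inj (h := fun x : 'I_n * 'I_n * 'I_n * 'I_n =>
  (x.1.1.2, x.1.1.1, x.1.2, x.2))) /=.
  by apply: eq_bigr => x _; rewrite T_swap12.
by move=> [[[? ?] ?] ?] [[[? ?] ?] ?] /= [-> -> -> ->].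
Qed.

Lemma quad_swap23 n F : quad n F = quad n (fun i j k l => F i k j l).
Proof.
rewrite /quad (reindex_inj (h := fun x : 'I_n * 'I_n * 'I_n * 'I_n =>
  (x.1.1.1, x.1.2, x.1.1.2, x.2))) /=.
  by apply: eq_bigr => x _; rewrite T_swap23.
by move=> [[[? ?] ?] ?] [[[? ?] ?] ?] /= [-> -> -> ->].
Qed.

Lemma quad_swap34 n F : quad n F = quad n (fun i j k l => F i j l k).
Proof.
rewrite /quad (reindex_inj (h := fun x : 'I_n * 'I_n * 'I_n * 'I_n =>
  (x.1.1.1, x.1.1.2, x.2, x.1.2))) /=.
  by apply: eq_bigr => x _; rewrite T_swap34.
by move=> [[[? ?] ?] ?] [[[? ?] ?] ?] /= [-> -> -> ->].
Qed.

Lemma quadD n F G : quad n (fun i j k l => F i j k l + G i j k l) = quad n F + quad n G.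
Proof. by rewrite /quad -big_split; apply: eq_bigr => x _; rewrite mulrDr. Qed.

Lemma quadZ n c F : quad n (fun i j k l => c * F i j k l) = c * quad n F.
Proof. by rewrite /quad mulr_sumr; apply: eq_bigr => x _; rewrite mulrCA. Qed.

Lemma le_quad n F G :
  (forall i j k l, T i j k l * F i j k l <= T i j k l * G i j k l) -> quad n F <= quad n G.
Proof. by move=> le; apply: ler_sum => x _. Qed.

Lemma quad_le_triple n (F : nat -> nat -> nat -> R) : (forall i j k, 0 <= F i j k) ->
  quad n (fun i j k l => F i j k) <= 2 * \sum_(i < n) \sum_(j < n) \sum_(k < n) F i j k.
Proof.
move=> F0; rewrite /quad -(pair_bigA _ (fun (x : 'I_n * 'I_n * 'I_n) (l : 'I_n) =>
  T x.1.1 x.1.2 x.2 l * F x.1.1 x.1.2 x.2))/=.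
rewrite -(pair_bigA _ (fun (x : 'I_n * 'I_n) (k : 'I_n) =>
  \sum_(l < n) T x.1 x.2 k l * F x.1 x.2 k))/=.
rewrite -(pair_bigA _ (fun (i j : 'I_n) => \sum_(k < n)
  \sum_(l < n) T i j k l * F i j k))/=.
rewrite mulr_sumr ler_sum// => i _; rewrite mulr_sumr ler_sum// => j _.
by rewrite mulr_sumr ler_sum// => k _; rewrite -mulr_suml ler_wpM2r// T_sum_le.
Qed.

Lemma sum_triple n f g h :
  \sum_(i < n) \sum_(j < n) \sum_(k < n) f i * g j * h k =
  (\sum_(i < n) f i) * (\sum_(i < n) g i) * (\sum_(i < n) h i).
Proof.
rewrite !mulr_suml; apply: eq_bigr => i _; rewrite [f i * _]mulr_sumr mulr_suml.
by apply: eq_bigr => j _; rewrite mulr_sumr.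
Qed.

(** Up to the factor [pi], the integral over a period of the product of four cosine series
    ([mean_cubic]); [tri] gives the cosine coefficients of a product of three. *)
Definition form n f g h w := quad n (fun i j k l => f i * g j * h k * w l).

Definition tri n f g h l : R := \sum_(x : 'I_n * 'I_n * 'I_n)
  T x.1.1 x.1.2 x.2 l * (f x.1.1 * g x.1.2 * h x.2).

Lemma sum_tri n f g h w : \sum_(l < n) tri n f g h l * w l = form n f g h w.
Proof.
rewrite /form /quad.
rewrite -(pair_bigA _ (fun (x : 'I_n * 'I_n * 'I_n) (l : 'I_n) =>
  T x.1.1 x.1.2 x.2 l * (f x.1.1 * g x.1.2 * h x.2 * w l)))/= exchange_big.
by apply: eq_bigr => l _; rewrite mulr_suml; apply: eq_bigr => x _; rewrite !mulrA.
Qed.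

Lemma form_swap12 n f g h w : form n f g h w = form n g f h w.
Proof.
rewrite /form quad_swap12; congr quad.
by apply/funext => i; apply/funext => j; apply/funext => k; apply/funext => l; ring.
Qed.

Lemma form_swap23 n f g h w : form n f g h w = form n f h g w.
Proof.
rewrite /form quad_swap23; congr quad.
by apply/funext => i; apply/funext => j; apply/funext => k; apply/funext => l; ring.
Qed.

Lemma form_swap34 n f g h w : form n f g h w = form n f g w h.
Proof.
rewrite /form quad_swap34; congr quad.
by apply/funext => i; apply/funext => j; apply/funext => k; apply/funext => l; ring.
Qed.

Lemma norm_tri n f g h l :
  `|tri n f g h l| <= tri n (fun i => `|f i|) (fun i => `|g i|) (fun i => `|h i|) l.
Proof.
apply: le_trans (ler_norm_sum _ _ _) _; apply: ler_sum => x _.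
by rewrite normrM (ger0_norm (T_ge0 _ _ _ _)) !normrM.
Qed.

(** The index [l] is arbitrary: the decay for [l >= n] is what makes the discarded modes small. *)
Lemma tri_weighted_le m n (a : nat -> R) l : (forall i, 0 <= a i) ->
  tri n a a a l * freq l ^+ m <= 2 * 3 ^+ m * (\sum_(i < n) freq i ^+ m * a i) ^+ 3.
Proof.
move=> a0; rewrite /tri mulr_suml.
pose b i := freq i ^+ m * a i.
have b0 i : 0 <= b i by apply: mulr_ge0 => //; exact/ltW/freqX_gt0.
apply: (@le_trans _ _ (\sum_(x : 'I_n * 'I_n * 'I_n)
    2 * (3 ^+ m * (b x.1.1 * b x.1.2 * b x.2)))).
  apply: ler_sum => x _; rewrite mulrAC.
  apply: le_trans (ler_wpM2r _ (T_freq_mul m _ _ _ _)) _; first by rewrite !mulr_ge0.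
  rewrite [X in X <= _](_ : _ = T x.1.1 x.1.2 x.2 l * (3 ^+ m * (b x.1.1 * b x.1.2 * b x.2))).
    rewrite ler_wpM2r ?T_le2//; apply: mulr_ge0; first by rewrite exprn_ge0.
    exact: mulr_ge0 (mulr_ge0 (b0 _) (b0 _)) (b0 _).
  by rewrite /b; ring.
rewrite -!mulr_sumr mulrA ler_wpM2l ?mulr_ge0 ?exprn_ge0//.
rewrite -(pair_bigA _ (fun (x : 'I_n * 'I_n) (k : 'I_n) => b x.1 * b x.2 * b k))/=.
rewrite -(pair_bigA _ (fun (i j : 'I_n) => \sum_(k < n) b i * b j * b k))/=.
by rewrite (sum_triple n b b b) /b exprSr expr2.
Qed.

(** A Schur test: [x_i x_l] is at most half of [x_i^2 + x_l^2], the symmetry of [T] identifies the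
    two halves, and the free index is summed by [T_sum_le]. *)
Lemma form_square_le n (a x : nat -> R) : (forall i, 0 <= a i) ->
  form n x a a x <= 2 * (\sum_(i < n) a i) ^+ 2 * \sum_(i < n) x i ^+ 2.
Proof.
move=> a0.
have H : quad n (fun i j k l => x i ^+ 2 * a j * a k) <=
    2 * (\sum_(i < n) a i) ^+ 2 * \sum_(i < n) x i ^+ 2.
  apply: le_trans (quad_le_triple _ _) _ => [i j k|].
    by rewrite mulr_ge0// mulr_ge0// sqr_ge0.
  rewrite (sum_triple n (fun i => x i ^+ 2) a a) le_eqVlt.
  by apply/orP; left; apply/eqP; ring.
apply: (@le_trans _ _ (quad n (fun i j k l =>
    2^-1 * (x i ^+ 2 * a j * a k) + 2^-1 * (x l ^+ 2 * a j * a k)))).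
  apply: le_quad => i j k l; rewrite ler_wpM2l ?T_ge0//.
  rewrite -subr_ge0 (_ : _ - _ = 2^-1 * (x i - x l) ^+ 2 * (a j * a k)).
    apply: mulr_ge0; last by rewrite mulr_ge0.
    by apply: mulr_ge0; [rewrite invr_ge0|exact: sqr_ge0].
  by field.
rewrite quadD !quadZ [quad n (fun i j k l => x l ^+ 2 * _ * _)](_ : _ =
  quad n (fun i j k l => x i ^+ 2 * a j * a k)).
  by have := H; lra.
by rewrite [LHS]quad_swap34 [LHS]quad_swap23 [LHS]quad_swap12 [LHS]quad_swap23 [LHS]quad_swap34.
Qed.

(** Only two factors carry the weight; the other two enter through their plain sum, which the energy
    controls. This makes Gronwall applicable at every order [m]. *)
Lemma form_tame m n (a : nat -> R) : (forall i, 0 <= a i) ->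
  \sum_(l < n) tri n a a a l * (freq l ^+ m * freq l ^+ m * a l) <=
  6 * 3 ^+ m * (\sum_(i < n) a i) ^+ 2 * \sum_(i < n) (freq i ^+ m * a i) ^+ 2.
Proof.
move=> a0; rewrite (sum_tri n a a a (fun l => freq l ^+ m * freq l ^+ m * a l)).
pose b i := freq i ^+ m * a i.
have b0 i : 0 <= b i by apply: mulr_ge0 => //; exact/ltW/freqX_gt0.
apply: (@le_trans _ _ (3 ^+ m * (form n b a a b + form n a b a b + form n a a b b))).
  rewrite -!quadD -quadZ; apply: le_quad => i j k l.
  have nn : 0 <= a i * a j * a k * b l by apply: mulr_ge0 (b0 l); rewrite !mulr_ge0.
  have := ler_wpM2r nn (T_freq_add m i j k l); rewrite /b.
  by congr (_ <= _); ring.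
rewrite (form_swap12 n a b) (form_swap23 n a a b) (form_swap12 n a b).
have := form_square_le n b a0; set S := _ * \sum_(i < n) _ => H.
have M : 0 <= 3 ^+ m :> R by rewrite exprn_ge0.
have := ler_wpM2l M H; rewrite /S /b; nra.
Qed.

End Tensor.

(** * The truncated flow, its mass and its energy *)

Section Galerkin.
Context {R : realType}.
Implicit Types (p q : R -> nat -> R) (A t : R) (l n : nat) (a b w : nat -> R).

Definition cubic_re n (a b : nat -> R) l : R := tri n a a a l + tri n b b a l.
Definition cubic_im n (a b : nat -> R) l : R := tri n a a b l + tri n b b b l.

Definition field_re n (a b : nat -> R) l : R :=
  if (l < n)%N then - (freq l ^+ 2 * b l + cubic_im n a b l) else 0.
Definition field_im n (a b : nat -> R) l : R :=
  if (l < n)%N then freq l ^+ 2 * a l + cubic_re n a b l else 0.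

Record galerkin A n p q : Prop := Galerkin {
  galerkin_re0 : p 0 = fun l => if l == 0%N then A else 0;
  galerkin_im0 : q 0 = fun=> 0;
  galerkin_high : forall t l, (n <= l)%N -> p t l = 0 /\ q t l = 0;
  galerkin_dre : forall t l, is_derive t (1 : R) (p ^~ l) (field_re n (p t) (q t) l);
  galerkin_dim : forall t l, is_derive t (1 : R) (q ^~ l) (field_im n (p t) (q t) l) }.

Lemma sum_cubic_re n a b w :
  \sum_(l < n) cubic_re n a b l * w l = form n a a a w + form n b b a w.
Proof.
rewrite -!sum_tri -big_split; apply: eq_bigr => l _; exact: mulrDl.
Qed.

Lemma sum_cubic_im n a b w :
  \sum_(l < n) cubic_im n a b l * w l = form n a a b w + form n b b b w.
Proof.
rewrite -!sum_tri -big_split; apply: eq_bigr => l _; exact: mulrDl.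
Qed.

Lemma field_mass n a b :
  \sum_(l < n) (a l * field_re n a b l + b l * field_im n a b l) = 0.
Proof.
rewrite (eq_bigr (fun l : 'I_n => cubic_re n a b l * b l - cubic_im n a b l * a l)).
  rewrite sumrB sum_cubic_re sum_cubic_im.
  rewrite (form_swap34 n a a b) (form_swap34 n b b b).
  by ring.
by move=> l _; rewrite /field_re /field_im ltn_ord; ring.
Qed.

Section Existence.
Variable n : nat.
Let I := (bool * 'I_n)%type.

Let ext (x : I -> R) (b : bool) l : R :=
  if insub l is Some l' then x (b, l') else 0.

Let extE x (b : bool) (l : 'I_n) : ext x b l = x (b, l).
Proof. by rewrite /ext valK. Qed.

Let blip_ext (b : bool) l : blip (fun x => ext x b l).
Proof.
rewrite /ext; case: insubP => [l' _ _|_]; first exact: blip_coord.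
exact: blip_cst.
Qed.

Let blip_tri (b1 b2 b3 : bool) l : blip (fun x => tri n (ext x b1) (ext x b2) (ext x b3) l).
Proof.
apply: blip_sum => y; apply: blip_mul; first exact: blip_cst.
by apply: blip_mul; [apply: blip_mul|]; exact: blip_ext.
Qed.

Lemma galerkin_exists A : (0 < n)%N -> exists p q, galerkin A n p q.
Proof.
move=> n0.
pose X (x : I -> R) (i : I) := let a := ext x false in let b := ext x true in
  if i.1 then freq i.2 ^+ 2 * a i.2 + cubic_re n a b i.2
  else - (freq i.2 ^+ 2 * b i.2 + cubic_im n a b i.2).
pose x0 (i : I) := if i == (false, Ordinal n0) then A else 0.
have bX i : blip (X ^~ i).
  case: i => [[] l]; rewrite /X /=.
    apply: blip_add; first by apply: blip_mul; [exact: blip_cst|exact: blip_ext].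
    by apply: blip_add; exact: blip_tri.
  apply: blip_opp; apply: blip_add.
    by apply: blip_mul; [exact: blip_cst|exact: blip_ext].
  by apply: blip_add; exact: blip_tri.
have X0 x : \sum_i x i * X x i = 0.
  rewrite (eq_bigr (fun i : I => x (i.1, i.2) * X x (i.1, i.2))); last by case.
  rewrite -(pair_bigA _ (fun (b : bool) (l : 'I_n) => x (b, l) * X x (b, l)))/=.
  rewrite big_bool -big_split /= -[RHS](field_mass n (ext x false) (ext x true)).
  apply: eq_bigr => l _; rewrite /X /field_re /field_im ltn_ord /= !extE; ring.
have [x [x00 xD _]] := conservative_ode x0 bX X0.
exists (fun t l => ext (x t) false l), (fun t l => ext (x t) true l).
have hi t (b : bool) l : (n <= l)%N -> ext (x t) b l = 0.
  by move=> nl; rewrite /ext insubF// ltnNge nl.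
have ext_hi (b : bool) l : (n <= l)%N -> (fun t => ext (x t) b l) = fun=> 0.
  by move=> nl; apply/funext => t; exact: hi.
have ext_lo (b : bool) (l : 'I_n) : (fun t => ext (x t) b l) = fun t => x t (b, l).
  by apply/funext => t; exact: extE.
split.
- apply/funext => l; rewrite x00 /ext; case: insubP => [l' _ <-|].
    by rewrite /x0 xpair_eqE eqxx/= -val_eqE.
  by rewrite -leqNgt; case: l => [|//]; rewrite leqNgt n0.
- by apply/funext => l; rewrite x00 /ext; case: insubP.
- by move=> t l nl; rewrite !hi.
- move=> t l; have [ln|nl] := ltnP l n.
    have := xD t (false, Ordinal ln); rewrite /X/= /field_re ln.
    by rewrite -(ext_lo false (Ordinal ln)).
  by rewrite ext_hi// /field_re ltnNge nl; exact: der_cst.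
- move=> t l; have [ln|nl] := ltnP l n.
    have := xD t (true, Ordinal ln); rewrite /X/= /field_im ln.
    by rewrite -(ext_lo true (Ordinal ln)).
  by rewrite ext_hi// /field_im ltnNge nl; exact: der_cst.
Qed.

End Existence.

Lemma der_sqr (f : R -> R) t d : is_derive t (1 : R) f d ->
  is_derive t (1 : R) (fun s => f s ^+ 2) (2 * (f t * d)).
Proof.
move=> fd; rewrite (_ : (fun s => _) = fun s => f s * f s).
  by apply: (der_eq (der_mul fd fd)); ring.
by apply/funext => s; rewrite expr2.
Qed.

Lemma der_form n (f g h w : R -> nat -> R) (f' g' h' w' : nat -> R) t :
  (forall l, is_derive t (1 : R) (f ^~ l) (f' l)) ->
  (forall l, is_derive t (1 : R) (g ^~ l) (g' l)) ->
  (forall l, is_derive t (1 : R) (h ^~ l) (h' l)) ->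
  (forall l, is_derive t (1 : R) (w ^~ l) (w' l)) ->
  is_derive t (1 : R) (fun s => form n (f s) (g s) (h s) (w s))
    (form n f' (g t) (h t) (w t) + form n (f t) g' (h t) (w t) +
     (form n (f t) (g t) h' (w t) + form n (f t) (g t) (h t) w')).
Proof.
move=> df dg dh dw; rewrite /form -!quadD /quad; apply: der_sum => x _.
apply: der_scale.
apply: (der_eq (der_mul (der_mul (der_mul (df _) (dg _)) (dh _)) (dw _))); ring.
Qed.

Section Conservation.
Variables (A : R) (n : nat) (p q : R -> nat -> R).
Hypothesis G : galerkin A n p q.
Hypothesis n0 : (0 < n)%N.

Let dp := galerkin_dre G.
Let dq := galerkin_dim G.

Lemma sum_initial (w : nat -> R) :
  \sum_(l < n) w l * (p 0 l ^+ 2 + q 0 l ^+ 2) = w 0%N * A ^+ 2.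
Proof.
rewrite (galerkin_re0 G) (galerkin_im0 G) (bigD1 (Ordinal n0))//= big1 => [|l].
  by rewrite expr0n/= !addr0.
by rewrite -val_eqE/= => /negPf ->; rewrite expr0n/= addr0 mulr0.
Qed.

Lemma galerkin_mass t : \sum_(l < n) (p t l ^+ 2 + q t l ^+ 2) = A ^+ 2.
Proof.
transitivity (\sum_(l < n) (p 0 l ^+ 2 + q 0 l ^+ 2)); last first.
  by have := sum_initial (fun=> 1); rewrite mul1r => <-; apply: eq_bigr => l _; rewrite mul1r.
apply: (@is_derive_0_is_cst R (fun t => \sum_(l < n) (p t l ^+ 2 + q t l ^+ 2))) => s.
apply: (der_eq (der_sum_ord n (fun l => der_add (der_sqr (dp s l)) (der_sqr (dq s l))))).
transitivity (2 * \sum_(l < n) (p s l * field_re n (p s) (q s) l +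
    q s l * field_im n (p s) (q s) l)); last by rewrite field_mass mulr0.
rewrite mulr_sumr; by apply: eq_bigr => l _; ring.
Qed.

(** Up to the factor [pi], the integral of [|u|^4] over a period ([mean_quartic]). *)
Definition quartic n (a b : nat -> R) : R :=
  form n a a a a + 2 * form n a a b b + form n b b b b.

(** Since [form] is symmetric in its four arguments, [4 cubic_re] and [4 cubic_im] are the gradients
    of [quartic] in [a] and [b]. *)
Lemma der_quartic t : is_derive t (1 : R) (fun s => quartic n (p s) (q s))
  (4 * (\sum_(l < n) cubic_re n (p t) (q t) l * field_re n (p t) (q t) l +
        \sum_(l < n) cubic_im n (p t) (q t) l * field_im n (p t) (q t) l)).
Proof.
have P l := dp t l; have Q l := dq t l.
have D := der_add (der_add (der_form n P P P P)
  (der_scale 2 (der_form n P P Q Q))) (der_form n Q Q Q Q).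
apply: (der_eq D); rewrite sum_cubic_re sum_cubic_im.
set a := p t; set b := q t; set a' := field_re n a b; set b' := field_im n a b.
have M1 f g h : form n f g g h = form n g g f h.
  by rewrite (form_swap12 n f) (form_swap23 n g f).
have M2 f g h : form n f g h h = form n g h h f :> R.
  by rewrite (form_swap12 n f) (form_swap23 n g f) (form_swap34 n g h f).
have E1 f f' : form n f' f f f = form n f f f f' :> R.
  by rewrite (form_swap12 n f' f) (form_swap23 n f f') (form_swap34 n f f f').
have E2 f f' : form n f f' f f = form n f f f f' :> R.
  by rewrite (form_swap23 n f f') (form_swap34 n f f f').
have E3 f f' : form n f f f' f = form n f f f f' :> R by rewrite (form_swap34 n f f f').
rewrite !E1 !E2 !E3.
have F1 : form n a' a b b = form n b b a a'.
  by rewrite (form_swap12 n a') (form_swap23 n a a') (form_swap34 n a b a')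
    (form_swap12 n a b) (form_swap23 n b a).
have F2 : form n a a' b b = form n b b a a'.
  by rewrite (form_swap12 n a a') F1.
have F3 : form n a a b b' = form n a a b b' by [].
have F4 : form n a a b' b = form n a a b b' by rewrite (form_swap34 n a a b').
rewrite F1 F2 F4; ring.
Qed.

(** The derivative is twice the sum of [q' p' - p' q'], by the form of the field. On the right, 3/8
    is half of [T 0 0 0 0 = 3/4]. *)
Lemma galerkin_energy t :
  \sum_(l < n) freq l ^+ 2 * (p t l ^+ 2 + q t l ^+ 2) + 2^-1 * quartic n (p t) (q t) =
  A ^+ 2 + 3 / 8 * A ^+ 4.
Proof.
transitivity (\sum_(l < n) freq l ^+ 2 * (p 0 l ^+ 2 + q 0 l ^+ 2) +
    2^-1 * quartic n (p 0) (q 0)).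
  apply: (@is_derive_0_is_cst R (fun t => \sum_(l < n) freq l ^+ 2 *
    (p t l ^+ 2 + q t l ^+ 2) + 2^-1 * quartic n (p t) (q t))) => s.
  have D := der_add (der_sum_ord n (fun l =>
    der_scale (freq l ^+ 2) (der_add (der_sqr (dp s l)) (der_sqr (dq s l)))))
    (der_scale 2^-1 (der_quartic s)).
  apply: (der_eq D); rewrite mulrA -big_split/= mulr_sumr -big_split/= big1// => l _.
  by rewrite /field_re /field_im ltn_ord; field.
rewrite (sum_initial (fun l => freq l ^+ 2)) /freq muln0 add0n expr1n mul1r.
congr (_ + _); rewrite /quartic (galerkin_re0 G) (galerkin_im0 G) /form /quad.
rewrite (bigD1 (Ordinal n0, Ordinal n0, Ordinal n0, Ordinal n0))//= big1 => [|x].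
  rewrite big1 => [|x _]; last by rewrite mulr0 mulr0.
  rewrite big1 => [|x _]; last by rewrite mulr0 mulr0.
  by rewrite /T/=; field.
case: x => [[[i j] k] l]; rewrite !xpair_eqE -!val_eqE/=.
by do 4 (case: eqP => //= _; rewrite ?(mul0r, mulr0)//).
Qed.

End Conservation.
End Galerkin.

(** * Trigonometric series and their integrals over a period *)

Section Trigonometry.
Context {R : realType}.
Implicit Types (f g h : R -> R) (a b : nat -> R) (k l m n : nat) (x y : R).

Lemma der_scale_id (c x : R) : is_derive x (1 : R) (fun y : R => c * y) c.
Proof. by apply: (der_eq (der_scale c (der_id x))); rewrite mulr1. Qed.

Lemma der_cos_scale (c x : R) :
  is_derive x (1 : R) (fun y : R => cos (c * y)) (- c * sin (c * x)).
Proof.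
apply: (der_eq (der_comp (is_derive_cos _) (der_scale_id c x))); ring.
Qed.

Lemma der_sin_scale (c x : R) :
  is_derive x (1 : R) (fun y : R => sin (c * y)) (c * cos (c * x)).
Proof.
apply: (der_eq (der_comp (is_derive_sin _) (der_scale_id c x))); ring.
Qed.

Lemma cos_periodic_int x (z : int) : cos (x + 2 * pi * z%:~R) = cos x :> R.
Proof.
have N y n : cos (y + 2 * pi * n%:R) = cos y :> R.
  rewrite -[RHS](periodicn (@cosD2pi R) n); congr cos; congr (_ + _).
  by rewrite -[RHS]mulr_natr mulr_natl.
by case: z => n; [exact: N|rewrite NegzE mulrNz mulrN -[LHS](N _ n.+1) subrK].
Qed.

Lemma sin_periodic_int x (z : int) : sin (x + 2 * pi * z%:~R) = sin x :> R.
Proof. by rewrite -!cosBpihalf addrAC cos_periodic_int. Qed.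

(** The [k]-th derivative of [cos], as a phase shift: this avoids a case distinction on [k] modulo
    4. *)
Definition cosd k y : R := cos (y + k%:R * (pi / 2)).

Lemma cosd0 y : cosd 0 y = cos y.
Proof. by rewrite /cosd mul0r addr0. Qed.

Lemma cosdS k y : cosd k.+1 y = - sin (y + k%:R * (pi / 2)).
Proof. by rewrite /cosd -natr1 mulrDl mul1r addrA cosDpihalf. Qed.

Lemma cosdSS k y : cosd k.+2 y = - cosd k y.
Proof. by rewrite cosdS -natr1 mulrDl mul1r addrA sinDpihalf. Qed.

Lemma norm_cosd k y : `|cosd k y| <= 1.
Proof. exact: cos_max. Qed.

Lemma cosd_periodic k y (z : int) : cosd k (y + 2 * pi * z%:~R) = cosd k y.
Proof. by rewrite /cosd addrAC cos_periodic_int. Qed.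

Lemma der_cosd_scale k (c x : R) :
  is_derive x (1 : R) (fun y => cosd k (c * y)) (c * cosd k.+1 (c * x)).
Proof.
apply: (der_eq (der_comp (is_derive_cos _)
  (der_add (der_scale_id c x) (der_cst (k%:R * (pi / 2)) x 1)))).
by rewrite cosdS; ring.
Qed.

(** The [k]-th derivative of the cosine polynomial with coefficients [a]. *)
Definition tser n k a x : R := \sum_(l < n) freq l ^+ k * a l * cosd k (freq l * x).

Lemma der_tser n k a x : is_derive x (1 : R) (tser n k a) (tser n k.+1 a x).
Proof.
apply: (der_eq (der_sum_ord n (fun l => der_scale (freq l ^+ k * a l)
  (der_cosd_scale k (freq l) x)))).
by apply: eq_bigr => l _; rewrite exprS; ring.
Qed.

Lemma tser_periodic n k a x (z : int) : tser n k a (x + 2 * pi * z%:~R) = tser n k a x.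
Proof.
apply: eq_bigr => l _; congr (_ * _).
rewrite mulrDr -[RHS](cosd_periodic k _ ((2 * l + 1)%:Z * z)).
by rewrite intrM /freq; congr cosd; ring.
Qed.

Lemma tser_period n k a : tser n k a (2 * pi) = tser n k a 0.
Proof. by have := tser_periodic n k a 0 1; rewrite add0r mulr1. Qed.

Lemma tserSS n k a x : tser n k.+2 a x = - tser n k (fun l => freq l ^+ 2 * a l) x.
Proof.
rewrite /tser -sumrN; apply: eq_bigr => l _.
by rewrite cosdSS !exprS expr0; ring.
Qed.

Let pick_sum (m c : nat) (F : nat -> R) : (c < m)%N ->
  \sum_(l < m) (c == l)%N%:R * F l = F c.
Proof.
move=> cm; rewrite (bigD1 (Ordinal cm))//= eqxx mul1r big1 ?addr0// => l.
by rewrite -val_eqE/= eq_sym => /negPf ->; rewrite mul0r.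
Qed.

Let pick0 (m : nat) (F : nat -> R) (P : nat -> bool) : (forall l, ~~ P l) ->
  \sum_(l < m) (P l)%:R * F l = 0.
Proof. by move=> NP; apply: big1 => l _; rewrite (negPf (NP l)) mul0r. Qed.

(* One sign pattern: [|(2i+1) + (2j+1) - (2k+1)|] is again an odd frequency. *)
Let pick_diff (m i j k : nat) x : (i + j + k + 1 < m)%N ->
  \sum_(l < m) ((i + j + l + 1 == k)%N%:R + (i + j == k + l)%N%:R) * cos (freq l * x) =
  cos ((freq i + freq j - freq k) * x).
Proof.
move=> ijk; under eq_bigr do rewrite mulrDl; rewrite big_split /=.
pose c (l : nat) := cos (freq l * x).
have [H|H] := leqP k (i + j).
  rewrite (@pick0 m c (fun l => (i + j + l + 1 == k)%N)); last by move=> l; lia.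
  rewrite (eq_bigr (fun l : 'I_m => (i + j - k == l)%N%:R * c l)); last first.
    by move=> l _; congr (_%:R * _); congr nat_of_bool; apply/eqP/eqP; lia.
  rewrite (pick_sum c) ?add0r /c; last by lia.
  rewrite /freq; congr (cos (_ * x)).
  have -> : i = ((i + j - k) + k - j)%N by lia.
  rewrite -!natrD -natrB; last by lia.
  by congr (_%:R); lia.
rewrite addrC (@pick0 m c (fun l => (i + j == k + l)%N)); last by move=> l; lia.
rewrite (eq_bigr (fun l : 'I_m => (k - (i + j + 1) == l)%N%:R * c l)); last first.
  by move=> l _; congr (_%:R * _); congr nat_of_bool; apply/eqP/eqP; lia.
rewrite (pick_sum c) ?add0r /c; last by lia.
rewrite -[RHS]cosN -mulNr opprB /freq; congr (cos (_ * x)).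
by rewrite -natrD -natrB; [congr (_%:R); lia|lia].
Qed.

(** The product formula yields four cosines of weight 1/4. The frequency [freq i + freq j + freq k]
    has index [i + j + k + 1], the largest that occurs; each of the other three cosines has exactly
    one index, given by one of two conditions in [T]. *)
Lemma cos_product3 (m i j k : nat) x : (i + j + k + 1 < m)%N ->
  \sum_(l < m) T i j k l * cos (freq l * x) =
  cos (freq i * x) * cos (freq j * x) * cos (freq k * x) :> R.
Proof.
move=> ijk.
have E1 : \sum_(l < m) (i + j + k + 1 == l)%N%:R * cos (freq l * x) =
    cos ((freq i + freq j + freq k) * x).
  rewrite (@pick_sum m _ (fun l => cos (freq l * x)))// /freq.
  by rewrite -!natrD; congr (cos (_%:R * x)); lia.
have E2 := @pick_diff m i j k x ijk.
have ijk3 : (i + k + j + 1 < m)%N by lia.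
have E3 := @pick_diff m i k j x ijk3.
have ijk4 : (j + k + i + 1 < m)%N by lia.
have E4 := @pick_diff m j k i x ijk4.
transitivity ((cos ((freq i + freq j + freq k) * x) + cos ((freq i + freq j - freq k) * x)
   + cos ((freq i + freq k - freq j) * x) + cos ((freq j + freq k - freq i) * x)) / 4).
  rewrite -E1 -E2 -E3 -E4 -!big_split mulr_suml; apply: eq_bigr => l _.
  by rewrite /T /=; field.
rewrite !(mulrDl, mulrBl, mulNr) !(cosD, cosN, sinD, sinN); by field.
Qed.

(** [3 * n] modes hold the whole product, since [i + j + k + 1 <= 3 (n - 1) + 1]. *)
Lemma tri_tser n m (f g h : nat -> R) x : (3 * n <= m)%N ->
  \sum_(l < m) tri n f g h l * cos (freq l * x) =
  tser n 0 f x * tser n 0 g x * tser n 0 h x.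
Proof.
move=> nm; rewrite /tri; under eq_bigr do rewrite mulr_suml.
rewrite exchange_big /tser /=.
under [X in X * _ * _]eq_bigr do rewrite expr0 mul1r cosd0.
under [X in _ * X * _]eq_bigr do rewrite expr0 mul1r cosd0.
under [X in _ * _ * X]eq_bigr do rewrite expr0 mul1r cosd0.
rewrite -(sum_triple n (fun l => f l * cos (freq l * x))
  (fun l => g l * cos (freq l * x)) (fun l => h l * cos (freq l * x))).
rewrite (pair_bigA _ (fun (i j : 'I_n) => \sum_(k < n) f i * cos (freq i * x) *
  (g j * cos (freq j * x)) * (h k * cos (freq k * x))))/=.
rewrite (pair_bigA _ (fun (y : 'I_n * 'I_n) (k : 'I_n) => f y.1 * cos (freq y.1 * x) *
  (g y.2 * cos (freq y.2 * x)) * (h k * cos (freq k * x))))/=.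
apply: eq_bigr => y _.
rewrite (eq_bigr (fun l : 'I_m => f y.1.1 * g y.1.2 * h y.2 *
  (T y.1.1 y.1.2 y.2 l * cos (freq l * x)))); last by move=> l _; ring.
rewrite -mulr_sumr cos_product3; first by ring.
by have := ltn_ord y.1.1; have := ltn_ord y.1.2; have := ltn_ord y.2; lia.
Qed.

End Trigonometry.

(** * Integrals over a period *)

Section Mean.
Context {R : realType}.
Local Open Scope classical_set_scope.
Implicit Types (f g F : R -> R) (x : R).

(** The working class of integrands: stable under ring operations and contained in the continuous,
    hence integrable, functions. *)
Definition dble f := forall x, exists d, is_derive x (1 : R) f d.

Lemma dble_continuous f : dble f -> continuous f.
Proof. by move=> df x; have [d /der_continuous] := df x. Qed.

Lemma dble_cst (c : R) : dble (fun=> c).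
Proof. by move=> x; exists 0; exact: der_cst. Qed.

Lemma dble_add f g : dble f -> dble g -> dble (fun x => f x + g x).
Proof.
by move=> df dg x; have [a fa] := df x; have [b gb] := dg x;
  exists (a + b); exact: der_add.
Qed.

Lemma dble_opp f : dble f -> dble (fun x => - f x).
Proof. by move=> df x; have [a fa] := df x; exists (- a); exact: der_opp. Qed.

Lemma dble_mul f g : dble f -> dble g -> dble (fun x => f x * g x).
Proof.
by move=> df dg x; have [a fa] := df x; have [b gb] := dg x;
  eexists; exact: der_mul.
Qed.

Lemma dble_exp f k : dble f -> dble (fun x => f x ^+ k).
Proof.
move=> df; elim: k => [|k IH]; first exact: dble_cst.
by rewrite (_ : (fun x => _) = fun x => f x * f x ^+ k);
  [exact: dble_mul|apply/funext => x; rewrite exprS].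
Qed.

Lemma dble_sum n (f : nat -> R -> R) : (forall i, dble (f i)) ->
  dble (fun x => \sum_(i < n) f i x).
Proof.
move=> df; elim: n => [|n IH].
  by rewrite (_ : (fun x => _) = fun=> 0); [exact: dble_cst|
    apply/funext => x; rewrite big_ord0].
by rewrite (_ : (fun x => _) = fun x => \sum_(i < n) f i x + f n x);
  [exact: dble_add|apply/funext => x; rewrite big_ord_recr].
Qed.

Lemma dble_tser n k a : dble (tser n k a).
Proof. by move=> x; exists (tser n k.+1 a x); exact: der_tser. Qed.

Lemma dble_cos (c : R) : dble (fun x => cos (c * x)).
Proof. by move=> x; eexists; exact: der_cos_scale. Qed.

Lemma dble_sin (c : R) : dble (fun x => sin (c * x)).
Proof. by move=> x; eexists; exact: der_sin_scale. Qed.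

(** Not normalised: constants are multiplied by [2 * pi]. *)
Definition mean f : R := Rintegral lebesgue_measure `[0, 2 * pi] f.

Let pi2_gt0 : 0 < 2 * pi :> R.
Proof. by rewrite mulr_gt0// pi_gt0. Qed.

Lemma mean_integrable f : dble f ->
  lebesgue_measure.-integrable `[0, 2 * pi] (EFin \o f).
Proof.
move=> df; apply: continuous_compact_integrable; first exact: segment_compact.
exact/continuous_subspaceT/dble_continuous.
Qed.

Lemma meanD f g : dble f -> dble g -> mean (fun x => f x + g x) = mean f + mean g.
Proof. by move=> df dg; rewrite /mean RintegralD//; exact: mean_integrable. Qed.

Lemma meanZ (c : R) f : dble f -> mean (fun x => c * f x) = c * mean f.
Proof. by move=> df; rewrite /mean RintegralZl//; exact: mean_integrable. Qed.

Lemma meanN f : dble f -> mean (fun x => - f x) = - mean f.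
Proof.
move=> df; rewrite -mulN1r -meanZ//; congr mean.
by apply/funext => x; rewrite mulN1r.
Qed.

Lemma meanB f g : dble f -> dble g -> mean (fun x => f x - g x) = mean f - mean g.
Proof. by move=> df dg; rewrite meanD ?meanN//; exact: dble_opp. Qed.

Lemma mean_cst (c : R) : mean (fun=> c) = 2 * pi * c.
Proof.
rewrite /mean Rintegral_cst//= lebesgue_measure_itv/= lte_fin pi2_gt0.
by rewrite -EFinB /= subr0 mulrC.
Qed.

Lemma mean_sum n (f : nat -> R -> R) : (forall i, dble (f i)) ->
  mean (fun x => \sum_(i < n) f i x) = \sum_(i < n) mean (f i).
Proof.
move=> df; elim: n => [|n IH].
  rewrite big_ord0 -[RHS](mulr0 (2 * pi)) -mean_cst; congr mean.
  by apply/funext => x; rewrite big_ord0.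
rewrite big_ord_recr/= -IH -meanD//; last exact: dble_sum.
by congr mean; apply/funext => x; rewrite big_ord_recr.
Qed.

Lemma mean_le f g : dble f -> dble g -> (forall x, f x <= g x) -> mean f <= mean g.
Proof.
by move=> df dg fg; apply: le_Rintegral => //; exact: mean_integrable.
Qed.

Lemma mean_norm_le f (c : R) : dble f -> (forall x, `|f x| <= c) ->
  `|mean f| <= 2 * pi * c.
Proof.
move=> df fc; rewrite ler_norml -mulrN -!mean_cst; apply/andP; split.
  by apply: mean_le => // [|x]; [exact: dble_cst|have := fc x; rewrite ler_norml => /andP[]].
by apply: mean_le => // [|x]; [exact: dble_cst|have := fc x; rewrite ler_norml => /andP[]].
Qed.

Lemma mean_derivative F f : (forall x, is_derive x (1 : R) F (f x)) -> dble f ->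
  F (2 * pi) = F 0 -> mean f = 0.
Proof.
move=> dF df F0; rewrite /mean /Rintegral (@continuous_FTC2 _ f F)//.
- by rewrite -EFinB /= F0 subrr.
- exact/continuous_subspaceT/dble_continuous.
- have cF : continuous F by move=> x; exact: der_continuous (dF x).
  split=> [x _||]; first by have [] := dF x.
  + exact/cvg_at_right_filter/cF.
  + exact/cvg_at_left_filter/cF.
- by move=> x _; rewrite derive1E; have [] := dF x.
Qed.

(** All integrations by parts take this form: one exhibits a periodic [F] whose derivative is the
    difference of the integrands, and the rest is a ring identity. *)
Lemma mean_by_parts F f g : (forall x, is_derive x (1 : R) F (f x - g x)) ->
  dble f -> dble g -> F (2 * pi) = F 0 -> mean f = mean g.
Proof.
move=> dF df dg F0; apply/eqP; rewrite -subr_eq0 -meanB//; apply/eqP.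
apply: (mean_derivative dF) => //; apply: dble_add => //; exact: dble_opp.
Qed.

Lemma cos_int_period (z : int) : cos (z%:~R * (2 * pi)) = 1 :> R.
Proof. by rewrite -[RHS]cos0 -[RHS](cos_periodic_int _ z) add0r mulrC. Qed.

Lemma sin_int_period (z : int) : sin (z%:~R * (2 * pi)) = 0 :> R.
Proof. by rewrite -[RHS]sin0 -[RHS](sin_periodic_int _ z) add0r mulrC. Qed.

Lemma mean_cos (z : int) : z != 0 -> mean (fun x => cos (z%:~R * x)) = 0.
Proof.
move=> z0; have z0' : z%:~R != 0 :> R by rewrite intr_eq0.
apply: (@mean_derivative (fun x => z%:~R^-1 * sin (z%:~R * x))).
- move=> x; apply: (der_eq (der_scale _ (der_sin_scale _ _))).
  by rewrite mulrA mulVf// mul1r.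
- exact: dble_cos.
- by rewrite sin_int_period !mulr0 sin0 mulr0.
Qed.

Lemma mean_sin (z : int) : mean (fun x => sin (z%:~R * x)) = 0.
Proof.
have [->|z0] := eqVneq z 0.
  rewrite (_ : (fun x => _) = fun=> 0) ?mean_cst ?mulr0//.
  by apply/funext => x; rewrite mul0r sin0.
have z0' : z%:~R != 0 :> R by rewrite intr_eq0.
apply: (@mean_derivative (fun x => - z%:~R^-1 * cos (z%:~R * x))).
- move=> x; apply: (der_eq (der_scale _ (der_cos_scale _ _))).
  by rewrite mulrA mulrNN mulVf// mul1r.
- exact: dble_sin.
- by rewrite cos_int_period mulr0 cos0.
Qed.

Lemma mean_cos_cos (z w : int) : z + w != 0 ->
  mean (fun x => cos (z%:~R * x) * cos (w%:~R * x)) = if z == w then pi else 0.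
Proof.
move=> zw.
rewrite (_ : (fun x => _) = fun x => 2^-1 * (cos ((z + w)%:~R * x) + cos ((z - w)%:~R * x))).
  rewrite meanZ; last by apply: dble_add; exact: dble_cos.
  rewrite meanD; [|exact: dble_cos|exact: dble_cos].
  rewrite mean_cos// add0r; case: eqVneq => [->|zw'].
    rewrite (_ : (fun x => _) = fun=> 1) ?mean_cst ?mulr1 ?mulrA ?mulVf ?mul1r//.
    by apply/funext => x; rewrite subrr mul0r cos0.
  by rewrite mean_cos ?mulr0// subr_eq0.
apply/funext => x; rewrite intrD intrB !(mulrDl, mulNr) !(cosD, cosN, sinN); by field.
Qed.

Lemma mean_cos_freq l m :
  mean (fun x => cos (freq l * x) * cos (freq m * x)) = if l == m then pi else 0.
Proof.
have := @mean_cos_cos (2 * l + 1)%:Z (2 * m + 1)%:Z.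
rewrite (_ : (_ == _ :> int) = (l == m)); last by apply/eqP/eqP; lia.
by apply; lia.
Qed.

Lemma mean_tser_mul n (a b : nat -> R) :
  mean (fun x => tser n 0 a x * tser n 0 b x) = pi * \sum_(l < n) a l * b l.
Proof.
rewrite (_ : (fun x => _) = fun x => \sum_(l < n) \sum_(m < n)
  (a l * b m) * (cos (freq l * x) * cos (freq m * x))); last first.
  apply/funext => x; rewrite /tser mulr_suml; apply: eq_bigr => l _.
  rewrite mulr_sumr; apply: eq_bigr => m _; rewrite !cosd0; ring.
pose cc l m x := (a l * b m) * (cos (freq l * x) * cos (freq m * x)).
have dcc l m : dble (cc l m).
  by apply: dble_mul; [exact: dble_cst|apply: dble_mul; exact: dble_cos].
rewrite (@mean_sum n (fun l x => \sum_(m < n) cc l m x)); last by move=> l; exact: dble_sum.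
rewrite mulr_sumr; apply: eq_bigr => l _; rewrite (@mean_sum n (cc l))//.
have E m : mean (cc l m) = if l == m :> nat then pi * (a l * b m) else 0.
  rewrite /cc meanZ ?mean_cos_freq; last by apply: dble_mul; exact: dble_cos.
  by case: ifP => _; rewrite ?mulr0// mulrC.
rewrite (bigD1 l)//= E eqxx big1 ?addr0// => m.
by rewrite -val_eqE/= eq_sym E => /negPf ->.
Qed.

Lemma mean_tser1_sqr n (a : nat -> R) :
  mean (fun x => tser n 1 a x ^+ 2) = pi * \sum_(l < n) freq l ^+ 2 * a l ^+ 2.
Proof.
transitivity (mean (fun x => tser n 0 (fun l => freq l ^+ 2 * a l) x * tser n 0 a x)).
  apply: (@mean_by_parts (fun x => tser n 1 a x * tser n 0 a x)).
  - move=> x; apply: (der_eq (der_mul (der_tser n 1 a x) (der_tser n 0 a x))).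
    by rewrite tserSS; ring.
  - exact/dble_exp/dble_tser.
  - by apply: dble_mul; exact: dble_tser.
  - by rewrite !tser_period.
rewrite mean_tser_mul; congr (_ * _); apply: eq_bigr => l _; ring.
Qed.

Lemma mean_density n (a b : nat -> R) :
  mean (fun x => tser n 0 a x ^+ 2 + tser n 0 b x ^+ 2) =
  pi * \sum_(l < n) (a l ^+ 2 + b l ^+ 2).
Proof.
rewrite meanD; [|exact/dble_exp/dble_tser|exact/dble_exp/dble_tser].
rewrite big_split/= mulrDr; congr (_ + _).
  by rewrite -mean_tser_mul.
by rewrite -mean_tser_mul.
Qed.

Lemma mean_kinetic n (a b : nat -> R) :
  mean (fun x => tser n 1 a x ^+ 2 + tser n 1 b x ^+ 2) =
  pi * \sum_(l < n) freq l ^+ 2 * (a l ^+ 2 + b l ^+ 2).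
Proof.
rewrite meanD; [|exact/dble_exp/dble_tser|exact/dble_exp/dble_tser].
rewrite !mean_tser1_sqr -mulrDr -big_split/=; congr (_ * _).
by apply: eq_bigr => l _; ring.
Qed.

(** The product of three series is a series with [3 * n] modes; padding the fourth with zeros to
    that length, orthogonality applies. *)
Lemma mean_cubic n (f g h w : nat -> R) :
  mean (fun x => tser n 0 f x * tser n 0 g x * tser n 0 h x * tser n 0 w x) =
  pi * form n f g h w.
Proof.
rewrite (_ : (fun x => _) = fun x => tser (3 * n) 0 (tri n f g h) x *
    tser (3 * n) 0 (fun l => if (l < n)%N then w l else 0) x); last first.
  apply/funext => x; congr (_ * _).
    rewrite -(@tri_tser _ n (3 * n))// /tser.
    by apply: eq_bigr => l _; rewrite cosd0 expr0 mul1r.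
  rewrite /tser [RHS](bigID (fun l : 'I_(3 * n) => (l < n)%N))/=.
  rewrite [X in _ = _ + X]big1 => [|l /negPf ->]; last by rewrite mulr0 mul0r.
  have n3 : (n <= 3 * n)%N by lia.
  rewrite addr0 (big_ord_widen _ (fun l => freq l ^+ 0 * w l * cosd 0 (freq l * x)) n3).
  by apply: eq_bigr => l ->.
rewrite mean_tser_mul -sum_tri; congr (_ * _).
have n3 : (n <= 3 * n)%N by lia.
rewrite (big_ord_widen _ (fun l => tri n f g h l * w l) n3) [RHS]big_mkcond/=.
by apply: eq_bigr => l _; case: ifP; rewrite ?mulr0.
Qed.

Lemma mean_quartic n (a b : nat -> R) :
  mean (fun x => (tser n 0 a x ^+ 2 + tser n 0 b x ^+ 2) ^+ 2) = pi * quartic n a b.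
Proof.
pose t4 (f g h w : nat -> R) x := tser n 0 f x * tser n 0 g x * tser n 0 h x * tser n 0 w x.
have d4 (f g h w : nat -> R) : dble (t4 f g h w) by do !apply: dble_mul; exact: dble_tser.
rewrite (_ : (fun x => _) = fun x => t4 a a a a x + 2 * t4 a a b b x + t4 b b b b x).
  rewrite meanD//; last by apply: dble_add => //; apply: dble_mul => //; exact: dble_cst.
  rewrite meanD//; last by apply: dble_mul => //; exact: dble_cst.
  by rewrite meanZ// !mean_cubic /quartic; ring.
by apply/funext => x; rewrite /t4; ring.
Qed.

(** Not visible on the coefficients, whose products have both signs; it comes from the integral of a
    square. *)
Lemma quartic_ge0 n (a b : nat -> R) : 0 <= quartic n a b.
Proof.
rewrite -(pmulr_rge0 _ (@pi_gt0 R)) -mean_quartic -(mulr0 (2 * pi)) -mean_cst.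
apply: mean_le => [||x]; [exact: dble_cst| |exact: sqr_ge0].
by apply/dble_exp/dble_add; apply/dble_exp/dble_tser.
Qed.

(** Differentiation under the integral sign is finite-dimensional: the integral is a bilinear form
    in the coefficients with constant entries [mean (W i j)]. *)
Lemma der_mean_bilinear n k m (f g : R -> nat -> R) (f' g' : nat -> R) (w : R -> R) t :
  dble w ->
  (forall l, is_derive t (1 : R) (f ^~ l) (f' l)) ->
  (forall l, is_derive t (1 : R) (g ^~ l) (g' l)) ->
  is_derive t (1 : R)
    (fun s => mean (fun x => tser n k (f s) x * tser n m (g s) x * w x))
    (mean (fun x => (tser n k f' x * tser n m (g t) x +
                     tser n k (f t) x * tser n m g' x) * w x)).
Proof.
move=> dw df dg.
pose W (i j : nat) x := freq i ^+ k * freq j ^+ m *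
  (cosd k (freq i * x) * cosd m (freq j * x) * w x).
have dW i j : dble (W i j).
  apply: dble_mul; first exact: dble_cst.
  apply: dble_mul => //; apply: dble_mul => x; eexists; exact: der_cosd_scale.
have E a b : (fun x => tser n k a x * tser n m b x * w x) =
    fun x => \sum_(i < n) \sum_(j < n) a i * b j * W i j x.
  apply/funext => x; rewrite /tser !mulr_suml; apply: eq_bigr => i _.
  rewrite mulr_sumr mulr_suml; apply: eq_bigr => j _; rewrite /W; ring.
have M a b : mean (fun x => tser n k a x * tser n m b x * w x) =
    \sum_(i < n) \sum_(j < n) a i * b j * mean (W i j).
  have dabW i j : dble (fun x => a i * b j * W i j x).
    by apply: dble_mul => //; exact: dble_cst.
  rewrite E (@mean_sum n (fun i x => \sum_(j < n) a i * b j * W i j x)); last first.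
    by move=> i; exact: (@dble_sum n (fun j x => a i * b j * W i j x)).
  apply: eq_bigr => i _; rewrite (@mean_sum n (fun j x => a i * b j * W i j x))//.
  by apply: eq_bigr => j _; rewrite meanZ.
rewrite (_ : (fun s => mean _) = fun s =>
  \sum_(i < n) \sum_(j < n) f s i * g s j * mean (W i j)); last by apply/funext => s.
apply: (der_eq (der_sum_ord n (fun i => der_sum_ord n (fun j =>
  der_mul (der_mul (df i) (dg j)) (der_cst (mean (W i j)) t 1))))).
rewrite (_ : (fun x => _ * w x) = fun x => tser n k f' x * tser n m (g t) x * w x +
  tser n k (f t) x * tser n m g' x * w x); last by apply/funext => x; rewrite mulrDl.
have D a b : dble (fun x => tser n k a x * tser n m b x * w x).
  by do !apply: dble_mul => //; exact: dble_tser.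
rewrite meanD// !M -big_split; apply: eq_bigr => i _; rewrite -big_split.
by apply: eq_bigr => j _; rewrite /=; ring.
Qed.

End Mean.

(** * Bounds uniform in the truncation *)

Section UniformBounds.
Context {R : realType}.
Implicit Types (k l m n : nat) (t x S : R) (a b : nat -> R).

Lemma sum_inv_freq2_le n : \sum_(l < n) (@freq R l ^+ 2)^-1 <= 2.
Proof.
(* The sharper bound telescopes, because [(2n+1)^-2 <= 2/(n+1) - 2/(n+2)]. *)
suff H : \sum_(l < n) (@freq R l ^+ 2)^-1 <= 2 - 2 / n.+1%:R.
  by apply: le_trans H _; rewrite gerBl divr_ge0.
elim: n => [|n IH]; first by rewrite big_ord0 divr1 subrr.
rewrite big_ord_recr/=; apply: le_trans (lerD IH (lexx _)) _.
rewrite -lerBrDl -subr_ge0.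
have n0 : 0 <= n%:R :> R by [].
have f0 := freqX_gt0 (R := R) 2 n.
rewrite (_ : _ - _ = (2 * freq n ^+ 2 - n.+1%:R * n.+2%:R) /
  (n.+1%:R * n.+2%:R * freq n ^+ 2)); last first.
  by rewrite -!natr1; field; rewrite !gt_eqF//; lra.
rewrite divr_ge0 ?mulr_ge0 ?(ltW f0)//.
rewrite /freq -!natr1 natrD natrM; nra.
Qed.

Definition mass_l1 n m (a b : nat -> R) : R :=
  \sum_(l < n) freq l ^+ m * (`|a l| + `|b l|).

Definition sobolev2 n m (a b : nat -> R) : R :=
  \sum_(l < n) (freq l ^+ m * freq l ^+ m) * (a l ^+ 2 + b l ^+ 2).

(** Young's inequality against the summable weight [freq l ^- 2]: one more derivative in the square
    norm buys absolute summability. *)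
Lemma mass_l1_le n m a b : mass_l1 n m a b <= 2 + sobolev2 n m.+1 a b.
Proof.
have H : mass_l1 n m a b <= \sum_(l < n) ((freq l ^+ 2)^-1 +
    (freq l ^+ m.+1 * freq l ^+ m.+1) * (a l ^+ 2 + b l ^+ 2)).
  apply: ler_sum => l _.
  have F := freq_gt0 (R := R) l; have Fm := freqX_gt0 (R := R) m l.
  pose y := (@freq R l)^-1; have fy : freq l * y = 1 by rewrite /y divff// gt_eqF.
  rewrite -exprVn -/y [freq l ^+ m.+1]exprS; set f := freq l in fy *; set g := f ^+ m.
  have A c : g * `|c| <= 2^-1 * y ^+ 2 + 2^-1 * ((f * g * (f * g)) * c ^+ 2).
    rewrite -[c ^+ 2]real_normK ?num_real// -subr_ge0.
    rewrite (_ : _ - _ = 2^-1 * (y - f * g * `|c|) ^+ 2).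
      by apply: mulr_ge0; [rewrite invr_ge0|exact: sqr_ge0].
    rewrite (_ : g * `|c| = (f * y) * g * `|c|); last by rewrite fy mul1r.
    by field.
  have P c : 0 <= (f * g * (f * g)) * c ^+ 2.
    by apply: mulr_ge0; [rewrite -expr2 sqr_ge0|exact: sqr_ge0].
  by have := A (a l); have := A (b l); have := P (a l); have := P (b l); lra.
by apply: le_trans H _; rewrite big_split/= lerD// sum_inv_freq2_le.
Qed.

Lemma cubic_re_le n a b l :
  `|cubic_re n a b l| <= tri n (fun i => `|a i| + `|b i|) (fun i => `|a i| + `|b i|)
    (fun i => `|a i| + `|b i|) l.
Proof.
apply: le_trans (ler_normD _ _) _; apply: le_trans (lerD (norm_tri _ _ _ _ _) (norm_tri _ _ _ _ _)) _.
rewrite /tri -big_split; apply: ler_sum => x _; rewrite /= -mulrDr ler_wpM2l ?T_ge0//.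
set a1 := `|a _|; set a2 := `|a _|; set a3 := `|a _|.
set b1 := `|b _|; set b2 := `|b _|.
rewrite -mulrDl ler_pM ?addr_ge0 ?mulr_ge0 ?normr_ge0//; last by rewrite lerDl normr_ge0.
rewrite -subr_ge0 (_ : _ - _ = a1 * b2 + b1 * a2); last by ring.
by rewrite addr_ge0// mulr_ge0// normr_ge0.
Qed.

Lemma cubic_im_le n a b l :
  `|cubic_im n a b l| <= tri n (fun i => `|a i| + `|b i|) (fun i => `|a i| + `|b i|)
    (fun i => `|a i| + `|b i|) l.
Proof.
apply: le_trans (ler_normD _ _) _; apply: le_trans (lerD (norm_tri _ _ _ _ _) (norm_tri _ _ _ _ _)) _.
rewrite /tri -big_split; apply: ler_sum => x _; rewrite /= -mulrDr ler_wpM2l ?T_ge0//.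
set a1 := `|a _|; set a2 := `|a _|; set b3 := `|b x.2|.
set b1 := `|b _|; set b2 := `|b _|.
rewrite -mulrDl ler_pM ?addr_ge0 ?mulr_ge0 ?normr_ge0//; last by rewrite lerDr normr_ge0.
rewrite -subr_ge0 (_ : _ - _ = a1 * b2 + b1 * a2); last by ring.
by rewrite addr_ge0// mulr_ge0// normr_ge0.
Qed.

(** In [l1_bound], 2 bounds the sum of [freq l ^- 2] and the rest is the conserved energy. In
    [growth_rate], 24 is [2 * 6 * 2]: the derivative of a square, the constant of [form_tame], and
    [(|p| + |q|)^2 <= 2 (p^2 + q^2)]. *)
Definition l1_bound (A : R) : R := 2 + (A ^+ 2 + 3 / 8 * A ^+ 4).
Definition growth_rate (A : R) m : R := 24 * 3 ^+ m * l1_bound A ^+ 2.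
Definition weighted_bound (A : R) m S : R :=
  2 + A ^+ 2 * expR (growth_rate A m.+1 * S).
Definition cubic_bound A m S : R := 2 * 3 ^+ m * weighted_bound A m S ^+ 3.

Lemma l1_bound_ge0 (A : R) : 0 <= l1_bound A.
Proof.
have h2 := sqr_ge0 A; have h4 : 0 <= A ^+ 4 by rewrite exprn_even_ge0.
by rewrite /l1_bound; lra.
Qed.

Lemma weighted_bound_ge0 (A : R) m S : 0 <= weighted_bound A m S.
Proof. by rewrite addr_ge0// mulr_ge0 ?expR_ge0// sqr_ge0. Qed.

Lemma cubic_bound_ge0 (A : R) m S : 0 <= cubic_bound A m S.
Proof.
by rewrite mulr_ge0 ?mulr_ge0 ?exprn_ge0// weighted_bound_ge0.
Qed.

(** Applied to the cubic coefficients, this is what the truncation discards, the only defect of the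
    truncated equation. *)
Definition remainder n k (c : nat -> R) x : R := tser (3 * n) k c x - tser n k c x.

Lemma tser_field_re n k a b x : tser n k (field_re n a b) x =
  tser n k.+2 b x - tser (3 * n) k (cubic_im n a b) x + remainder n k (cubic_im n a b) x.
Proof.
transitivity (tser n k.+2 b x - tser n k (cubic_im n a b) x); last by rewrite /remainder; ring.
rewrite tserSS -opprD /tser -big_split -sumrN.
by apply: eq_bigr => l _; rewrite /field_re ltn_ord/=; ring.
Qed.

Lemma tser_field_im n k a b x : tser n k (field_im n a b) x =
  - tser n k.+2 a x + tser (3 * n) k (cubic_re n a b) x - remainder n k (cubic_re n a b) x.
Proof.
transitivity (- tser n k.+2 a x + tser n k (cubic_re n a b) x); last by rewrite /remainder; ring.
rewrite tserSS opprK /tser -big_split.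
by apply: eq_bigr => l _; rewrite /field_im ltn_ord/=; ring.
Qed.

Lemma norm_tser_le n k (a : nat -> R) x :
  `|tser n k a x| <= \sum_(l < n) freq l ^+ k * `|a l|.
Proof.
apply: le_trans (ler_norm_sum _ _ _) _; apply: ler_sum => l _.
rewrite normrM normrM (gtr0_norm (freqX_gt0 _ _)) ler_piMr ?norm_cosd//.
by rewrite mulr_ge0// ltW// freqX_gt0.
Qed.

(** Two spare derivatives make each of the [2 * n] discarded terms at most [C / n^2]. *)
Lemma remainder_le n k (c : nat -> R) (C : R) x : (0 < n)%N ->
  (forall l, `|c l| * freq l ^+ k.+2 <= C) -> `|remainder n k c x| <= 2 * C / n%:R.
Proof.
move=> n0 cC; have n0' : 0 < n%:R :> R by rewrite ltr0n.
have C0 : 0 <= C by apply: le_trans (cC 0%N); rewrite mulr_ge0// ltW// freqX_gt0.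
pose F l := freq l ^+ k * c l * cosd k (freq l * x).
have -> : remainder n k c x = \sum_(n <= l < 3 * n) F l.
  rewrite /remainder /tser -(big_mkord xpredT F) -(big_mkord xpredT F).
  by rewrite (@big_cat_nat _ _ _ n 0 (3 * n))//=; [by rewrite addrAC subrr add0r|lia].
apply: le_trans (ler_norm_sum _ _ _) _.
apply: (@le_trans _ _ (\sum_(n <= l < 3 * n) C / n%:R ^+ 2)).
  rewrite big_nat [X in _ <= X]big_nat; apply: ler_sum => l /andP[nl _].
  have f0 := freq_gt0 (R := R) l; have fk := freqX_gt0 (R := R) k l.
  apply: (@le_trans _ _ (C / freq l ^+ 2)).
    rewrite ler_pdivlMr ?freqX_gt0// /F 2!normrM (gtr0_norm fk).
    apply: le_trans (cC l); rewrite -[k.+2]addn2 exprD.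
    rewrite [X in _ <= X](_ : _ = (freq l ^+ k * `|c l|) * freq l ^+ 2); last by ring.
    apply: ler_wpM2r; first exact/ltW/freqX_gt0.
    by rewrite ler_piMr ?norm_cosd// mulr_ge0// ltW.
  rewrite ler_wpM2l// lef_pV2 ?posrE ?exprn_gt0//.
  by rewrite lerXn2r ?nnegrE ?ltW// /freq ltr_nat; lia.
rewrite big_const_nat iter_addr addr0 -[_ *+ _]mulr_natr (_ : (3 * n - n)%N = (2 * n)%N).
  by rewrite natrM le_eqVlt; apply/orP; left; apply/eqP; field; rewrite gt_eqF.
lia.
Qed.

Section GalerkinBounds.
Variables (A : R) (n : nat) (p q : R -> nat -> R).
Hypothesis G : galerkin A n p q.
Hypothesis n0 : (0 < n)%N.

Lemma galerkin_kinetic_le t : sobolev2 n 1 (p t) (q t) <= A ^+ 2 + 3 / 8 * A ^+ 4.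
Proof.
rewrite -(galerkin_energy G n0 t) lerDl mulr_ge0 ?quartic_ge0// invr_ge0//.
Qed.

Lemma galerkin_l1 t : mass_l1 n 0 (p t) (q t) <= l1_bound A.
Proof. by apply: le_trans (mass_l1_le _ _ _ _) _; rewrite lerD2l galerkin_kinetic_le. Qed.

(** The dispersive terms cancel. In the cubic ones the plain sum of coefficients is bounded by the
    energy, so Gronwall applies with a rate independent of [n]. The datum has frequency 1 only, so
    all its norms equal [A ^+ 2]. *)
Lemma galerkin_sobolev m t :
  sobolev2 n m (p t) (q t) <= A ^+ 2 * expR (growth_rate A m * `|t|).
Proof.
have E0 : sobolev2 n m (p 0) (q 0) = A ^+ 2.
  rewrite /sobolev2 (sum_initial G n0 (fun l => freq l ^+ m * freq l ^+ m)).
  by rewrite /freq muln0 expr1n !mul1r.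
rewrite -E0.
pose a t i := `|p t i| + `|q t i|.
apply: (@gronwall _ (fun t => sobolev2 n m (p t) (q t)) (fun t =>
  2 * \sum_(l < n) (freq l ^+ m * freq l ^+ m) *
   (q t l * cubic_re n (p t) (q t) l - p t l * cubic_im n (p t) (q t) l))) => s.
  apply: (der_eq (der_sum_ord n (fun l => der_scale (freq l ^+ m * freq l ^+ m)
    (der_add (der_sqr (galerkin_dre G s l)) (der_sqr (galerkin_dim G s l)))))).
  rewrite mulr_sumr; apply: eq_bigr => l _.
  by rewrite /field_re /field_im ltn_ord; ring.
have a0 i : 0 <= a s i by rewrite addr_ge0.
have S1 := form_tame m n a0.
have S2 : \sum_(i < n) a s i <= l1_bound A.
  by have := galerkin_l1 s; rewrite /mass_l1; under eq_bigr do rewrite expr0 mul1r.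
have S3 : \sum_(i < n) (freq i ^+ m * a s i) ^+ 2 <= 2 * sobolev2 n m (p s) (q s).
  rewrite mulr_sumr; apply: ler_sum => i _; rewrite exprMn -expr2 [X in _ <= X]mulrCA.
  apply: ler_wpM2l; first exact: sqr_ge0.
  rewrite -[p s i ^+ 2]real_normK ?num_real// -[q s i ^+ 2]real_normK ?num_real//.
  rewrite /a -subr_ge0 (_ : _ - _ = (`|p s i| - `|q s i|) ^+ 2); last by ring.
  exact: sqr_ge0.
rewrite normrM ger0_norm//.
have H : `|\sum_(l < n) (freq l ^+ m * freq l ^+ m) *
    (q s l * cubic_re n (p s) (q s) l - p s l * cubic_im n (p s) (q s) l)| <=
    \sum_(l < n) tri n (a s) (a s) (a s) l * (freq l ^+ m * freq l ^+ m * a s l).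
  apply: le_trans (ler_norm_sum _ _ _) _; apply: ler_sum => l _.
  have w0 : 0 <= @freq R l ^+ m * freq l ^+ m by rewrite mulr_ge0// ltW// freqX_gt0.
  rewrite normrM (ger0_norm w0) mulrCA ler_wpM2l//.
  apply: le_trans (ler_normB _ _) _; rewrite !normrM [X in _ <= X]mulrC /a mulrDl addrC.
  by rewrite lerD// ler_wpM2l// ?cubic_re_le ?cubic_im_le.
have M : 0 <= 6 * 3 ^+ m :> R by rewrite mulr_ge0// exprn_ge0.
have B : (\sum_(i < n) a s i) ^+ 2 <= l1_bound A ^+ 2.
  by rewrite lerXn2r ?nnegrE ?sumr_ge0 ?l1_bound_ge0.
apply: le_trans (ler_wpM2l _ (le_trans H S1)) _ => //.
rewrite (_ : growth_rate A m * _ = 2 * (6 * 3 ^+ m * l1_bound A ^+ 2 *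
  (2 * sobolev2 n m (p s) (q s)))); last by rewrite /growth_rate; ring.
rewrite ler_wpM2l// ler_pM ?mulr_ge0 ?sqr_ge0 ?sumr_ge0//.
- by move=> i _; exact: sqr_ge0.
- by rewrite ler_wpM2l.
Qed.

Lemma galerkin_weighted m S t : `|t| <= S ->
  mass_l1 n m (p t) (q t) <= weighted_bound A m S.
Proof.
move=> tS; apply: le_trans (mass_l1_le _ _ _ _) _; rewrite lerD2l.
apply: le_trans (galerkin_sobolev _ _) _; rewrite ler_wpM2l ?sqr_ge0//.
rewrite ler_expR ler_wpM2l// /growth_rate mulr_ge0 ?sqr_ge0// mulr_ge0// exprn_ge0//.
Qed.

Lemma galerkin_tser_re k S t x : `|t| <= S ->
  `|tser n k (p t) x| <= weighted_bound A k S.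
Proof.
move=> tS; apply: le_trans (norm_tser_le _ _ _ _) _.
apply: le_trans (galerkin_weighted k tS); apply: ler_sum => l _.
by rewrite ler_wpM2l ?lerDl// ltW// freqX_gt0.
Qed.

Lemma galerkin_tser_im k S t x : `|t| <= S ->
  `|tser n k (q t) x| <= weighted_bound A k S.
Proof.
move=> tS; apply: le_trans (norm_tser_le _ _ _ _) _.
apply: le_trans (galerkin_weighted k tS); apply: ler_sum => l _.
by rewrite ler_wpM2l ?lerDr// ltW// freqX_gt0.
Qed.

Lemma galerkin_cubic m S t l : `|t| <= S ->
  `|cubic_re n (p t) (q t) l| * freq l ^+ m <= cubic_bound A m S /\
  `|cubic_im n (p t) (q t) l| * freq l ^+ m <= cubic_bound A m S.
Proof.
move=> tS; pose a i := `|p t i| + `|q t i|.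
have a0 i : 0 <= a i by rewrite addr_ge0.
have H : tri n a a a l * freq l ^+ m <= cubic_bound A m S.
  apply: le_trans (tri_weighted_le m n l a0) _.
  rewrite ler_wpM2l ?mulr_ge0 ?exprn_ge0// lerXn2r ?nnegrE ?weighted_bound_ge0//.
    by apply: sumr_ge0 => i _; rewrite mulr_ge0// ltW// freqX_gt0.
  exact: galerkin_weighted.
by split; apply: le_trans H; rewrite ler_wpM2r ?cubic_re_le ?cubic_im_le// ltW// freqX_gt0.
Qed.

Lemma galerkin_remainder k S t x : `|t| <= S ->
  `|remainder n k (cubic_re n (p t) (q t)) x| <= 2 * cubic_bound A k.+2 S / n%:R /\
  `|remainder n k (cubic_im n (p t) (q t)) x| <= 2 * cubic_bound A k.+2 S / n%:R.
Proof.
by move=> tS; split; apply: remainder_le => // l;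
  have [] := galerkin_cubic k.+2 l tS.
Qed.

Lemma galerkin_coef m S t l : `|t| <= S ->
  `|p t l| * freq l ^+ m <= weighted_bound A m S /\
  `|q t l| * freq l ^+ m <= weighted_bound A m S.
Proof.
move=> tS; have [ln|nl] := ltnP l n; last first.
  have [-> ->] := galerkin_high G t nl.
  by rewrite normr0 mul0r weighted_bound_ge0.
suff H : (`|p t l| + `|q t l|) * freq l ^+ m <= weighted_bound A m S.
  by split; apply: le_trans H; rewrite ler_wpM2r ?lerDl ?lerDr// ltW// freqX_gt0.
apply: le_trans (galerkin_weighted m tS); rewrite /mass_l1 (bigD1 (Ordinal ln))//=.
rewrite mulrC lerDl sumr_ge0// => i _.
by rewrite mulr_ge0 ?addr_ge0// ltW// freqX_gt0.
Qed.

End GalerkinBounds.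
End UniformBounds.

(** * Growth of the kinetic energy *)

Ltac solve_dble := repeat first
  [assumption | exact: dble_cst | exact: dble_tser | exact: dble_cos | exact: dble_sin
  | apply: dble_exp | apply: dble_add | apply: dble_opp | apply: dble_mul].

Section MomentIdentities.
Context {R : realType}.
Implicit Types (k l m n : nat) (t x : R) (a b : nat -> R).

Lemma dble_remainder n k (c : nat -> R) : dble (remainder n k c).
Proof. by rewrite /remainder; solve_dble. Qed.

Lemma tser_cubic_im n a b x : tser (3 * n) 0 (cubic_im n a b) x =
  (tser n 0 a x ^+ 2 + tser n 0 b x ^+ 2) * tser n 0 b x.
Proof.
have H := fun f g h => @tri_tser R n (3 * n) f g h x (leqnn _).
rewrite (_ : _ * _ = tser n 0 a x * tser n 0 a x * tser n 0 b x +
  tser n 0 b x * tser n 0 b x * tser n 0 b x); last by ring.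
rewrite -!H /tser -big_split; apply: eq_bigr => l _.
by rewrite /cubic_im cosd0 expr0/=; ring.
Qed.

Lemma tser_cubic_re n a b x : tser (3 * n) 0 (cubic_re n a b) x =
  (tser n 0 a x ^+ 2 + tser n 0 b x ^+ 2) * tser n 0 a x.
Proof.
have H := fun f g h => @tri_tser R n (3 * n) f g h x (leqnn _).
rewrite (_ : _ * _ = tser n 0 a x * tser n 0 a x * tser n 0 a x +
  tser n 0 b x * tser n 0 b x * tser n 0 a x); last by ring.
rewrite -!H /tser -big_split; apply: eq_bigr => l _.
by rewrite /cubic_re cosd0 expr0/=; ring.
Qed.

Lemma field_re_physical n a b x : tser n 0 (field_re n a b) x =
  tser n 2 b x - (tser n 0 a x ^+ 2 + tser n 0 b x ^+ 2) * tser n 0 b x +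
  remainder n 0 (cubic_im n a b) x.
Proof. by rewrite tser_field_re tser_cubic_im. Qed.

Lemma field_im_physical n a b x : tser n 0 (field_im n a b) x =
  - tser n 2 a x + (tser n 0 a x ^+ 2 + tser n 0 b x ^+ 2) * tser n 0 a x -
  remainder n 0 (cubic_re n a b) x.
Proof. by rewrite tser_field_im tser_cubic_re. Qed.

Lemma period_cos2 : cos (2 * (2 * pi)) = cos (2 * 0) :> R.
Proof. by rewrite mulr0 cos0 -[RHS](cos_int_period 2). Qed.

Lemma period_sin2 : sin (2 * (2 * pi)) = sin (2 * 0) :> R.
Proof. by rewrite mulr0 sin0 -[RHS](sin_int_period 2). Qed.

Section Profile.
Variables (n : nat) (a b : nat -> R).
Let P := tser n 0 a.
Let Q := tser n 0 b.
Let P1 := tser n 1 a.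
Let Q1 := tser n 1 b.
Let Pt := tser n 0 (field_re n a b).
Let Qt := tser n 0 (field_im n a b).
Let Pt1 := tser n 1 (field_re n a b).
Let Qt1 := tser n 1 (field_im n a b).
Let r1 := remainder n 0 (cubic_im n a b).
Let r2 := remainder n 0 (cubic_re n a b).

Definition density_moment : R :=
  mean (fun x => tser n 0 a x * tser n 0 a x * cos (2 * x)) +
  mean (fun x => tser n 0 b x * tser n 0 b x * cos (2 * x)).
Definition current_moment : R :=
  mean (fun x => tser n 0 a x * tser n 1 b x * sin (2 * x)) -
  mean (fun x => tser n 0 b x * tser n 1 a x * sin (2 * x)).
Definition density_rate : R :=
  mean (fun x => (Pt x * P x + P x * Pt x) * cos (2 * x)) +
  mean (fun x => (Qt x * Q x + Q x * Qt x) * cos (2 * x)).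
Definition current_rate : R :=
  mean (fun x => (Pt x * Q1 x + P x * Qt1 x) * sin (2 * x)) -
  mean (fun x => (Qt x * P1 x + Q x * Pt1 x) * sin (2 * x)).

Let dr1 : dble r1 := @dble_remainder n 0 _.
Let dr2 : dble r2 := @dble_remainder n 0 _.
Let dP : dble P := @dble_tser R n 0 a.
Let dQ : dble Q := @dble_tser R n 0 b.
Let dP1 : dble P1 := @dble_tser R n 1 a.
Let dQ1 : dble Q1 := @dble_tser R n 1 b.
Let dPt : dble Pt := @dble_tser R n 0 _.
Let dQt : dble Qt := @dble_tser R n 0 _.
Let dPt1 : dble Pt1 := @dble_tser R n 1 _.
Let dQt1 : dble Qt1 := @dble_tser R n 1 _.

Let DP x : is_derive x (1 : R) P (P1 x) := der_tser n 0 a x.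
Let DQ x : is_derive x (1 : R) Q (Q1 x) := der_tser n 0 b x.
Let DP1 x : is_derive x (1 : R) P1 (tser n 2 a x) := der_tser n 1 a x.
Let DQ1 x : is_derive x (1 : R) Q1 (tser n 2 b x) := der_tser n 1 b x.
Let DPt x : is_derive x (1 : R) Pt (Pt1 x) := der_tser n 0 _ x.
Let DQt x : is_derive x (1 : R) Qt (Qt1 x) := der_tser n 0 _ x.
Let Dc x := der_cos_scale 2 x.
Let Ds x := der_sin_scale 2 x.

Let PtE x : Pt x = tser n 2 b x - (P x ^+ 2 + Q x ^+ 2) * Q x + r1 x.
Proof. exact: field_re_physical. Qed.

Let QtE x : Qt x = - tser n 2 a x + (P x ^+ 2 + Q x ^+ 2) * P x - r2 x.
Proof. exact: field_im_physical. Qed.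

Lemma density_moment_rate : density_rate = 4 * current_moment +
  2 * mean (fun x => (P x * r1 x - Q x * r2 x) * cos (2 * x)).
Proof.
rewrite /density_rate /current_moment -meanD; [|by solve_dble|by solve_dble].
rewrite -meanB; [|by solve_dble|by solve_dble].
rewrite -!meanZ; [|by solve_dble|by solve_dble].
rewrite -meanD; [|by solve_dble|by solve_dble].
(* Up to the remainders, the time derivative of the density is twice the space derivative of the
   current [P Q_x - Q P_x]. *)
pose H x := 2 * ((P x * Q1 x - Q x * P1 x) * cos (2 * x)).
apply: (@mean_by_parts _ H); [|by solve_dble|by solve_dble|].
  move=> x; apply: (der_eq (der_scale 2 (der_mul (der_sub
    (der_mul (DP x) (DQ1 x)) (der_mul (DQ x) (DP1 x))) (Dc x)))).
  by cbv beta; rewrite PtE QtE /P /Q /P1 /Q1; ring.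
by rewrite /H period_cos2 /P /Q /P1 /Q1 !tser_period.
Qed.

Lemma current_moment_rate : current_rate =
  - 4 * mean (fun x => (P1 x ^+ 2 + Q1 x ^+ 2) * cos (2 * x))
  - mean (fun x => (P x ^+ 2 + Q x ^+ 2) ^+ 2 * cos (2 * x)) - 4 * density_moment
  + 2 * mean (fun x => (r1 x * Q1 x + r2 x * P1 x) * sin (2 * x))
  + 2 * mean (fun x => (Q x * r1 x + P x * r2 x) * cos (2 * x)).
Proof.
rewrite /current_rate /density_moment -meanB; [|by solve_dble|by solve_dble].
rewrite -meanD; [|by solve_dble|by solve_dble].
rewrite -!meanZ; [|by solve_dble|by solve_dble|by solve_dble|by solve_dble].
rewrite -meanB; [|by solve_dble|by solve_dble].
rewrite -meanB; [|by solve_dble|by solve_dble].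
rewrite -meanD; [|by solve_dble|by solve_dble].
rewrite -meanD; [|by solve_dble|by solve_dble].
(* The first term moves [d_x] off [Pt] and [Qt]; the next two integrate the kinetic and pressure
   gradients; the last two reduce [P P_xx + Q Q_xx] first to the kinetic density and then to the
   density. *)
pose H x := (P x * Qt x - Q x * Pt x) * sin (2 * x) +
  (P1 x ^+ 2 + Q1 x ^+ 2) * sin (2 * x) +
  - 2^-1 * ((P x ^+ 2 + Q x ^+ 2) ^+ 2 * sin (2 * x)) +
  2 * ((P x * P1 x + Q x * Q1 x) * cos (2 * x)) +
  2 * ((P x ^+ 2 + Q x ^+ 2) * sin (2 * x)).
apply: (@mean_by_parts _ H); [|by solve_dble|by solve_dble|].
  move=> x.
  have S1 := der_mul (der_sub (der_mul (DP x) (DQt x)) (der_mul (DQ x) (DPt x))) (Ds x).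
  have S2 := der_mul (der_add (der_sqr (DP1 x)) (der_sqr (DQ1 x))) (Ds x).
  have rho := der_add (der_sqr (DP x)) (der_sqr (DQ x)).
  have S3 := der_scale (- 2^-1) (der_mul (der_sqr rho) (Ds x)).
  have S4 := der_scale 2 (der_mul (der_add (der_mul (DP x) (DP1 x))
    (der_mul (DQ x) (DQ1 x))) (Dc x)).
  have S5 := der_scale 2 (der_mul rho (Ds x)).
  apply: (der_eq (der_add (der_add (der_add (der_add S1 S2) S3) S4) S5)).
  by cbv beta; rewrite PtE QtE /P /Q /P1 /Q1; field.
by rewrite /H period_cos2 period_sin2 /P /Q /P1 /Q1 /Pt /Qt !tser_period.
Qed.

(** Cauchy-Schwarz in Young's form; the free weight [theta] is chosen later to balance mass against
    kinetic energy. *)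
Lemma current_moment_le (theta : R) : 0 < theta ->
  `|current_moment| <= 2^-1 * (theta * mean (fun x => P x ^+ 2 + Q x ^+ 2) +
     mean (fun x => P1 x ^+ 2 + Q1 x ^+ 2) / theta).
Proof.
move=> th0; rewrite /current_moment -meanB; [|by solve_dble|by solve_dble].
rewrite [_ / theta]mulrC -!meanZ; [|by solve_dble|by solve_dble].
rewrite -meanD; [|by solve_dble|by solve_dble].
rewrite -meanZ; last by solve_dble.
have A1 u v s : `|s| <= 1 -> 2 * (u * v * s) <= theta * u ^+ 2 + theta^-1 * v ^+ 2.
  move=> s1; have s2 : s ^+ 2 <= 1 by rewrite -real_normK ?num_real// expr_le1.
  rewrite -subr_ge0 (_ : _ - _ = theta * (u - s * (theta^-1 * v)) ^+ 2 +
    theta^-1 * (v ^+ 2 * (1 - s ^+ 2))); last by field; rewrite gt_eqF.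
  apply: addr_ge0; first by apply: mulr_ge0; [exact: ltW|exact: sqr_ge0].
  apply: mulr_ge0; first by rewrite invr_ge0 ltW.
  by apply: mulr_ge0; [exact: sqr_ge0|rewrite subr_ge0].
have A2 u v s : `|s| <= 1 -> - (theta * u ^+ 2 + theta^-1 * v ^+ 2) <= 2 * (u * v * s).
  by move=> s1; have := A1 u v (- s); rewrite normrN => /(_ s1); lra.
rewrite ler_norml -meanN; last by solve_dble.
have S x : `|sin (2 * x)| <= 1 by exact: sin_max.
apply/andP; split; (apply: mean_le; [by solve_dble|by solve_dble|move=> x]).
  have := A1 (P x) (Q1 x) _ (S x); have := A2 (P x) (Q1 x) _ (S x).
  have := A1 (Q x) (P1 x) _ (S x); have := A2 (Q x) (P1 x) _ (S x).
  by rewrite /P /Q /P1 /Q1; lra.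
have := A1 (P x) (Q1 x) _ (S x); have := A2 (P x) (Q1 x) _ (S x).
have := A1 (Q x) (P1 x) _ (S x); have := A2 (Q x) (P1 x) _ (S x).
  by rewrite /P /Q /P1 /Q1; lra.
Qed.

(* Comparison with the density [A^2 cos^2 x] of the initial datum. *)
Lemma flux_moment_ge (A : R) :
  5 / 16 * pi * A ^+ 4 - 5 * (mean (fun x => (P x ^+ 2 + Q x ^+ 2) ^+ 2)
     - A ^+ 2 * (mean (fun x => P x ^+ 2 + Q x ^+ 2) + density_moment)
     + 3 / 4 * pi * A ^+ 4) <=
  mean (fun x => (P x ^+ 2 + Q x ^+ 2) ^+ 2 * cos (2 * x)).
Proof.
rewrite /density_moment.
pose c x := cos (2 * x) : R; pose s x := sin (2 * x) : R.
pose rho x := P x ^+ 2 + Q x ^+ 2.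
have drho : dble rho by rewrite /rho; solve_dble.
have dc : dble c by exact: dble_cos.
have ds : dble s by exact: dble_sin.
pose rho0 x := A ^+ 2 / 2 * (1 + c x).
(* Giving up 1/4 of [rho0^2] pays for the cross term by completing the square. In units of [pi A^4],
   [rho0^2 c] integrates to 1/2 and [rho0^2] to 3/4, whence 1/2 - 3/16 = 5/16. *)
pose low x := rho0 x ^+ 2 * (c x - 4^-1) - 5 * (rho x - rho0 x) ^+ 2.
have dlow : dble low by rewrite /low /rho0; solve_dble.
apply: (@le_trans _ _ (mean low)); last first.
  apply: mean_le => //; [by solve_dble|move=> x].
  have c1 : `|c x| <= 1 by exact: cos_max.
  have c2 : c x ^+ 2 <= 1 by rewrite -real_normK ?num_real// expr_le1.
  have cN : -1 <= c x by move: c1; rewrite ler_norml => /andP[].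
  rewrite -/(rho x) -/(c x) /low -subr_ge0; set r0 := rho0 x; set d := rho x - r0.
  have -> : rho x = r0 + d by rewrite /d addrC subrK.
  rewrite (_ : _ - _ = (2^-1 * r0 + 2 * d * c x) ^+ 2 +
    (4 * d ^+ 2 * (1 - c x ^+ 2) + d ^+ 2 * (1 + c x))); last by field.
  apply: addr_ge0; first exact: sqr_ge0.
  apply: addr_ge0; apply: mulr_ge0; rewrite ?sqr_ge0 ?subr_ge0//; last by lra.
  by apply: mulr_ge0 => //; exact: sqr_ge0.
(* The terms of [low] free of [rho] are replaced by their averages, 1/4 - 3/32 = 5/32 and 5 * 3/8 =
   15/8 times [A^4]; the other terms are exactly the moments of the statement. *)
pose high x := - 5 * rho x ^+ 2 + 5 * A ^+ 2 * (rho x + rho x * c x) +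
  (5 / 32 - 15 / 8) * A ^+ 4.
have dhigh : dble high by rewrite /high; solve_dble.
have E : mean low = mean high.
  (* A primitive of the oscillating part, split into its [c], [c^2 - s^2] and [c^3] components. *)
  pose H x := A ^+ 4 * ((8^-1 - 5 / 2) / 2 * s x + (7 / 16 - 5 / 4) / 4 * (s x * c x) +
    8^-1 * (s x - 3^-1 * (s x * (s x * s x)))).
  apply: (@mean_by_parts _ H) => // [x|].
    have D := der_scale (A ^+ 4) (der_add (der_add (der_scale ((8^-1 - 5 / 2) / 2) (Ds x))
      (der_scale ((7 / 16 - 5 / 4) / 4) (der_mul (Ds x) (Dc x))))
      (der_scale 8^-1 (der_sub (Ds x) (der_scale 3^-1 (der_mul (Ds x) (der_mul (Ds x) (Ds x))))))).
    apply: (der_eq D); rewrite /low /high /rho0 -/(c x) -/(s x).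
    have cs : s x ^+ 2 = 1 - c x ^+ 2 by rewrite sin2cos2.
    transitivity (A ^+ 4 * ((8^-1 - 5 / 2) * c x + (7 / 16 - 5 / 4) / 2 * (c x ^+ 2 - s x ^+ 2)
      + 4^-1 * (c x - s x ^+ 2 * c x))); first by field.
    by rewrite cs; field.
  by rewrite /H /s /c period_cos2 period_sin2.
rewrite E le_eqVlt; apply/orP; left; apply/eqP.
rewrite /high [RHS]meanD; [|by solve_dble|by solve_dble].
rewrite [in RHS]meanD; [|by solve_dble|by solve_dble].
rewrite [in RHS](@meanZ _ (- 5)); last by solve_dble.
rewrite [in RHS](@meanZ _ (5 * A ^+ 2)); last by solve_dble.
rewrite mean_cst [in RHS](@meanD _ rho); [|by solve_dble|by solve_dble].
rewrite (_ : (fun x => rho x * c x) = fun x => P x * P x * cos (2 * x) +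
  Q x * Q x * cos (2 * x)); last by apply/funext => x; rewrite /rho /c; ring.
by rewrite [in RHS](@meanD _ (fun x => P x * P x * cos (2 * x))); [rewrite /rho /c; field|by solve_dble|by solve_dble].
Qed.

End Profile.
End MomentIdentities.

(** * The contradiction argument for a single truncation *)

Section GalerkinGrowth.
Context {R : realType}.
Variables (A eps : R) (n : nat) (p q : R -> nat -> R).
Hypothesis G : galerkin A n p q.
Hypothesis n0 : (0 < n)%N.
Hypothesis A100 : 100 <= A.

Let A0 : 0 < A. Proof. by apply: lt_le_trans A100. Qed.
Let Ainv1 : A^-1 <= 1.
Proof. by rewrite invf_le1// (le_trans _ A100)// ler1n. Qed.

Let kin t := sobolev2 n 1 (p t) (q t).
Let C := weighted_bound A 0 1 + weighted_bound A 1 1.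
Let r1 t := remainder n 0 (cubic_im n (p t) (q t)).
Let r2 t := remainder n 0 (cubic_re n (p t) (q t)).

Hypothesis r1_le : forall t x, `|t| <= 1 -> `|r1 t x| <= eps.
Hypothesis r2_le : forall t x, `|t| <= 1 -> `|r2 t x| <= eps.
Hypothesis small : 64 * C * eps <= 1.

Let eps0 : 0 <= eps.
Proof. by apply: le_trans (r1_le (t := 0) 0 _); rewrite ?normr0. Qed.

Let C0 : 0 <= C.
Proof. by rewrite addr_ge0 ?weighted_bound_ge0. Qed.

Let P_le t x : `|t| <= 1 -> `|tser n 0 (p t) x| <= C.
Proof.
move=> t1; apply: le_trans (galerkin_tser_re G n0 0 x t1) _.
by rewrite lerDl weighted_bound_ge0.
Qed.

Let Q_le t x : `|t| <= 1 -> `|tser n 0 (q t) x| <= C.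
Proof.
move=> t1; apply: le_trans (galerkin_tser_im G n0 0 x t1) _.
by rewrite lerDl weighted_bound_ge0.
Qed.

Let P1_le t x : `|t| <= 1 -> `|tser n 1 (p t) x| <= C.
Proof.
move=> t1; apply: le_trans (galerkin_tser_re G n0 1 x t1) _.
by rewrite lerDr weighted_bound_ge0.
Qed.

Let Q1_le t x : `|t| <= 1 -> `|tser n 1 (q t) x| <= C.
Proof.
move=> t1; apply: le_trans (galerkin_tser_im G n0 1 x t1) _.
by rewrite lerDr weighted_bound_ge0.
Qed.

Let pi4 : @pi R <= 4.
Proof. by have := @pihalf_lt2 R; lra. Qed.

Let pi2 : 2 <= @pi R.
Proof. exact: pi_ge2. Qed.

(** The left side is at most [8 pi C eps <= 32 C eps], which is where the 64 of [small] comes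
    from. *)
Let error_le (u v r r' w : R -> R) : dble u -> dble v -> dble r -> dble r' -> dble w ->
  (forall x, `|u x| <= C) -> (forall x, `|v x| <= C) ->
  (forall x, `|r x| <= eps) -> (forall x, `|r' x| <= eps) -> (forall x, `|w x| <= 1) ->
  `|2 * mean (fun x => (u x * r x + v x * r' x) * w x)| <= 2^-1.
Proof.
move=> du dv dr dr' dw uC vC re re' w1.
rewrite normrM ger0_norm//.
have H : `|mean (fun x => (u x * r x + v x * r' x) * w x)| <= 2 * pi * (2 * (C * eps)).
  apply: mean_norm_le => [|x].
    by apply: dble_mul => //; apply: dble_add; apply: dble_mul.
  rewrite normrM -[X in _ <= X]mulr1 ler_pM//.
  rewrite (le_trans (ler_normD _ _))// !normrM mulr_natl mulr2n lerD// ler_pM//.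
have := mulr_ge0 C0 eps0; have := ler_wpM2r (mulr_ge0 C0 eps0) pi4.
move: H small; set y := C * eps => H; rewrite -mulrA -/y => s; lra.
Qed.

Let Z t := density_moment n (p t) (q t).
Let J t := current_moment n (p t) (q t).

Let dZ t : is_derive t (1 : R) Z (density_rate n (p t) (q t)).
Proof.
exact: (der_add (der_mean_bilinear n 0 0 (dble_cos 2) (galerkin_dre G t) (galerkin_dre G t))
  (der_mean_bilinear n 0 0 (dble_cos 2) (galerkin_dim G t) (galerkin_dim G t))).
Qed.

Let dJ t : is_derive t (1 : R) J (current_rate n (p t) (q t)).
Proof.
exact: (der_sub (der_mean_bilinear n 0 1 (dble_sin 2) (galerkin_dre G t) (galerkin_dim G t))
  (der_mean_bilinear n 0 1 (dble_sin 2) (galerkin_dim G t) (galerkin_dre G t))).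
Qed.

Let mean_mass t : mean (fun x => tser n 0 (p t) x ^+ 2 + tser n 0 (q t) x ^+ 2) = pi * A ^+ 2.
Proof. by rewrite mean_density (galerkin_mass G n0). Qed.

Let mean_kin t : mean (fun x => tser n 1 (p t) x ^+ 2 + tser n 1 (q t) x ^+ 2) = pi * kin t.
Proof. exact: mean_kinetic. Qed.

Let Z_initial : Z 0 = pi / 2 * A ^+ 2.
Proof.
have E0 x : tser n 0 (p 0) x = A * cos x.
  rewrite /tser (galerkin_re0 G) (bigD1 (Ordinal n0))//= big1 ?addr0 => [|l].
    by rewrite cosd0 expr0 mul1r /freq muln0 mul1r.
  by rewrite -val_eqE/= => /negPf ->; rewrite mulr0 mul0r.
have E1 x : tser n 0 (q 0) x = 0.
  by rewrite /tser (galerkin_im0 G) big1// => l _; rewrite mulr0 mul0r.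
have dcos : dble (fun x : R => cos x) by move=> x; exists (- sin x); exact: is_derive_cos.
rewrite /Z /density_moment.
under [X in mean X + _]eq_fun do rewrite E0.
under [X in _ + mean X]eq_fun do rewrite E1 mul0r mul0r.
rewrite mean_cst mulr0 addr0.
rewrite (_ : pi / 2 * A ^+ 2 = 2 * pi * (A ^+ 2 / 4)); last by field.
rewrite -mean_cst.
pose H x := A ^+ 2 * (4^-1 * sin (2 * x) + 8^-1 * (sin (2 * x) * cos (2 * x))).
apply: (@mean_by_parts _ H) => [x| | |].
- have D := der_scale (A ^+ 2) (der_add (der_scale 4^-1 (der_sin_scale 2 x))
    (der_scale 8^-1 (der_mul (der_sin_scale 2 x) (der_cos_scale 2 x)))).
  apply: (der_eq D).
  have cs : sin (2 * x) ^+ 2 = 1 - cos (2 * x) ^+ 2 by rewrite sin2cos2.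
  have c2 : cos x ^+ 2 = (1 + cos (2 * x)) / 2.
    have E := cos_mulr2n x; rewrite -[x *+ 2]mulr_natl in E.
    by rewrite E -[cos x ^+ 2 *+ 2]mulr_natl; field.
  transitivity (A ^+ 2 * (2^-1 * cos (2 * x) + 4^-1 * (cos (2 * x) ^+ 2 - sin (2 * x) ^+ 2)));
    first by field.
  rewrite cs; transitivity (A ^+ 2 * (cos x ^+ 2) * cos (2 * x) - A ^+ 2 / 4); last by field.
  by rewrite c2; field.
- by do !apply: dble_mul => //; try exact: dble_cst; exact: dble_cos.
- exact: dble_cst.
- by rewrite /H period_cos2 period_sin2.
Qed.

Let J_le t : kin t <= A ^+ 4 / 10 ^+ 6 -> `|J t| <= pi * A ^+ 3 / 10 ^+ 3.
Proof.
(* With [theta = A / 10 ^+ 3], the mass term and the kinetic term are both at most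
   [pi * A ^+ 3 / 10 ^+ 3]. *)
move=> kt; have th0 : 0 < A / 10 ^+ 3 by rewrite divr_gt0// exprn_gt0.
apply: le_trans (current_moment_le _ _ _ th0) _; rewrite mean_mass mean_kin.
have H : pi * kin t / (A / 10 ^+ 3) <= pi * A ^+ 3 / 10 ^+ 3.
  rewrite ler_pdivrMr//.
  rewrite [X in _ <= X](_ : _ = pi * (A ^+ 4 / 10 ^+ 6)); last by field.
  by rewrite ler_wpM2l// ltW// pi_gt0.
rewrite (_ : A / 10 ^+ 3 * (pi * A ^+ 2) = pi * A ^+ 3 / 10 ^+ 3); last by ring.
lra.
Qed.

Let density_rate_le t : `|t| <= 1 -> kin t <= A ^+ 4 / 10 ^+ 6 ->
  `|density_rate n (p t) (q t)| <= 4 * (pi * A ^+ 3 / 10 ^+ 3) + 1.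
Proof.
move=> t1 kt; rewrite density_moment_rate.
apply: le_trans (ler_normD _ _) _; rewrite lerD//.
  by rewrite normrM ger0_norm// ler_wpM2l// J_le.
rewrite (_ : (fun x => _) = fun x => (tser n 0 (p t) x * r1 t x +
  - tser n 0 (q t) x * r2 t x) * cos (2 * x)); last first.
  by apply/funext => x; rewrite mulNr.
apply: (le_trans (error_le _ _ _ _ _ _ _ _ _ _)); last by lra.
- exact: dble_tser.
- by apply: dble_opp; exact: dble_tser.
- exact: dble_remainder.
- exact: dble_remainder.
- exact: dble_cos.
- by move=> x; exact: P_le.
- by move=> x; rewrite normrN; exact: Q_le.
- by move=> x; exact: r1_le.
- by move=> x; exact: r2_le.
- by move=> x; exact: cos_max.
Qed.

Let Z_near t : 0 <= t <= A^-1 -> (forall s, 0 <= s <= A^-1 -> kin s <= A ^+ 4 / 10 ^+ 6) ->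
  `|Z t - Z 0| <= 4 * pi * A ^+ 2 / 10 ^+ 3 + A^-1.
Proof.
move=> /andP[t0 tA] K; pose c := 4 * (pi * A ^+ 3 / 10 ^+ 3) + 1.
have := @ler_norm_increment _ Z _ (fun y => c * y) (fun=> c) 0 t t0 dZ
  (fun x => der_scale_id c x).
rewrite mulr0 subr0 => H; apply: le_trans (H _) _ => [s /andP[s0 st]|].
  have sA : s <= A^-1 by apply: le_trans tA.
  by apply: density_rate_le; [rewrite ger0_norm// (le_trans sA)|apply: K; rewrite s0].
apply: (@le_trans _ _ (c * A^-1)).
  rewrite ler_wpM2l// /c addr_ge0// !mulr_ge0 ?exprn_ge0 ?ltW// ?pi_gt0//.
rewrite /c le_eqVlt; apply/orP; left; apply/eqP; field; rewrite gt_eqF//.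
Qed.

(** Here [W = A^2 pi], [X = pi A^4], [V = 1/A], [Y = A^2 / A] and [AZ = A^2 Zt]. The main loss
    [5 (2 W + Y + X / 250)] is about [X / 46], well inside the margin [(5/16 - 1/4) X]. *)
Let arith (W X Y V ke fl Zt AZ e1 e2 qu : R) : 10 ^+ 4 * W <= X ->
  - (X / 10 ^+ 6) <= ke -> - (4 / 10 ^+ 3 * W + V) <= Zt - W / 2 -> V <= 1 ->
  qu <= 2 * W + 3 / 4 * X -> - (4 / 10 ^+ 3 * X) - Y <= AZ - X / 2 ->
  5 / 16 * X - 5 * (qu - (X + AZ) + 3 / 4 * X) <= fl -> Y <= W -> 1 <= W ->
  e1 <= 2^-1 -> e2 <= 2^-1 -> -4 * ke - fl - 4 * Zt + e1 + e2 <= - (4^-1 * X).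
Proof. lra. Qed.

Let current_rate_le t : 0 <= t <= A^-1 ->
  (forall s, 0 <= s <= A^-1 -> kin s <= A ^+ 4 / 10 ^+ 6) ->
  current_rate n (p t) (q t) <= - (4^-1 * (pi * A ^+ 4)).
Proof.
move=> tA K; have kt := K t tA; have Zt := Z_near tA K.
have t1 : `|t| <= 1.
  by case/andP: tA => t0 tA; rewrite ger0_norm// (le_trans tA).
have F := flux_moment_ge n (p t) (q t) A.
rewrite mean_mass mean_quartic -/(Z t) in F.
have E : quartic n (p t) (q t) <= 2 * A ^+ 2 + 3 / 4 * A ^+ 4.
  have := galerkin_energy G n0 t; have : 0 <= kin t.
    by apply: sumr_ge0 => l _; rewrite !mulr_ge0 ?addr_ge0 ?sqr_ge0// ltW// freqX_gt0.
  rewrite /kin /sobolev2; under eq_bigr do rewrite expr1 -expr2.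
  lra.
have E' := ler_wpM2l (ltW (@pi_gt0 R)) E.
rewrite current_moment_rate -/(Z t).
have KE : `|mean (fun x => (tser n 1 (p t) x ^+ 2 + tser n 1 (q t) x ^+ 2) * cos (2 * x))|
    <= pi * (A ^+ 4 / 10 ^+ 6).
  apply: (@le_trans _ _ (pi * kin t)); last by rewrite ler_wpM2l// ltW// pi_gt0.
  rewrite -mean_kin ler_norml -meanN; last by solve_dble.
  have kap x : 0 <= tser n 1 (p t) x ^+ 2 + tser n 1 (q t) x ^+ 2.
    by rewrite addr_ge0// sqr_ge0.
  apply/andP; split; (apply: mean_le; [by solve_dble|by solve_dble|move=> x]).
    by rewrite -[X in X <= _]mulrN1 ler_wpM2l// cos_geN1.
  by rewrite -[X in _ <= X]mulr1 ler_wpM2l// cos_le1.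
set e1 := 2 * mean _; set e2 := 2 * mean _.
have He1 : `|e1| <= 2^-1.
  rewrite /e1 (_ : (fun x => _) = fun x => (tser n 1 (q t) x * r1 t x +
    tser n 1 (p t) x * r2 t x) * sin (2 * x)); last by apply/funext => x; rewrite /r1 /r2; ring.
  apply: error_le; try exact: dble_tser; try exact: dble_remainder.
  - exact: dble_sin.
  - by move=> x; exact: Q1_le.
  - by move=> x; exact: P1_le.
  - by move=> x; exact: r1_le.
  - by move=> x; exact: r2_le.
  - by move=> x; exact: sin_max.
have He2 : `|e2| <= 2^-1.
  apply: error_le; try exact: dble_tser; try exact: dble_remainder.
  - exact: dble_cos.
  - by move=> x; exact: Q_le.
  - by move=> x; exact: P_le.
  - by move=> x; exact: r1_le.
  - by move=> x; exact: r2_le.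
  - by move=> x; exact: cos_max.
rewrite Z_initial in Zt.
move: He1 He2 KE Zt F E'; rewrite !ler_norml.
move=> /andP[_ He1] /andP[_ He2] /andP[KE _] /andP[Zl Zu].
set ke := mean _ in KE *; set fl := mean _ => F E'.
have A2 : 10 ^+ 4 * A ^+ 2 <= A ^+ 4.
  rewrite (_ : A ^+ 4 = A ^+ 2 * A ^+ 2); last by ring.
  rewrite ler_wpM2r ?sqr_ge0//.
  by rewrite (_ : 10 ^+ 4 = 100 ^+ 2 :> R); [rewrite lerXn2r ?nnegrE// ltW|ring].
have A2' := ler_wpM2l (ltW (@pi_gt0 R)) A2.
have Z2 := ler_wpM2l (sqr_ge0 A) Zl.
have A1 : 1 <= A ^+ 2 by rewrite exprn_ege1// (le_trans _ A100)// ler1n.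
have A1' : 1 <= A ^+ 2 * pi.
  by rewrite -[1]mulr1 ler_pM// (le_trans _ pi2)// ler1n.
have A3 : A ^+ 2 * A^-1 <= A ^+ 2 by rewrite ler_piMr// sqr_ge0.
have A4 : A ^+ 2 <= A ^+ 2 * pi by rewrite ler_peMr ?sqr_ge0// (le_trans _ pi2)// ler1n.
move: Z2 F; rewrite (_ : A ^+ 2 * - _ = - (4 / 10 ^+ 3 * (pi * A ^+ 4)) - A ^+ 2 * A^-1); last by ring.
rewrite (_ : A ^+ 2 * (Z t - _) = A ^+ 2 * Z t - pi * A ^+ 4 / 2); last by field.
rewrite (_ : A ^+ 2 * (pi * A ^+ 2 + Z t) = pi * A ^+ 4 + A ^+ 2 * Z t); last by ring.
set X := pi * A ^+ 4 in A2' *; set AZ := A ^+ 2 * Z t; set Y := A ^+ 2 * A^-1 in A3 *.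
rewrite (_ : 5 / 16 * pi * A ^+ 4 = 5 / 16 * X); last by rewrite /X; ring.
rewrite (_ : 3 / 4 * pi * A ^+ 4 = 3 / 4 * X); last by rewrite /X; ring.
move: E'; rewrite (_ : pi * (2 * A ^+ 2 + 3 / 4 * A ^+ 4) = 2 * (A ^+ 2 * pi) + 3 / 4 * X); last by rewrite /X; ring.
set W := A ^+ 2 * pi in A1' A4 *.
move: A2' KE Zl; rewrite (_ : pi * (10 ^+ 4 * A ^+ 2) = 10 ^+ 4 * W); last by rewrite /W; ring.
rewrite (_ : pi * (A ^+ 4 / 10 ^+ 6) = X / 10 ^+ 6); last by rewrite /X; ring.
rewrite (_ : 4 * pi * A ^+ 2 / 10 ^+ 3 = 4 / 10 ^+ 3 * W); last by rewrite /W; ring.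
rewrite (_ : pi / 2 * A ^+ 2 = W / 2); last by rewrite /W; field.
set qu := pi * quartic _ _ _.
move=> h1 h2 h3 h4 h5 h6.
exact: (arith h1 h2 h3 Ainv1 h4 h5 h6 (le_trans A3 A4) A1' He1 He2).
Qed.

Theorem galerkin_growth : exists2 t, 0 <= t <= A^-1 & A ^+ 4 / 10 ^+ 6 < kin t.
Proof.
apply: contrapT => H.
have K s : 0 <= s <= A^-1 -> kin s <= A ^+ 4 / 10 ^+ 6.
  by move=> sA; rewrite leNgt; apply/negP => h; apply: H; exists s.
have Ai : 0 <= A^-1 by rewrite invr_ge0 ltW.
pose c := - (4^-1 * (pi * A ^+ 4)).
have := @ler_increment _ J _ (fun y => c * y) (fun=> c) 0 A^-1 Ai dJ
  (fun x => der_scale_id c x) (fun x xA => current_rate_le xA K).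
have J1 := J_le (K A^-1 _); have J0 := J_le (K 0 _).
move: (J1 ltac:(by rewrite Ai lexx)) (J0 ltac:(by rewrite lexx Ai)).
rewrite !ler_norml => /andP[J1l _] /andP[_ J0u].
rewrite mulr0 subr0 (_ : c * A^-1 = - (4^-1 * (pi * A ^+ 3))); last first.
  by rewrite /c; field; rewrite gt_eqF.
have : 0 < pi * A ^+ 3 by rewrite mulr_gt0 ?pi_gt0// exprn_gt0.
move: J1l J0u; rewrite (_ : pi * A ^+ 3 / 10 ^+ 3 = 1 / 10 ^+ 3 * (pi * A ^+ 3)); last by ring.
set X := pi * A ^+ 3; lra.
Qed.

End GalerkinGrowth.

(** * Passage to the limit *)

(* Polynomials in the formal variables [d_x^k Re u] and [d_x^k Im u]; the equation turns
   [d_x] and [d_t] into derivations of this ring. *)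
Inductive jet (R : Type) : Type :=
| JRe of nat
| JIm of nat
| JCst of R
| JAdd of jet R & jet R
| JOpp of jet R
| JMul of jet R & jet R.

Arguments JRe {R}.
Arguments JIm {R}.

Section Jets.
Context {R : realType}.
Implicit Types (e f : jet R) (k n : nat) (t x S : R).

Fixpoint jeval (a b : nat -> R) e : R :=
  match e with
  | JRe k => a k
  | JIm k => b k
  | JCst c => c
  | JAdd f g => jeval a b f + jeval a b g
  | JOpp f => - jeval a b f
  | JMul f g => jeval a b f * jeval a b g
  end.

Fixpoint jderive (dre dim : nat -> jet R) e : jet R :=
  match e with
  | JRe k => dre k
  | JIm k => dim k
  | JCst _ => JCst 0
  | JAdd f g => JAdd (jderive dre dim f) (jderive dre dim g)
  | JOpp f => JOpp (jderive dre dim f)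
  | JMul f g => JAdd (JMul (jderive dre dim f) g) (JMul f (jderive dre dim g))
  end.

Definition jdx : jet R -> jet R := jderive (fun k => JRe k.+1) (fun k => JIm k.+1).

Definition jdensity : jet R := JAdd (JMul (JRe 0) (JRe 0)) (JMul (JIm 0) (JIm 0)).
Definition jcubic_re : jet R := JMul jdensity (JRe 0).
Definition jcubic_im : jet R := JMul jdensity (JIm 0).

Definition jdt_re k : jet R := JAdd (JIm k.+2) (JOpp (iter k jdx jcubic_im)).
Definition jdt_im k : jet R := JAdd (JOpp (JRe k.+2)) (iter k jdx jcubic_re).

(* The derivative in the direction [(tau, xi)] of space-time. *)
Definition jdir (tau xi : R) : jet R -> jet R :=
  jderive (fun k => JAdd (JMul (JCst tau) (jdt_re k)) (JMul (JCst xi) (JRe k.+1)))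
          (fun k => JAdd (JMul (JCst tau) (jdt_im k)) (JMul (JCst xi) (JIm k.+1))).

Lemma der_jeval (V : normedModType R) (a b : nat -> V -> R) (dre dim : nat -> jet R) (p v : V) e :
  (forall k, is_derive p v (a k) (jeval (a ^~ p) (b ^~ p) (dre k))) ->
  (forall k, is_derive p v (b k) (jeval (a ^~ p) (b ^~ p) (dim k))) ->
  is_derive p v (fun y => jeval (a ^~ y) (b ^~ y) e)
    (jeval (a ^~ p) (b ^~ p) (jderive dre dim e)).
Proof.
move=> da db; elim: e => [k|k|c|f IHf g IHg|f IHf|f IHf g IHg] /=.
- exact: da.
- exact: db.
- exact: der_cst.
- exact: der_add.
- exact: der_opp.
- exact: der_mul.
Qed.

Definition tser_jet n (a b : nat -> R) x e : R :=
  jeval (fun k => tser n k a x) (fun k => tser n k b x) e.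

Lemma der_tser_jet n a b x e :
  is_derive x (1 : R) (fun y => tser_jet n a b y e) (tser_jet n a b x (jdx e)).
Proof.
by apply: (@der_jeval R (fun k => tser n k a) (fun k => tser n k b)) => k;
  exact: der_tser.
Qed.

(** Both sides are [k]-th derivatives of one function of [x], so an identity between values
    propagates to all derivatives. *)
Lemma tser_iter_jdx n m k (a b c : nat -> R) e :
  (forall x, tser m 0 c x = tser_jet n a b x e) ->
  forall x, tser m k c x = tser_jet n a b x (iter k jdx e).
Proof.
move=> E0; elim: k => [//|k IH] x; rewrite iterS.
have D1 := der_tser m k c x; have D2 := der_tser_jet n a b x (iter k jdx e).
have E : tser m k c = fun y => tser_jet n a b y (iter k jdx e) by apply/funext.
by rewrite E in D1; rewrite -(@derive_val _ _ _ _ _ _ _ D1) (@derive_val _ _ _ _ _ _ _ D2).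
Qed.

Lemma tser_field_re_jet n k a b x : tser n k (field_re n a b) x =
  tser_jet n a b x (jdt_re k) + remainder n k (cubic_im n a b) x.
Proof.
rewrite tser_field_re (@tser_iter_jdx n _ k a b _ jcubic_im)// => y.
by rewrite tser_cubic_im /tser_jet/= !expr2.
Qed.

Lemma tser_field_im_jet n k a b x : tser n k (field_im n a b) x =
  tser_jet n a b x (jdt_im k) - remainder n k (cubic_re n a b) x.
Proof.
rewrite tser_field_im (@tser_iter_jdx n _ k a b _ jcubic_re)// => y.
by rewrite tser_cubic_re /tser_jet/= !expr2.
Qed.

Section GalerkinFamily.
Variables (A : R) (p q : nat -> R -> nat -> R).
Hypothesis G : forall n, galerkin A n.+1 (p n) (q n).

Definition gjet n t x e : R := tser_jet n.+1 (p n t) (q n t) x e.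

Lemma gjet_bounded S e : exists2 C, 0 <= C &
  forall n t x, `|t| <= S -> `|gjet n t x e| <= C.
Proof.
elim: e => [k|k|c|f [C C0 Hf] g [D D0 Hg]|f [C C0 Hf]|f [C C0 Hf] g [D D0 Hg]].
- exists (weighted_bound A k S); first exact: weighted_bound_ge0.
  by move=> n t x tS; exact: (galerkin_tser_re (G n) isT k x tS).
- exists (weighted_bound A k S); first exact: weighted_bound_ge0.
  by move=> n t x tS; exact: (galerkin_tser_im (G n) isT k x tS).
- by exists `|c|.
- exists (C + D); first exact: addr_ge0.
  by move=> n t x tS; rewrite (le_trans (ler_normD _ _))// lerD ?Hf ?Hg.
- by exists C => // n t x tS; rewrite /gjet /tser_jet/= normrN; exact: Hf.
- exists (C * D); first exact: mulr_ge0.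
  by move=> n t x tS; rewrite /gjet /tser_jet/= normrM ler_pM ?Hf ?Hg.
Qed.

(** Along a space-time ray the truncation depends on one variable, so the one-dimensional mean value
    theorem handles all directions at once. *)
Lemma der_ray_re n k t x (tau xi h : R) :
  is_derive h (1 : R) (fun s => tser n.+1 k (p n (t + s * tau)) (x + s * xi))
    (tau * tser n.+1 k (field_re n.+1 (p n (t + h * tau)) (q n (t + h * tau))) (x + h * xi) +
     xi * tser n.+1 k.+1 (p n (t + h * tau)) (x + h * xi)).
Proof.
have ray (y d : R) : is_derive h (1 : R) (fun s : R => y + s * d) d.
  apply: (der_eq (der_add (der_cst y h 1) (der_mul (der_id h) (der_cst d h 1)))).
  by rewrite mulr0 addr0 mul1r add0r.
have D1 l := @der_comp R (fun u => p n u l) (fun s => t + s * tau) h _ _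
  (galerkin_dre (G n) (t + h * tau) l) (ray t tau).
have D2 l := @der_comp R (fun y => cosd k (freq l * y)) (fun s => x + s * xi) h _ _
  (der_cosd_scale k (freq l) (x + h * xi)) (ray x xi).
apply: (der_eq (der_sum_ord n.+1 (fun l => der_mul
  (der_scale (freq l ^+ k) (D1 l)) (D2 l)))).
rewrite /tser !mulr_sumr -big_split; apply: eq_bigr => l _.
by rewrite /= exprS; ring.
Qed.

Lemma der_ray_im n k t x (tau xi h : R) :
  is_derive h (1 : R) (fun s => tser n.+1 k (q n (t + s * tau)) (x + s * xi))
    (tau * tser n.+1 k (field_im n.+1 (p n (t + h * tau)) (q n (t + h * tau))) (x + h * xi) +
     xi * tser n.+1 k.+1 (q n (t + h * tau)) (x + h * xi)).
Proof.
have ray (y d : R) : is_derive h (1 : R) (fun s : R => y + s * d) d.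
  apply: (der_eq (der_add (der_cst y h 1) (der_mul (der_id h) (der_cst d h 1)))).
  by rewrite mulr0 addr0 mul1r add0r.
have D1 l := @der_comp R (fun u => q n u l) (fun s => t + s * tau) h _ _
  (galerkin_dim (G n) (t + h * tau) l) (ray t tau).
have D2 l := @der_comp R (fun y => cosd k (freq l * y)) (fun s => x + s * xi) h _ _
  (der_cosd_scale k (freq l) (x + h * xi)) (ray x xi).
apply: (der_eq (der_sum_ord n.+1 (fun l => der_mul
  (der_scale (freq l ^+ k) (D1 l)) (D2 l)))).
rewrite /tser !mulr_sumr -big_split; apply: eq_bigr => l _.
by rewrite /= exprS; ring.
Qed.

Definition rem_bound k S : R := 2 * cubic_bound A k.+2 S.

Lemma rem_bound_ge0 k S : 0 <= rem_bound k S.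
Proof. by rewrite mulr_ge0// cubic_bound_ge0. Qed.

Lemma rem_le k S n t x : `|t| <= S ->
  `|remainder n.+1 k (cubic_re n.+1 (p n t) (q n t)) x| <= rem_bound k S / n.+1%:R /\
  `|remainder n.+1 k (cubic_im n.+1 (p n t) (q n t)) x| <= rem_bound k S / n.+1%:R.
Proof. exact: (galerkin_remainder (G n) isT k x). Qed.

Let segment_le S (t t' s : R) : `|t| <= S -> `|t'| <= S -> 0 <= s <= 1 ->
  `|t + s * (t' - t)| <= S.
Proof.
move=> tS tS' /andP[s0 s1].
rewrite (_ : _ + _ = (1 - s) * t + s * t'); last by ring.
rewrite (le_trans (ler_normD _ _))// !normrM (ger0_norm s0) ger0_norm ?subr_ge0//.
by have := ler_wpM2l s0 tS'; have := ler_wpM2l (_ : 0 <= 1 - s) tS; rewrite subr_ge0 => /(_ s1); lra.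
Qed.

(** For a variable, the derivative along a segment is a jet plus a remainder, both bounded uniformly
    in [n]; sums and products follow by induction. *)
Lemma gjet_lipschitz S e : exists2 C, 0 <= C & forall n t t' x x',
  `|t| <= S -> `|t'| <= S ->
  `|gjet n t' x' e - gjet n t x e| <= C * (`|t' - t| + `|x' - x|).
Proof.
elim: e => [k|k|c|f [C C0 Hf] g [D D0 Hg]|f [C C0 Hf]|f [C C0 Hf] g [D D0 Hg]].
- have [C C0 HC] := gjet_bounded S (jdt_re k).
  exists (C + rem_bound k S + weighted_bound A k.+1 S).
    exact: addr_ge0 (addr_ge0 C0 (rem_bound_ge0 k S)) (weighted_bound_ge0 A k.+1 S).
  move=> n t t' x x' tS tS'.
  have [s s01] := mean_value ler01 (der_ray_re n k t x (t' - t) (x' - x)).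
  rewrite subr0 mulr1 !mul0r !addr0 !mul1r ![_ + (_ - _)]addrC !subrK.
  rewrite -/(gjet n t' x' (JRe k)) -/(gjet n t x (JRe k)) => ->.
  have sS := segment_le tS tS' s01.
  have [_ R1] := rem_le k n (x + s * (x' - x)) sS.
  have R2 : rem_bound k S / n.+1%:R <= rem_bound k S.
    by rewrite ler_pdivrMr ?ltr0n// ler_peMr ?rem_bound_ge0// ler1n.
  rewrite tser_field_re_jet; apply: le_trans (ler_normD _ _) _.
  rewrite !normrM [X in _ <= X]mulrDr lerD//.
    rewrite mulrC ler_wpM2r// (le_trans (ler_normD _ _))//.
    apply: (@le_trans _ _ (C + rem_bound k S)); last by rewrite lerDl weighted_bound_ge0.
    by apply: lerD; [exact: HC|exact: le_trans R1 R2].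
  rewrite mulrC ler_wpM2r// (le_trans (galerkin_tser_re (G n) isT k.+1 _ sS))//.
  rewrite lerDr; exact: addr_ge0 C0 (rem_bound_ge0 k S).
- have [C C0 HC] := gjet_bounded S (jdt_im k).
  exists (C + rem_bound k S + weighted_bound A k.+1 S).
    exact: addr_ge0 (addr_ge0 C0 (rem_bound_ge0 k S)) (weighted_bound_ge0 A k.+1 S).
  move=> n t t' x x' tS tS'.
  have [s s01] := mean_value ler01 (der_ray_im n k t x (t' - t) (x' - x)).
  rewrite subr0 mulr1 !mul0r !addr0 !mul1r ![_ + (_ - _)]addrC !subrK.
  rewrite -/(gjet n t' x' (JIm k)) -/(gjet n t x (JIm k)) => ->.
  have sS := segment_le tS tS' s01.
  have [R1 _] := rem_le k n (x + s * (x' - x)) sS.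
  have R2 : rem_bound k S / n.+1%:R <= rem_bound k S.
    by rewrite ler_pdivrMr ?ltr0n// ler_peMr ?rem_bound_ge0// ler1n.
  rewrite tser_field_im_jet; apply: le_trans (ler_normD _ _) _.
  rewrite !normrM [X in _ <= X]mulrDr lerD//.
    rewrite mulrC ler_wpM2r// (le_trans (ler_normB _ _))//.
    apply: (@le_trans _ _ (C + rem_bound k S)); last by rewrite lerDl weighted_bound_ge0.
    by apply: lerD; [exact: HC|exact: le_trans R1 R2].
  rewrite mulrC ler_wpM2r// (le_trans (galerkin_tser_im (G n) isT k.+1 _ sS))//.
  rewrite lerDr; exact: addr_ge0 C0 (rem_bound_ge0 k S).
- by exists 0 => // n t t' x x' _ _; rewrite /gjet/tser_jet/= subrr normr0 mul0r.
- exists (C + D); first exact: addr_ge0.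
  move=> n t t' x x' tS tS'.
  rewrite (_ : _ - _ = gjet n t' x' f - gjet n t x f + (gjet n t' x' g - gjet n t x g)).
    by rewrite (le_trans (ler_normD _ _))// mulrDl lerD ?Hf ?Hg.
  by rewrite /gjet/tser_jet/=; ring.
- exists C => // n t t' x x' tS tS'; rewrite /gjet/tser_jet/= -opprD normrN.
  exact: Hf.
- have [M M0 HM] := gjet_bounded S f; have [N N0 HN] := gjet_bounded S g.
  exists (C * N + M * D); first by rewrite addr_ge0 ?mulr_ge0.
  move=> n t t' x x' tS tS'.
  rewrite (_ : _ - _ = (gjet n t' x' f - gjet n t x f) * gjet n t' x' g +
    gjet n t x f * (gjet n t' x' g - gjet n t x g)).
    rewrite (le_trans (ler_normD _ _))// !normrM mulrDl lerD//.
      by rewrite mulrAC ler_pM ?Hf ?HN.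
    by rewrite -mulrA ler_pM ?Hg ?HM.
  by rewrite /gjet/tser_jet/=; ring.
Qed.

End GalerkinFamily.
End Jets.

Section UltraLimitFunction.
Context {R : realType}.
Local Open Scope classical_set_scope.

(** Total by the default 0; every sequence to which it is applied below is bounded, hence
    convergent. *)
Definition ulim (f : nat -> R) : R := xget 0 [set l | ucvg f l].

Lemma ulimP f : (exists l, ucvg f l) -> ucvg f (ulim f).
Proof. by move=> fl; exact: (@xgetPex R 0 [set l | ucvg f l] fl). Qed.

Lemma ulimE f l : ucvg f l -> ulim f = l.
Proof.
by move=> fl; have fl' := ulimP (ex_intro _ l fl); exact: (ucvg_unique fl' fl).
Qed.

End UltraLimitFunction.

(** * The limit function, its derivatives and its smoothness *)

Section Limit.
Context {R : realType}.
Variables (A : R) (p q : nat -> R -> nat -> R).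
Hypothesis G : forall n, galerkin A n.+1 (p n) (q n).
Implicit Types (e f : jet R) (k n : nat) (t x S : R).

Definition jet_re k t x : R := ulim (fun n => tser n.+1 k (p n t) x).
Definition jet_im k t x : R := ulim (fun n => tser n.+1 k (q n t) x).
Definition ujet t x e : R := jeval (fun k => jet_re k t x) (fun k => jet_im k t x) e.

Lemma gjet_cvg t x e : ucvg (fun n => gjet p q n t x e) (ujet t x e).
Proof.
elim: e => [k|k|c|f Hf g Hg|f Hf|f Hf g Hg].
- apply: ulimP; apply: ucvg_bounded => n.
  exact: (galerkin_tser_re (G n) isT k x (lexx _)).
- apply: ulimP; apply: ucvg_bounded => n.
  exact: (galerkin_tser_im (G n) isT k x (lexx _)).
- exact: ucvg_cst.
- exact: ucvgD.
- exact: ucvgN.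
- exact: ucvgM.
Qed.

Lemma ujet_lipschitz S e : exists2 C, 0 <= C & forall t t' x x',
  `|t| <= S -> `|t'| <= S ->
  `|ujet t' x' e - ujet t x e| <= C * (`|t' - t| + `|x' - x|).
Proof.
have [C C0 H] := gjet_lipschitz G S e; exists C => // t t' x x' tS tS'.
apply: (@ucvg_norm_le _ 0 (fun n => gjet p q n t' x' e - gjet p q n t x e)).
  by apply: ucvgB; exact: gjet_cvg.
by move=> n _; exact: H.
Qed.

Lemma ujet_period t x e (z : int) : ujet t (x + 2 * pi * z%:~R) e = ujet t x e.
Proof.
congr jeval; apply/funext => k; congr ulim; apply/funext => n; exact: tser_periodic.
Qed.

(** Each [f n] has derivative [g n] at 0 only up to [K / n.+1]; this defect vanishes in the limit
    and leaves a purely quadratic error. *)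
Let quadratic_limit (f : nat -> R -> R) (F : R -> R) (g : nat -> R) (d C K : R) :
  0 <= K ->
  (forall h, ucvg (fun n => f n h) (F h)) -> ucvg g d ->
  (forall n (h : R), `|h| <= 1 -> exists2 s : R, `|s| <= `|h| &
    exists2 d', f n h - f n 0 = d' * h & `|d' - g n| <= C * `|s| + K / n.+1%:R) ->
  0 <= C ->
  forall h : R, `|h| <= 1 -> `|F h - F 0 - h * d| <= C * h ^+ 2.
Proof.
move=> K0 fF gd H C0 h h1.
have L : ucvg (fun n => f n h - f n 0 - h * g n) (F h - F 0 - h * d).
  apply: ucvgB; first by apply: ucvgB; exact: fF.
  by apply: ucvgM => //; exact: ucvg_cst.
have B : ucvg (fun n => C * h ^+ 2 + K / n.+1%:R) (C * h ^+ 2 + 0).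
  by apply: ucvgD; [exact: ucvg_cst|exact: ucvg_inv_nat].
rewrite addr0 in B.
apply: (ucvg_le (N := 0) (ucvg_norm L) B) => n _.
have [s sh [d' -> dg]] := H n h h1.
rewrite [d' * h]mulrC -mulrBr normrM; apply: le_trans (ler_wpM2l (normr_ge0 h) dg) _.
rewrite mulrDr lerD//.
  rewrite mulrCA ler_wpM2l// -[h ^+ 2]real_normK ?num_real// expr2 ler_wpM2l//.
by rewrite ler_piMl// divr_ge0.
Qed.

Let ray_mean_value (f f' : R -> R) (h : R) : (forall s, is_derive s (1 : R) f (f' s)) ->
  exists2 s : R, `|s| <= `|h| & f h - f 0 = f' s * h.
Proof.
by move=> df; have [s] := mean_value_norm 0 h df; rewrite !subr0 => sh E; exists s.
Qed.

Let ray_bound (t tau h s : R) : `|h| <= 1 -> `|s| <= `|h| -> `|t + s * tau| <= `|t| + `|tau|.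
Proof.
move=> h1 sh; rewrite (le_trans (ler_normD _ _))// lerD2l normrM ler_piMl//.
exact: le_trans sh h1.
Qed.

(** The jets [jet_re k] are separate limits for each [k]; this is where they become derivatives of
    one another and where the equation enters, the remainder being [O(1/n)]. *)
Lemma der_jet_re k (z v : R * (R * R)) :
  is_derive z v (fun y : R * (R * R) => jet_re k y.1 y.2.1)
   (ujet z.1 z.2.1 (JAdd (JMul (JCst v.1) (jdt_re k)) (JMul (JCst v.2.1) (JRe k.+1)))).
Proof.
case: z v => [t [x y]] [tau [xi eta]] /=.
set e := JAdd _ _; pose S := `|t| + `|tau|.
have [C C0 HC] := gjet_lipschitz G S e.
apply: (@der_of_quadratic_bound _ _ _ _ _ _ (C * (`|tau| + `|xi|))) => h h1 /=.
rewrite ![h *: _]/GRing.scale/= ![h * _ + _]addrC.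
rewrite -[X in _ - jet_re k X x]addr0 -[X in _ - jet_re k _ X]addr0.
rewrite -[X in _ - jet_re k (_ + X) _](mul0r tau) -[X in _ - jet_re k _ (_ + X)](mul0r xi).
apply: (@quadratic_limit (fun n h => tser n.+1 k (p n (t + h * tau)) (x + h * xi))
  (fun h => jet_re k (t + h * tau) (x + h * xi)) (fun n => gjet p q n t x e) _ _
  (`|tau| * rem_bound A k S)) => //.
- by rewrite mulr_ge0// rem_bound_ge0.
- by move=> s; exact: (@gjet_cvg (t + s * tau) (x + s * xi) (JRe k)).
- exact: gjet_cvg.
- move=> n s s1; have [r rs E] := ray_mean_value s (der_ray_re G n k t x tau xi).
  exists r => //; eexists; first exact: E.
  have rS := ray_bound t tau s1 rs.
  rewrite tser_field_re_jet; have [_ R1] := rem_le G k n (x + r * xi) rS.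
  rewrite (_ : _ - _ = (gjet p q n (t + r * tau) (x + r * xi) e - gjet p q n t x e) +
     tau * remainder n.+1 k (cubic_im n.+1 (p n (t + r * tau)) (q n (t + r * tau))) (x + r * xi)).
    rewrite (le_trans (ler_normD _ _))// lerD//.
      have tS : `|t| <= S by rewrite lerDl.
      apply: le_trans (HC n t (t + r * tau) x (x + r * xi) tS rS) _.
      by rewrite ![_ + _ - _]addrAC !subrr !add0r !normrM -mulrDr mulrCA mulrC.
    by rewrite normrM -mulrA ler_wpM2l.
  by rewrite /gjet /tser_jet /e/=; ring.
- by rewrite mulr_ge0// addr_ge0.
Qed.

Lemma der_jet_im k (z v : R * (R * R)) :
  is_derive z v (fun y : R * (R * R) => jet_im k y.1 y.2.1)
   (ujet z.1 z.2.1 (JAdd (JMul (JCst v.1) (jdt_im k)) (JMul (JCst v.2.1) (JIm k.+1)))).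
Proof.
case: z v => [t [x y]] [tau [xi eta]] /=.
set e := JAdd _ _; pose S := `|t| + `|tau|.
have [C C0 HC] := gjet_lipschitz G S e.
apply: (@der_of_quadratic_bound _ _ _ _ _ _ (C * (`|tau| + `|xi|))) => h h1 /=.
rewrite ![h *: _]/GRing.scale/= ![h * _ + _]addrC.
rewrite -[X in _ - jet_im k X x]addr0 -[X in _ - jet_im k _ X]addr0.
rewrite -[X in _ - jet_im k (_ + X) _](mul0r tau) -[X in _ - jet_im k _ (_ + X)](mul0r xi).
apply: (@quadratic_limit (fun n h => tser n.+1 k (q n (t + h * tau)) (x + h * xi))
  (fun h => jet_im k (t + h * tau) (x + h * xi)) (fun n => gjet p q n t x e) _ _
  (`|tau| * rem_bound A k S)) => //.
- by rewrite mulr_ge0// rem_bound_ge0.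
- by move=> s; exact: (@gjet_cvg (t + s * tau) (x + s * xi) (JIm k)).
- exact: gjet_cvg.
- move=> n s s1; have [r rs E] := ray_mean_value s (der_ray_im G n k t x tau xi).
  exists r => //; eexists; first exact: E.
  have rS := ray_bound t tau s1 rs.
  rewrite tser_field_im_jet; have [R1 _] := rem_le G k n (x + r * xi) rS.
  rewrite (_ : _ - _ = (gjet p q n (t + r * tau) (x + r * xi) e - gjet p q n t x e) -
     tau * remainder n.+1 k (cubic_re n.+1 (p n (t + r * tau)) (q n (t + r * tau))) (x + r * xi)).
    rewrite (le_trans (ler_normB _ _))// lerD//.
      have tS : `|t| <= S by rewrite lerDl.
      apply: le_trans (HC n t (t + r * tau) x (x + r * xi) tS rS) _.
      by rewrite ![_ + _ - _]addrAC !subrr !add0r !normrM -mulrDr mulrCA mulrC.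
    by rewrite normrM -mulrA ler_wpM2l.
  by rewrite /gjet /tser_jet /e/=; ring.
- by rewrite mulr_ge0// addr_ge0.
Qed.

Lemma der_ujet e (z v : R * (R * R)) :
  is_derive z v (fun y : R * (R * R) => ujet y.1 y.2.1 e)
   (ujet z.1 z.2.1 (jdir v.1 v.2.1 e)).
Proof.
apply: (@der_jeval R _ (fun k (y : R * (R * R)) => jet_re k y.1 y.2.1)
  (fun k (y : R * (R * R)) => jet_im k y.1 y.2.1)) => k.
- exact: der_jet_re.
- exact: der_jet_im.
Qed.

Lemma continuous_ujet e : continuous (fun y : R * (R * R) => ujet y.1 y.2.1 e : R^o).
Proof.
move=> z; have [C C0 H] := ujet_lipschitz (`|z.1| + 1) e.
apply/cvgrPdist_le => eps eps0; near=> y.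
have N : `|z - y| <= Num.min 1 (eps / (2 * C + 1)).
  near: y; apply: (@cvgr_dist_le _ _ _ (nbhs z) _ id z cvg_id).
  by rewrite lt_min ltr01 divr_gt0// ltr_wpDl// mulr_ge0.
have N1 : `|z.1 - y.1| <= `|z - y| by rewrite [X in _ <= X]prod_normE le_max lexx.
have N2 : `|z.2.1 - y.2.1| <= `|z - y|.
  by rewrite [X in _ <= X]prod_normE le_max prod_normE le_max lexx orbT.
move: N; rewrite le_min => /andP[Na Nb].
have yS : `|y.1| <= `|z.1| + 1.
  by have := ler_normB z.1 (z.1 - y.1); rewrite subKr; have := le_trans N1 Na; lra.
have zS : `|z.1| <= `|z.1| + 1 by rewrite lerDl.
apply: le_trans (H _ _ _ _ yS zS) _.
have D0 : 0 < 2 * C + 1 by rewrite ltr_wpDl// mulr_ge0.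
move: Nb; rewrite ler_pdivlMr// => Nb.
have := ler_wpM2l C0 (lerD N1 N2); have := normr_ge0 (z - y); nra.
Unshelve. all: by end_near. Qed.

(** Jets are closed under directional derivatives, so every iterated derivative is again a jet,
    hence continuous and differentiable. *)
Lemma smooth_ujet e :
  @smooth R (R * (R * R))%type R^o (fun y : R * (R * R) => ujet y.1 y.2.1 e).
Proof.
move=> vs.
have -> : iter_derive vs (fun y : R * (R * R) => ujet y.1 y.2.1 e : R^o) =
    fun y => ujet y.1 y.2.1 (foldr (fun v => jdir v.1 v.2.1) e vs).
  elim: vs => [//|v vs IH] /=; rewrite IH; apply/funext => z.
  by have [_ ->] := der_ujet (foldr (fun v => jdir v.1 v.2.1) e vs) z v.
split; first exact: continuous_ujet.
by move=> v z; have [] := der_ujet (foldr (fun v => jdir v.1 v.2.1) e vs) z v.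
Qed.

End Limit.

(** * Fourier coefficients of the limit and the time of growth *)

Section LimitCoefficients.
Context {R : realType}.
Variables (A : R) (p q : nat -> R -> nat -> R).
Hypothesis G : forall n, galerkin A n.+1 (p n) (q n).
Implicit Types (k l m n J : nat) (t x S : R).

Definition coef_re l t : R := ulim (fun n => p n t l).
Definition coef_im l t : R := ulim (fun n => q n t l).

Lemma coef_re_cvg l t : ucvg (fun n => p n t l) (coef_re l t).
Proof.
apply: ulimP; apply: (@ucvg_bounded _ _ (weighted_bound A 0 `|t|)) => n.
by have [+ _] := galerkin_coef (G n) isT 0 l (lexx `|t|); rewrite expr0 mulr1.
Qed.

Lemma coef_im_cvg l t : ucvg (fun n => q n t l) (coef_im l t).
Proof.
apply: ulimP; apply: (@ucvg_bounded _ _ (weighted_bound A 0 `|t|)) => n.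
by have [_ +] := galerkin_coef (G n) isT 0 l (lexx `|t|); rewrite expr0 mulr1.
Qed.

Lemma coef_re0 l : coef_re l 0 = if l == 0%N then A else 0.
Proof.
apply: ulimE; apply: (@ucvg_ext _ 0 (fun=> if l == 0%N then A else 0)).
  exact: ucvg_cst.
by move=> n _; rewrite (galerkin_re0 (G n)).
Qed.

Lemma coef_im0 l : coef_im l 0 = 0.
Proof.
apply: ulimE; apply: (@ucvg_ext _ 0 (fun=> 0)); first exact: ucvg_cst.
by move=> n _; rewrite (galerkin_im0 (G n)).
Qed.

Definition coef_rate l : R := freq l ^+ 2 * weighted_bound A 0 1 + cubic_bound A 0 1.

Let field_le n l t : `|t| <= 1 ->
  `|field_re n.+1 (p n t) (q n t) l| <= coef_rate l /\
  `|field_im n.+1 (p n t) (q n t) l| <= coef_rate l.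
Proof.
move=> t1.
have c0 : 0 <= coef_rate l.
  apply: addr_ge0 (cubic_bound_ge0 A 0 1); apply: mulr_ge0 (weighted_bound_ge0 A 0 1).
  exact/ltW/freqX_gt0.
have [c1 c2] := galerkin_coef (G n) isT 0 l t1.
have [d1 d2] := galerkin_cubic (G n) isT 0 l t1.
rewrite expr0 !mulr1 in c1 c2 d1 d2.
rewrite /field_re /field_im; case: ifP => _; last by rewrite normr0.
have F : 0 <= freq l ^+ 2 :> R by exact/ltW/freqX_gt0.
split; rewrite ?normrN (le_trans (ler_normD _ _))// lerD//.
  by rewrite normrM (ger0_norm F) ler_wpM2l.
by rewrite normrM (ger0_norm F) ler_wpM2l.
Qed.

Let coef_lipschitz n l t t' : `|t| <= 1 -> `|t'| <= 1 ->
  `|p n t' l - p n t l| <= coef_rate l * `|t' - t| /\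
  `|q n t' l - q n t l| <= coef_rate l * `|t' - t|.
Proof.
wlog tt' : t t' / t <= t' => [W t1 t1'|t1 t1'].
  have [tt'|/ltW tt'] := leP t t'; first exact: W.
  by rewrite (distrC (p n t' l)) (distrC (q n t' l)) (distrC t'); exact: W.
have B s : t <= s <= t' -> `|s| <= 1.
  move: t1 t1'; rewrite !ler_norml => /andP[t1 _] /andP[_ t1'] /andP[ts st].
  by rewrite (le_trans t1 ts) (le_trans st t1').
have [s /B s1 ->] := mean_value tt' (fun s => galerkin_dre (G n) s l).
have [r /B r1 ->] := mean_value tt' (fun s => galerkin_dim (G n) s l).
by rewrite !normrM; split; rewrite ler_wpM2r//;
  [have [] := field_le n l s1|have [] := field_le n l r1].
Qed.

(** The growth time depends on the truncation; a Lipschitz bound in time, uniform in [n], lets the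
    coefficients be followed to the limit of these times. *)
Lemma coef_re_moving l T (t : nat -> R) : `|T| <= 1 -> (forall n, `|t n| <= 1) ->
  ucvg t T -> ucvg (fun n => p n (t n) l) (coef_re l T).
Proof.
move=> T1 t1 tT.
have E : ucvg (fun n => coef_rate l * `|t n - T|) 0.
  rewrite -(mulr0 (coef_rate l)); apply: ucvgM; first exact: ucvg_cst.
  rewrite -(normr0 R); apply: ucvg_norm; rewrite -(subrr T).
  exact: ucvgB tT (@ucvg_cst _ _).
have H : ucvg (fun n => p n (t n) l - p n T l) 0.
  apply: (@ucvg_squeeze _ 0 _ _ _ E) => n _; rewrite subr0.
  by have [] := coef_lipschitz n l T1 (t1 n).
have := ucvgD H (@coef_re_cvg l T); rewrite add0r.
by rewrite (_ : (fun n => _) = fun n => p n (t n) l)//; apply/funext => n; rewrite subrK.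
Qed.

Lemma coef_im_moving l T (t : nat -> R) : `|T| <= 1 -> (forall n, `|t n| <= 1) ->
  ucvg t T -> ucvg (fun n => q n (t n) l) (coef_im l T).
Proof.
move=> T1 t1 tT.
have E : ucvg (fun n => coef_rate l * `|t n - T|) 0.
  rewrite -(mulr0 (coef_rate l)); apply: ucvgM; first exact: ucvg_cst.
  rewrite -(normr0 R); apply: ucvg_norm; rewrite -(subrr T).
  exact: ucvgB tT (@ucvg_cst _ _).
have H : ucvg (fun n => q n (t n) l - q n T l) 0.
  apply: (@ucvg_squeeze _ 0 _ _ _ E) => n _; rewrite subr0.
  by have [] := coef_lipschitz n l T1 (t1 n).
have := ucvgD H (@coef_im_cvg l T); rewrite add0r.
by rewrite (_ : (fun n => _) = fun n => q n (t n) l)//; apply/funext => n; rewrite subrK.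
Qed.

Definition coef2 l t : R := coef_re l t ^+ 2 + coef_im l t ^+ 2.

Lemma coef2_ge0 l t : 0 <= coef2 l t.
Proof. by rewrite addr_ge0// sqr_ge0. Qed.

Let sum_support n J t (F : nat -> R) :
  \sum_(l < J) F l * (p n t l ^+ 2 + q n t l ^+ 2) =
  \sum_(l < n.+1) (if (l < J)%N then F l * (p n t l ^+ 2 + q n t l ^+ 2) else 0).
Proof.
pose H l := F l * (p n t l ^+ 2 + q n t l ^+ 2).
have H0 l : (n < l)%N -> H l = 0.
  by move=> nl; have [pl ql] := galerkin_high (G n) t nl; rewrite /H pl ql expr0n/= addr0 mulr0.
rewrite -/(H _); have [Jn|nJ] := leqP J n.+1.
  by rewrite (big_ord_widen _ H Jn) big_mkcond.
rewrite [RHS](eq_bigr (fun l : 'I_n.+1 => H l)); last first.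
  by move=> l _; rewrite (ltn_trans (ltn_ord l) nJ).
rewrite (big_ord_widen _ H (ltnW nJ)) [RHS]big_mkcond/=; apply: eq_bigr => l _.
by case: ltnP => // nl; exact: H0.
Qed.

Lemma coef2_mass J t : \sum_(l < J) coef2 l t <= A ^+ 2.
Proof.
have L : ucvg (fun n => \sum_(l < J) (p n t l ^+ 2 + q n t l ^+ 2)) (\sum_(l < J) coef2 l t).
  apply: ucvg_sum => l; rewrite /coef2 !expr2.
  rewrite (_ : (fun n => _) = fun n => p n t l * p n t l + q n t l * q n t l).
    by apply: ucvgD; apply: ucvgM; first [exact: coef_re_cvg|exact: coef_im_cvg].
  by apply/funext => n; rewrite !expr2.
apply: (ucvg_le (N := 0) L (@ucvg_cst _ (A ^+ 2))) => n _.
rewrite -(galerkin_mass (G n) isT t).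
have := sum_support n J t (fun=> 1); under eq_bigr do rewrite mul1r; move=> ->.
apply: ler_sum => l _; case: ifP => _; rewrite ?mul1r//.
by rewrite addr_ge0// sqr_ge0.
Qed.

(** The uniform second-order Sobolev bound keeps kinetic energy from escaping to infinite frequency
    as [n] grows. *)
Let kinetic_split n J t : `|t| <= 1 ->
  sobolev2 n.+1 1 (p n t) (q n t) <=
  \sum_(l < J) freq l ^+ 2 * (p n t l ^+ 2 + q n t l ^+ 2) +
  A ^+ 2 * expR (growth_rate A 2) / freq J ^+ 2.
Proof.
move=> t1; rewrite (sum_support n J t (fun l => freq l ^+ 2)).
have H : sobolev2 n.+1 2 (p n t) (q n t) <= A ^+ 2 * expR (growth_rate A 2).
  apply: le_trans (galerkin_sobolev (G n) isT 2 t) _; rewrite ler_wpM2l ?sqr_ge0//.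
  rewrite ler_expR ler_piMr// /growth_rate mulr_ge0 ?sqr_ge0// mulr_ge0// exprn_ge0//.
apply: (@le_trans _ _ (\sum_(l < n.+1)
    (if (l < J)%N then freq l ^+ 2 * (p n t l ^+ 2 + q n t l ^+ 2) else 0) +
    sobolev2 n.+1 2 (p n t) (q n t) / freq J ^+ 2)); last first.
  by rewrite lerD2l ler_wpM2r// invr_ge0 ltW// freqX_gt0.
rewrite /sobolev2 mulr_suml -big_split; apply: ler_sum => l _ /=.
set m := p n t l ^+ 2 + _; have m0 : 0 <= m by rewrite addr_ge0// sqr_ge0.
have fl := freqX_gt0 (R := R) 2 l; have fJ := freqX_gt0 (R := R) 2 J.
rewrite expr1 -!expr2; case: ltnP => lJ.
  rewrite lerDl; apply: mulr_ge0; last by rewrite invr_ge0 ltW.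
  by apply: mulr_ge0 => //; exact: sqr_ge0.
rewrite add0r ler_pdivlMr// mulrAC ler_wpM2r// [X in _ <= X]expr2.
apply: ler_wpM2l; first exact: ltW.
by rewrite lerXn2r ?nnegrE ?(ltW (freq_gt0 _))// /freq ler_nat; lia.
Qed.

Lemma growth_time : 10 ^+ 3 * 10 <= A -> exists T J, 0 < T <= A^-1 /\
  A ^+ 4 / 10 ^+ 6 / 2 <= \sum_(l < J) freq l ^+ 2 * coef2 l T.
Proof.
move=> A1.
have A100 : 100 <= A.
  apply: le_trans A1; rewrite (_ : 100 = 10 * 10); last by ring.
  by rewrite ler_pM2r// exprS ler_peMr// exprn_ege1// ler1n.
have A0 : 0 < A by apply: lt_le_trans A100.
have Ainv1 : A^-1 <= 1 by rewrite invf_le1// (le_trans _ A100)// ler1n.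
pose C := weighted_bound A 0 1 + weighted_bound A 1 1.
pose B := rem_bound A 0 1.
have C0 : 0 <= C by apply: addr_ge0 (weighted_bound_ge0 A 0 1) (weighted_bound_ge0 A 1 1).
have B0 : 0 <= B := rem_bound_ge0 A 0 1.
(* From this index on, the remainder bound [B / n.+1%:R] meets the smallness hypothesis of
   [galerkin_growth]. *)
pose N := Num.truncn (64 * C * B).
have tn n : exists t, 0 <= t <= A^-1 /\
    ((N <= n)%N -> A ^+ 4 / 10 ^+ 6 < sobolev2 n.+1 1 (p n t) (q n t)).
  have [Nn|nN] := leqP N n; last first.
    by exists 0; split=> //; rewrite lexx invr_ge0 ltW.
  have R1 t x (t1 : `|t| <= 1) := (rem_le G 0 n x t1).2.
  have R2 t x (t1 : `|t| <= 1) := (rem_le G 0 n x t1).1.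
  have [|t tA K] := galerkin_growth (G n) isT A100 R1 R2; last by exists t.
  rewrite -/C -/B mulrA ler_pdivrMr ?ltr0n// mul1r.
  have : 64 * C * B < N.+1%:R by exact: truncnS_gt.
  by move=> /ltW /le_trans; apply; rewrite ler_nat.
pose t n := projT1 (cid (tn n)).
have tA n : 0 <= t n <= A^-1 by rewrite /t; case: cid => ? [].
have tK n : (N <= n)%N -> A ^+ 4 / 10 ^+ 6 < sobolev2 n.+1 1 (p n (t n)) (q n (t n)).
  by rewrite /t; case: cid => ? [].
have t1 n : `|t n| <= 1.
  by have /andP[h1 h2] := tA n; rewrite ger0_norm// (le_trans h2).
have [T tT] := ucvg_bounded t1.
have T0 : 0 <= T by apply: (ucvg_le (N := 0) (@ucvg_cst _ 0) tT) => n _; have /andP[] := tA n.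
have TA : T <= A^-1 by apply: (ucvg_le (N := 0) tT (@ucvg_cst _ _)) => n _; have /andP[] := tA n.
have T1 : `|T| <= 1 by rewrite ger0_norm// (le_trans TA).
pose E := A ^+ 2 * expR (growth_rate A 2).
have E0 : 0 <= E by apply: mulr_ge0; [exact: sqr_ge0|exact: expR_ge0].
pose a := A ^+ 4 / 10 ^+ 6 / 2.
have a0 : 0 < a by rewrite !divr_gt0// exprn_gt0.
(* Beyond this cutoff the tail is at most [a], half of the kinetic energy reached. *)
pose J := (Num.truncn (E / a)).+1.
have EJ : E / freq J ^+ 2 <= a.
  rewrite ler_pdivrMr ?freqX_gt0// mulrC -ler_pdivrMr//.
  have : E / a < J%:R by exact: truncnS_gt.
  move/ltW/le_trans; apply; apply: (@le_trans _ _ (freq J)).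
    by rewrite /freq ler_nat; lia.
  by rewrite expr2 ler_peMr ?freq_ge1// ltW// freq_gt0.
have key : a <= \sum_(l < J) freq l ^+ 2 * coef2 l T.
  have L : ucvg (fun n => \sum_(l < J) freq l ^+ 2 * (p n (t n) l ^+ 2 + q n (t n) l ^+ 2))
      (\sum_(l < J) freq l ^+ 2 * coef2 l T).
    apply: ucvg_sum => l; apply: ucvgM; first exact: ucvg_cst.
    rewrite /coef2 !expr2 (_ : (fun n => _) = fun n => p n (t n) l * p n (t n) l +
      q n (t n) l * q n (t n) l); last by apply/funext => n; rewrite !expr2.
    by apply: ucvgD; apply: ucvgM; first [exact: coef_re_moving|exact: coef_im_moving].
  apply: (ucvg_le (N := N) (@ucvg_cst _ a) L) => n Nn.
  have := kinetic_split n J (t1 n); have := tK n Nn; rewrite -/E.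
  have : a = A ^+ 4 / 10 ^+ 6 - a by rewrite /a; field.
  move: EJ; lra.
exists T, J; split=> //; rewrite TA andbT lt_neqAle T0 andbT.
(* [T] cannot be 0: the datum has kinetic energy [A ^+ 2], and [A >= 10^4] makes the bound at least
   [50 A ^+ 2]. *)
apply/eqP => TE; move: key; rewrite -TE.
have -> : \sum_(l < J) freq l ^+ 2 * coef2 l 0 = A ^+ 2.
  rewrite big_ord_recl big1 => [|l _].
    by rewrite /coef2 coef_re0 coef_im0 /freq muln0 expr1n expr0n/= mul1r !addr0.
  by rewrite /coef2 coef_re0 coef_im0 expr0n/= addr0 mulr0.
apply/negP; rewrite -ltNge /a.
pose D : R := 10 ^+ 6; have D0 : 0 < D by rewrite exprn_gt0.
have A2 : D * 100 <= A ^+ 2.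
  rewrite (_ : D * 100 = (10 ^+ 3 * 10) ^+ 2); last first.
    by rewrite exprMn -exprM; congr (_ * _); ring.
  by rewrite lerXn2r// nnegrE ?(ltW A0)// mulr_ge0// exprn_ge0.
have A2p : 0 < A ^+ 2 by rewrite exprn_gt0.
rewrite -/D mulrAC ltr_pdivlMr// ltr_pdivlMr//.
have := ler_wpM2l (ltW A2p) A2; rewrite (_ : A ^+ 2 * A ^+ 2 = A ^+ 4); last by ring.
by apply: lt_le_trans; rewrite -mulrA !ltr_pM2l// ltr_nat.
Qed.

Let tail_le n J (a : nat -> R) x : (forall l, (n < l)%N -> a l = 0) ->
  `|tser n.+1 0 a x - tser J 0 a x| <= (\sum_(l < n.+1) freq l ^+ 1 * `|a l|) / freq J.
Proof.
move=> a0; pose F l := freq l ^+ 0 * a l * cosd 0 (freq l * x).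
have -> : tser J 0 a x = \sum_(l < n.+1) (if (l < J)%N then F l else 0).
  have F0 l : (n < l)%N -> F l = 0 by move=> nl; rewrite /F a0// mulr0 mul0r.
  rewrite /tser -/(F _); have [Jn|nJ] := leqP J n.+1.
    by rewrite (big_ord_widen _ F Jn) big_mkcond.
  rewrite [RHS](eq_bigr (fun l : 'I_n.+1 => F l)); last first.
    by move=> l _; rewrite (ltn_trans (ltn_ord l) nJ).
  rewrite (big_ord_widen _ F (ltnW nJ)) [RHS]big_mkcond/=; apply: eq_bigr => l _.
  by case: ltnP => // nl; exact: F0.
rewrite /tser -sumrB mulr_suml; apply: le_trans (ler_norm_sum _ _ _) _.
apply: ler_sum => l _; have fJ := freq_gt0 (R := R) J; have fl := freq_gt0 (R := R) l.
case: ltnP => lJ.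
  rewrite /F subrr normr0; apply: mulr_ge0; last by rewrite invr_ge0 ltW.
  by apply: mulr_ge0 => //; exact/ltW/freqX_gt0.
rewrite subr0 expr0 mul1r expr1 normrM ler_pdivlMr//.
apply: (@le_trans _ _ (`|a l| * freq J)).
  by apply: ler_wpM2r; [exact: ltW|rewrite ler_piMr// norm_cosd].
by rewrite mulrC ler_wpM2r// /freq ler_nat; lia.
Qed.

(** The rate is uniform in [x], so the partial sums may be integrated term by term. *)
Lemma jet_re_series J t x :
  `|jet_re p 0 t x - tser J 0 (coef_re ^~ t) x| <= weighted_bound A 1 `|t| / freq J.
Proof.
apply: (@ucvg_norm_le _ 0 (fun n => tser n.+1 0 (p n t) x - tser J 0 (p n t) x)).
  apply: ucvgB; first exact: (@gjet_cvg _ _ _ _ G t x (JRe 0)).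
  apply: ucvg_sum => l; apply: ucvgM; last exact: ucvg_cst.
  by apply: ucvgM; [exact: ucvg_cst|exact: coef_re_cvg].
move=> n _.
have H l : (n < l)%N -> p n t l = 0 by move=> nl; have [] := galerkin_high (G n) t nl.
apply: le_trans (tail_le J x H) _.
rewrite ler_wpM2r ?invr_ge0 ?(ltW (freq_gt0 _))//.
apply: le_trans (galerkin_weighted (G n) isT 1 (lexx `|t|)).
by apply: ler_sum => l _; rewrite ler_wpM2l ?lerDl// ltW// freqX_gt0.
Qed.

Lemma jet_im_series J t x :
  `|jet_im q 0 t x - tser J 0 (coef_im ^~ t) x| <= weighted_bound A 1 `|t| / freq J.
Proof.
apply: (@ucvg_norm_le _ 0 (fun n => tser n.+1 0 (q n t) x - tser J 0 (q n t) x)).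
  apply: ucvgB; first exact: (@gjet_cvg _ _ _ _ G t x (JIm 0)).
  apply: ucvg_sum => l; apply: ucvgM; last exact: ucvg_cst.
  by apply: ucvgM; [exact: ucvg_cst|exact: coef_im_cvg].
move=> n _.
have H l : (n < l)%N -> q n t l = 0 by move=> nl; have [] := galerkin_high (G n) t nl.
apply: le_trans (tail_le J x H) _.
rewrite ler_wpM2r ?invr_ge0 ?(ltW (freq_gt0 _))//.
apply: le_trans (galerkin_weighted (G n) isT 1 (lexx `|t|)).
by apply: ler_sum => l _; rewrite ler_wpM2l ?lerDr// ltW// freqX_gt0.
Qed.

End LimitCoefficients.

(** * The solution on the torus and its Fourier coefficients *)

Section Torus.
Context {R : realType}.
Local Open Scope classical_set_scope.
Implicit Types (g h : R -> R).

Lemma dble_measurable g : dble g -> measurable_fun [set: R] g.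
Proof. by move=> dg; apply: continuous_measurable_fun; exact: dble_continuous. Qed.

Lemma period_square_measure : lebesgue2 (@period_square R) = ((2 * pi) * (2 * pi))%:E.
Proof.
pose I : set R := `[0, 2 * pi].
transitivity (lebesgue_measure I * lebesgue_measure I)%E.
  by apply: product_measure1E; exact: measurable_itv.
have P : 0 < 2 * pi :> R by rewrite mulr_gt0// pi_gt0.
by rewrite /I lebesgue_measure_itv/= lte_fin P -EFinB subr0 -EFinM.
Qed.

Lemma measurable_period_square : measurable (@period_square R).
Proof. exact: measurableX. Qed.

Lemma dble_bounded g : dble g -> exists2 C : R, 0 <= C & forall x, 0 <= x <= 2 * pi -> `|g x| <= C.
Proof.
move=> dg; have P : 0 <= 2 * pi :> R by rewrite mulr_ge0// pi_ge0.
have [c _ H] := EVT_max P (continuous_subspaceT (dble_continuous (dble_exp 2 dg))).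
exists (g c ^+ 2 + 1); first by rewrite addr_ge0// sqr_ge0.
move=> x xp; have := H x; rewrite in_itv/= xp => /(_ isT) K.
apply: le_trans (_ : `|g x| <= `|g x| ^+ 2 + 1) _.
  by have := sqr_ge0 (`|g x| - 1); have := sqr_ge0 `|g x|; nra.
by rewrite real_normK ?num_real// lerD2r.
Qed.

Lemma period_square_integrable g h : dble g -> dble h ->
  (@lebesgue2 R).-integrable period_square (EFin \o (fun x => g x.1 * h x.2)).
Proof.
move=> dg dh.
have mg : measurable_fun [set: measurableTypeR R * measurableTypeR R]
    (fun x => g x.1 * h x.2 : measurableTypeR R).
  by apply: measurable_funM; apply: measurableT_comp => //; exact: dble_measurable.
have [C C0 HC] := dble_bounded dg; have [D D0 HD] := dble_bounded dh.
apply: measurable_bounded_integrable => //.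
- exact: measurable_period_square.
- by rewrite period_square_measure ltry.
- exact: measurable_funTS.
- exists (C * D); split; first exact: num_real.
  move=> M CM x [/=]; rewrite !in_itv/= => x1 x2.
  by rewrite (le_trans _ (ltW CM))// normrM ler_pM ?HC ?HD.
Qed.

Lemma Rintegral_period_square g h : dble g -> dble h ->
  Rintegral lebesgue2 period_square (fun x => g x.1 * h x.2) = mean g * mean h.
Proof.
move=> dg dh.
pose I : set R := `[0, 2 * pi].
have int := period_square_integrable dg dh.
rewrite /Rintegral integral_mkcond.
pose f (x : measurableTypeR R * measurableTypeR R) : \bar R := ((g \_ I) x.1 * (h \_ I) x.2)%:E.
have E : ((fun x => (g x.1 * h x.2)%:E) \_ (@period_square R)) = f.
  apply/funext => -[x y]; rewrite /f !patchE /period_square/=.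
  have -> : ((x, y) \in `[0, 2 * pi] `*` `[0, 2 * pi]) = (x \in I) && (y \in I).
    by rewrite /I; apply/idP/andP; rewrite !inE/= => -[].
  by case: (x \in I); case: (y \in I); rewrite /= ?mul0r ?mulr0.
rewrite E.
have imf : (@lebesgue2 R).-integrable setT f.
  have [i2 _] := @integrable_mkcond _ _ _ (@lebesgue2 R) period_square (EFin \o (fun x => g x.1 * h x.2)) measurable_period_square.
  by rewrite -E; exact: i2 int.
have F := @integral12_prod_meas1 _ _ _ _ R lebesgue_measure lebesgue_measure f imf.
have restrict k : dble k -> lebesgue_measure.-integrable setT (EFin \o (k \_ I)) /\
    (\int[lebesgue_measure]_x ((k \_ I) x)%:E = (mean k)%:E)%E.
  move=> dk; have ik := mean_integrable dk.
  have ik' : lebesgue_measure.-integrable setT (EFin \o (k \_ I)).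
    have mI : measurable (I : set (measurableTypeR R)) by exact: measurable_itv.
    have [i2 _] := @integrable_mkcond _ _ _ (@lebesgue_measure R) I (EFin \o k) mI.
    by rewrite -restrict_EFin; exact: i2 ik.
  split=> //; rewrite /mean /Rintegral fineK; last exact: integrable_fin_num.
  by rewrite [RHS]integral_mkcond -/I restrict_EFin.
have [ig Eg] := restrict _ dg; have [ih Eh] := restrict _ dh.
transitivity (fine (\int[lebesgue_measure]_x (fubini_F lebesgue_measure f x))%E).
  by congr fine; exact: esym F.
rewrite (_ : (\int[lebesgue_measure]_x _)%E = (mean g * mean h)%:E)//.
transitivity (\int[lebesgue_measure]_x (((g \_ I) x)%:E * (mean h)%:E))%E.
  apply: eq_integral => x _; rewrite /fubini_F /f /=.
  by under eq_integral do rewrite EFinM; rewrite integralZl ?Eh.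
by rewrite integralZr// Eg EFinM.
Qed.

Lemma Rintegral_period_square2 g h g' h' : dble g -> dble h -> dble g' -> dble h' ->
  Rintegral lebesgue2 period_square (fun x => g x.1 * h x.2 + g' x.1 * h' x.2) =
  mean g * mean h + mean g' * mean h'.
Proof.
move=> dg dh dg' dh'; rewrite -!Rintegral_period_square// RintegralD//.
- exact: measurable_period_square.
- exact: period_square_integrable.
- exact: period_square_integrable.
Qed.

(** The addition formulas split the exponential into products of a function of each variable; those
    containing [sin (n.2 y)] integrate to 0. *)
Lemma fourier_coef_line (a b : R -> R) (n : int * int) : dble a -> dble b ->
  fourier_coef (fun x => (a x.1 +i* b x.1)%C) n =
  ((mean (fun x => a x * cos (n.1%:~R * x) + b x * sin (n.1%:~R * x)) *
    mean (fun y => cos (n.2%:~R * y))) +i*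
   (mean (fun x => b x * cos (n.1%:~R * x) - a x * sin (n.1%:~R * x)) *
    mean (fun y => cos (n.2%:~R * y))))%C.
Proof.
move=> da db; rewrite /fourier_coef /cintegral.
have dcs (z : int) : dble (fun x : R => cos (z%:~R * x)) by exact: dble_cos.
have dsn (z : int) : dble (fun x : R => sin (z%:~R * x)) by exact: dble_sin.
have d1 := dble_add (dble_mul da (dcs n.1)) (dble_mul db (dsn n.1)).
have d2 := dble_add (dble_mul db (dcs n.1)) (dble_opp (dble_mul da (dsn n.1))).
have d3 := dble_opp d1.
congr (_ +i* _)%C.
- have := Rintegral_period_square2 d1 (dcs n.2) d2 (dsn n.2).
  rewrite mean_sin mulr0 addr0 => <-; apply: eq_Rintegral => x _.
  by rewrite /cis /= !(sinN, cosN, cosD, sinD); ring.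
- have := Rintegral_period_square2 d2 (dcs n.2) d3 (dsn n.2).
  rewrite mean_sin mulr0 addr0 => <-; apply: eq_Rintegral => x _.
  by rewrite /cis /= !(sinN, cosN, cosD, sinD); ring.
Qed.

Lemma mean_cos_int (z : int) : mean (fun y : R => cos (z%:~R * y)) = if z == 0 then 2 * pi else 0.
Proof.
case: eqVneq => [->|z0]; last exact: mean_cos.
rewrite -[RHS]mulr1 -mean_cst; congr mean; apply/funext => y.
by rewrite mul0r cos0.
Qed.

Lemma mean_cos_sin (z w : int) : mean (fun x : R => cos (z%:~R * x) * sin (w%:~R * x)) = 0.
Proof.
rewrite (_ : (fun x => _) = fun x => 2^-1 * (sin ((w + z)%:~R * x) + sin ((w - z)%:~R * x))).
  rewrite meanZ; last by apply: dble_add; exact: dble_sin.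
  rewrite meanD; [|exact: dble_sin|exact: dble_sin].
  by rewrite !mean_sin addr0 mulr0.
apply/funext => x; rewrite intrD intrB !(mulrDl, mulNr) !(sinD, cosN, sinN); by field.
Qed.

End Torus.

Section Solution.
Context {R : realType}.
Variables (A : R) (p q : nat -> R -> nat -> R).
Hypothesis G : forall n, galerkin A n.+1 (p n) (q n).
Implicit Types (t : R) (l J : nat).
Local Open Scope classical_set_scope.

Definition line_solution t (x : R * R) : R[i] :=
  (jet_re p 0 t x.1 +i* jet_im q 0 t x.1)%C.

Let jet_eval (y : R * (R * R)) e := ujet p q y.1 y.2.1 e.

Let derive_jet e (z v : R * (R * R)) :
  derive (fun y => jet_eval y e : R^o) z v = jet_eval z (jdir v.1 v.2.1 e).
Proof. by have [_] := der_ujet G e z v. Qed.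

Lemma line_solution_global : global_solution_NLS line_solution.
Proof.
split.
- split; first exact: (smooth_ujet G (JRe 0)).
  exact: (smooth_ujet G (JIm 0)).
- move=> t x n; rewrite /line_solution /=.
  have := ujet_period p q t x.1 (JRe 0) n.1; have := ujet_period p q t x.1 (JIm 0) n.1.
  by rewrite /ujet/= => -> ->.
- move=> t x.
  have D1 v : cderive v (spacetime line_solution) = fun z =>
      (jet_eval z (jdir v.1 v.2.1 (JRe 0)) +i* jet_eval z (jdir v.1 v.2.1 (JIm 0)))%C.
    apply/funext => z; congr (_ +i* _)%C; first exact: (derive_jet (JRe 0) z v).
    exact: (derive_jet (JIm 0) z v).
  have D2 v : cderive v (cderive v (spacetime line_solution)) = fun z =>
      (jet_eval z (jdir v.1 v.2.1 (jdir v.1 v.2.1 (JRe 0))) +i*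
       jet_eval z (jdir v.1 v.2.1 (jdir v.1 v.2.1 (JIm 0))))%C.
    rewrite D1; apply/funext => z; congr (_ +i* _)%C.
      exact: (derive_jet (jdir v.1 v.2.1 (JRe 0)) z v).
    exact: (derive_jet (jdir v.1 v.2.1 (JIm 0)) z v).
  rewrite /time_derivative /laplacian !D2 D1 normCK /line_solution /jet_eval /ujet /=.
  (* With all derivatives expressed by jets, the equation is a polynomial identity. *)
  apply/eqP; rewrite eq_complex /=; apply/andP; split; apply/eqP; ring.
Qed.

Let der_slice (F : R * (R * R) -> R) t (x d : R) :
  is_derive (t, (x, 0)) (0, (1, 0)) F d -> is_derive x (1 : R) (fun y => F (t, (y, 0))) d.
Proof.
move=> [D E].
have S : (fun h : R => h^-1 *: (((fun y => F (t, (y, 0))) \o shift x) (h *: (1 : R)) -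
      F (t, (x, 0)))) =
    (fun h : R => h^-1 *: ((F \o shift (t, (x, 0))) (h *: (0, (1, 0))) - F (t, (x, 0)))).
  apply/funext => h; congr (_ *: (F _ - _)).
  rewrite /shift /= /GRing.scale /= /GRing.scale /=; congr (_, (_, _)).
    by rewrite -[LHS]add0r; congr (_ + _); exact: esym (mulr0 h).
  by rewrite -[LHS]add0r; congr (_ + _); exact: esym (mulr0 h).
by apply: DeriveDef; [rewrite /derivable S; exact: D|rewrite /derive S; exact: E].
Qed.

Lemma dble_jet_re t : dble (jet_re p 0 t).
Proof.
move=> x; eexists.
exact: (@der_slice (fun y => jet_re p 0 y.1 y.2.1) _ _ _ (der_jet_re G 0 (t, (x, 0)) (0, (1, 0)))).
Qed.

Lemma dble_jet_im t : dble (jet_im q 0 t).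
Proof.
move=> x; eexists.
exact: (@der_slice (fun y => jet_im q 0 y.1 y.2.1) _ _ _ (der_jet_im G 0 (t, (x, 0)) (0, (1, 0)))).
Qed.

(** The means of the partial sums are constant once [J > l], and uniform convergence makes them
    converge to the mean of [f w]. *)
Lemma mean_of_series (f w : R -> R) (a : nat -> R) (C v : R) l :
  dble f -> dble w -> (forall x, `|w x| <= 1) ->
  (forall J x, `|f x - tser J 0 a x| <= C / freq J) ->
  (forall J, (l < J)%N -> mean (fun x => tser J 0 a x * w x) = v) ->
  mean (fun x => f x * w x) = v.
Proof.
move=> df dw w1 fa E; apply/eqP; rewrite -subr_eq0 -normr_le0.
have C0 : 0 <= C.
  by have := fa 0%N 0; rewrite /freq muln0 add0n divr1; apply: le_trans.
apply: (@ucvg_le _ l.+1 (fun=> `|mean (fun x => f x * w x) - v|) (fun J => 2 * pi * C / J.+1%:R)).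
- exact: ucvg_cst.
- exact: ucvg_inv_nat.
move=> J lJ; rewrite -(E J lJ) -meanB; [|exact: dble_mul|].
  rewrite -mulrA; apply: mean_norm_le => [|x].
    apply: dble_add; first exact: dble_mul.
    by apply/dble_opp/dble_mul => //; exact: dble_tser.
  rewrite -mulrBl normrM -[X in _ <= X]mulr1 ler_pM//.
  apply: le_trans (fa J x) _; rewrite ler_wpM2l// lef_pV2 ?posrE ?freq_gt0 ?ltr0n//.
  by rewrite /freq ler_nat; lia.
by apply: dble_mul => //; exact: dble_tser.
Qed.

Lemma mean_tser_cos J l (a : nat -> R) : (l < J)%N ->
  mean (fun x => tser J 0 a x * cos (freq l * x)) = pi * a l.
Proof.
move=> lJ; pose b m : R := if m == l then 1 else 0.
have E x : cos (freq l * x) = tser J 0 b x.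
  rewrite /tser (bigD1 (Ordinal lJ))//= /b eqxx big1 => [|m].
    by rewrite expr0 !mul1r cosd0 addr0.
  by rewrite -val_eqE/= => /negPf ->; rewrite mulr0 mul0r.
rewrite (_ : (fun x => _) = fun x => tser J 0 a x * tser J 0 b x).
  rewrite mean_tser_mul; congr (_ * _); rewrite (bigD1 (Ordinal lJ))//= /b eqxx big1 => [|m].
    by rewrite mulr1 addr0.
  by rewrite -val_eqE/= => /negPf ->; rewrite mulr0.
by apply/funext => x; rewrite E.
Qed.

Lemma mean_tser_sin J l (a : nat -> R) : mean (fun x => tser J 0 a x * sin (freq l * x)) = 0.
Proof.
pose F (m : nat) x := a m * (cos (freq m * x) * sin (freq l * x)).
rewrite (_ : (fun x => _) = fun x => \sum_(m < J) F m x); last first.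
  apply/funext => x; rewrite /tser mulr_suml; apply: eq_bigr => m _.
  by rewrite /F cosd0; ring.
have dcs m : dble (fun x : R => cos (freq m * x) * sin (freq l * x)).
  by apply: dble_mul; [exact: dble_cos|exact: dble_sin].
rewrite (@mean_sum _ J F) => [|m].
  apply: big1 => m _; rewrite meanZ//.
  by rewrite (@mean_cos_sin _ (2 * m + 1)%:Z (2 * l + 1)%:Z) mulr0.
by apply: dble_mul => //; exact: dble_cst.
Qed.

(** The factor is [pi], from the square of a cosine in the first variable, times the period [2 * pi]
    in the second. *)
Lemma fourier_line t l : fourier_coef (line_solution t) ((2 * l + 1)%:Z, 0) =
  ((2 * pi ^+ 2 * coef_re p l t) +i* (2 * pi ^+ 2 * coef_im q l t))%C.
Proof.
have dr := dble_jet_re t; have di := dble_jet_im t.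
rewrite (fourier_coef_line _ dr di) /= mean_cos_int eqxx.
have c1 x : `|cos (freq l * x : R)| <= 1 by exact: cos_max.
have s1 x : `|sin (freq l * x : R)| <= 1 by exact: sin_max.
have dc : dble (fun x : R => cos (freq l * x)) by exact: dble_cos.
have ds : dble (fun x : R => sin (freq l * x)) by exact: dble_sin.
have Rc := mean_of_series dr dc c1 (fun J => jet_re_series G J t) (fun J (lJ : (l < J)%N) => mean_tser_cos (coef_re p ^~ t) lJ).
have Rs := mean_of_series dr ds s1 (fun J => jet_re_series G J t)
  (fun J (_ : (0 < J)%N) => mean_tser_sin J l (coef_re p ^~ t)).
have Ic := mean_of_series di dc c1 (fun J => jet_im_series G J t) (fun J (lJ : (l < J)%N) => mean_tser_cos (coef_im q ^~ t) lJ).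
have Is := mean_of_series di ds s1 (fun J => jet_im_series G J t)
  (fun J (_ : (0 < J)%N) => mean_tser_sin J l (coef_im q ^~ t)).
congr (_ +i* _)%C.
  rewrite meanD; [|exact: dble_mul|exact: dble_mul].
  by rewrite Rc Is; ring.
rewrite meanB; [|exact: dble_mul|exact: dble_mul].
by rewrite Ic Rs; ring.
Qed.

Lemma line_initial x : line_solution 0 x = (A * cos x.1 +i* 0)%C.
Proof.
congr (_ +i* _)%C.
  apply: ulimE; apply: (@ucvg_ext _ 0 (fun=> A * cos x.1)); first exact: ucvg_cst.
  move=> n _; rewrite /tser (galerkin_re0 (G n)) big_ord_recl/= big1 => [|l _].
    by rewrite cosd0 expr0 mul1r addr0 /freq muln0 mul1r.
  by rewrite mulr0 mul0r.
apply: ulimE; apply: (@ucvg_ext _ 0 (fun=> 0)); first exact: ucvg_cst.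
move=> n _; rewrite /tser (galerkin_im0 (G n)) big1// => l _.
by rewrite mulr0 mul0r.
Qed.

Lemma fourier_initial (n : int * int) : fourier_coef (line_solution 0) n =
  ((if (n.2 == 0) && ((n.1 == 1) || (n.1 == -1)) then 2 * pi ^+ 2 * A else 0) +i* 0)%C.
Proof.
have -> : line_solution 0 = fun x => ((fun y => A * cos y) x.1 +i* (fun=> 0) x.1)%C.
  by apply/funext => x; exact: line_initial.
have dcos : dble (fun x : R => cos x) by move=> x; exists (- sin x); exact: is_derive_cos.
have da : dble (fun y : R => A * cos y) by apply: dble_mul => //; exact: dble_cst.
rewrite (fourier_coef_line _ da (dble_cst 0)) mean_cos_int; congr (_ +i* _)%C.
  under [X in mean X]eq_fun do rewrite mul0r addr0 -mulrA.
  rewrite meanZ; last by apply: dble_mul => //; exact: dble_cos.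
  case: eqVneq => [_|n2]; last by rewrite mulr0.
  have cc (z : int) : z + n.1 != 0 -> `|z| = 1 ->
      mean (fun x : R => cos x * cos (n.1%:~R * x)) = if z == n.1 then pi else 0.
    move=> zn z1; rewrite -(mean_cos_cos zn); congr mean; apply/funext => x.
    have [->|->] : z = 1 \/ z = -1 by lia.
      by rewrite mul1r.
    by rewrite mulN1r cosN.
  case: (eqVneq n.1 1) => [n1|n1] /=.
    by rewrite (cc 1) ?n1 ?eqxx//; ring.
  case: (eqVneq n.1 (-1)) => [n1'|n1'] /=.
    by rewrite (cc (-1)) ?n1' ?eqxx//; ring.
  rewrite (cc 1) ?mulr0 ?mul0r//; last by lia.
  by rewrite eq_sym (negPf n1) mulr0 mul0r.
under [X in mean X]eq_fun do rewrite mul0r add0r -mulrA -mulrN.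
rewrite meanZ; last by apply/dble_opp/dble_mul => //; exact: dble_sin.
rewrite meanN; last by apply/dble_mul => //; exact: dble_sin.
have := @mean_cos_sin R 1 n.1; under [X in mean X]eq_fun do rewrite mul1r.
by move=> ->; rewrite oppr0 mulr0 mul0r.
Qed.

End Solution.

(** * Norms of the datum and lower bounds for Sobolev norms *)

Section Norms.
Context {R : realType}.
Local Open Scope classical_set_scope.

Lemma normc_sqr (a b : R) : Normc.normc (a +i* b)%C ^+ 2 = a ^+ 2 + b ^+ 2.
Proof. by rewrite /Normc.normc sqr_sqrtr// addr_ge0// sqr_ge0. Qed.

Lemma japanese_bracket_gt0 (n : int * int) : 0 < japanese_bracket n :> R.
Proof.
by rewrite /japanese_bracket sqrtr_gt0 ltr_pwDl// addr_ge0// sqr_ge0.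
Qed.

Lemma freq_le_bracket l : freq l <= japanese_bracket ((2 * l + 1)%:Z, 0) :> R.
Proof.
rewrite /japanese_bracket /= expr0n/= addr0.
have f0 : 0 <= freq l :> R by exact/ltW/freq_gt0.
rewrite -[X in X <= _](ger0_norm f0) -sqrtr_sqr ler_sqrt.
  by rewrite lerDr.
by rewrite addr_ge0// sqr_ge0.
Qed.

(* Frequencies above [r] carry the kinetic energy: [k^2s >= r^(2s-2) (k^2 - r^2)]. *)
Lemma bracket_weight_ge (s r : R) l : 1 < s -> 0 < r ->
  r `^ (2 * s - 2) * (freq l ^+ 2 - r ^+ 2) <=
  japanese_bracket ((2 * l + 1)%:Z, 0) `^ (2 * s).
Proof.
move=> s1 r0; have f0 := freq_gt0 (R := R) l.
have [fr|rf] := leP (freq l) r.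
  apply: (@le_trans _ _ 0); last exact: powR_ge0.
  by rewrite mulr_ge0_le0 ?powR_ge0// subr_le0 lerXn2r// nnegrE ltW.
apply: (@le_trans _ _ (freq l `^ (2 * s))); last first.
  apply: ge0_ler_powR; rewrite ?nnegrE ?freq_le_bracket// ltW//.
    by rewrite mulr_gt0// (lt_trans _ s1).
  exact: japanese_bracket_gt0.
rewrite (_ : 2 * s = 2 * s - 2 + 2%:R); last by ring.
rewrite [X in _ <= X]powRD ?(gt_eqF f0) ?implybT// powR_mulrn ?(ltW f0)//.
rewrite (_ : 2 * s - 2 + 2%:R - 2 = 2 * s - 2); last by ring.
rewrite ler_pM ?powR_ge0//.
- by rewrite subr_ge0 lerXn2r ?nnegrE ?ltW.
- by apply: ge0_ler_powR; rewrite ?nnegrE ?ltW//; lra.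
- by rewrite gerBl sqr_ge0.
Qed.

(** The crude [cos^2 <= 1] suffices: constants are absorbed by the threshold on [K]. *)
Lemma L2_norm_cos (A : R) (f : R * R -> R[i]) : 0 <= A ->
  (forall x, f x = (A * cos x.1 +i* 0)%C) -> (L2_norm f <= (2 * pi * A)%:E)%E.
Proof.
move=> A0 fE; rewrite /L2_norm.
have P : 0 <= 2 * pi * A by rewrite mulr_ge0// mulr_ge0// pi_ge0.
rewrite (_ : (2 * pi * A)%:E = sqrte ((A ^+ 2)%:E * lebesgue2 (@period_square R))); last first.
  rewrite period_square_measure -EFinM /=; congr (_%:E).
  rewrite (_ : A ^+ 2 * _ = (2 * pi * A) ^+ 2); last by ring.
  by rewrite sqrtr_sqr ger0_norm.
rewrite lee_sqrt; last first.
  by rewrite mule_ge0// lee_fin sqr_ge0.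
rewrite -integral_cst; last exact: measurable_period_square.
have dc : dble (fun x : R => (A * cos x) ^+ 2).
  apply/dble_exp/dble_mul; first exact: dble_cst.
  by move=> x; exists (- sin x); exact: is_derive_cos.
have mf : measurable_fun (@period_square R) (fun x => (Normc.normc (f x) ^+ 2)%:E).
  have := measurable_int _ (period_square_integrable dc (dble_cst 1)).
  rewrite (_ : EFin \o _ = fun x => (Normc.normc (f x) ^+ 2)%:E)//.
  by apply/funext => x; rewrite fE normc_sqr /= expr0n addr0 mulr1.
apply: ge0_le_integral => //.
- exact: measurable_period_square.
- by move=> x _; rewrite lee_fin sqr_ge0.
- move=> x _; rewrite lee_fin fE normc_sqr expr0n addr0 exprMn ler_piMr ?sqr_ge0//.
Qed.

Lemma sobolev_norm_two_modes (s B : R) (f : R * R -> R[i]) :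
  (forall n, fourier_coef f n =
    ((if (n.2 == 0) && ((n.1 == 1) || (n.1 == -1)) then B else 0) +i* 0)%C) ->
  sobolev_norm s f = sqrte ((2 * japanese_bracket (1, 0) `^ (2 * s) * B ^+ 2)%:E).
Proof.
move=> fE; rewrite /sobolev_norm; congr sqrte.
pose r : seq (int * int) := [:: (1, 0); (-1, 0)].
pose F (n : int * int) : \bar R :=
  ((japanese_bracket n `^ (2 * s) * Normc.normc (fourier_coef f n) ^+ 2)%R)%:E.
transitivity (\esum_(n in [set` r]) F n)%E.
  rewrite [RHS]esum_mkcond; apply: eq_esum => n _; rewrite /F fE normc_sqr.
  rewrite mem_setE !inE; case: n => n1 n2 /=; rewrite !xpair_eqE.
  by case: (n2 == 0); case: (n1 == 1); case: (n1 == -1) => //=; rewrite expr0n addr0 mulr0.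
rewrite esum_fset; [|exact: finite_seq|by move=> n _; rewrite lee_fin mulr_ge0 ?powR_ge0 ?sqr_ge0].
rewrite -fsbig_seq// big_cons big_seq1 /F !fE !normc_sqr /= -EFinD; congr (_%:E).
rewrite (_ : japanese_bracket (-1, 0) = japanese_bracket (1, 0)); last first.
  by rewrite /japanese_bracket /=; congr (Num.sqrt (1 + (_ + _))); rewrite mulrN1z sqrrN.
by rewrite expr0n addr0; ring.
Qed.

Lemma sobolev_norm_ge (s : R) (f : R * R -> R[i]) J (a b : nat -> R) :
  (forall l, fourier_coef f ((2 * l + 1)%:Z, 0) = (a l +i* b l)%C) ->
  (sqrte ((\sum_(l < J) japanese_bracket ((2 * l + 1)%:Z, 0) `^ (2 * s) *
     (a l ^+ 2 + b l ^+ 2))%:E) <= sobolev_norm s f)%E.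
Proof.
move=> fE; rewrite /sobolev_norm lee_sqrt; last first.
  by apply: esum_ge0 => n _; rewrite lee_fin mulr_ge0 ?powR_ge0 ?sqr_ge0.
apply: esum_ge; pose g (l : nat) : int * int := ((2 * l + 1)%:Z, 0).
pose r := [seq g l | l <- iota 0 J].
exists [set` r]; first by split=> //; exact: finite_seq.
rewrite -fsbig_seq; last first.
  by rewrite map_inj_uniq ?iota_uniq// => l m [] /eqP; lia.
rewrite big_map sumEFin lee_fin.
rewrite (_ : iota 0 J = index_iota 0 J); last by rewrite /index_iota subn0.
rewrite big_mkord; apply: ler_sum => l _.
by rewrite fE normc_sqr.
Qed.

End Norms.

(** * Choice of the amplitude and conclusion *)

Section Growth.
Context {R : realType}.

(** [D] absorbs the weight of the two modes of the datum. With [r^s = K D], frequencies above [r]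
    are heavy enough to beat [K] times the initial norm. *)
Lemma sobolev_growth (A s D K : R) (p q : nat -> R -> nat -> R) :
  (forall n, galerkin A n.+1 (p n) (q n)) -> 1 < s -> 1 <= K -> 1 <= D ->
  2 * japanese_bracket (1, 0) `^ (2 * s) <= D ^+ 2 ->
  A = 10 ^+ 3 * 10 * (K * D) `^ s^-1 ->
  exists T, 0 < T <= A^-1 /\
    (K%:E * sobolev_norm s (line_solution p q 0) <= sobolev_norm s (line_solution p q T))%E.
Proof.
move=> G s1 K1 D1 DJ AE.
have s0 : 0 < s by rewrite (lt_trans _ s1).
have KD1 : 1 <= K * D by rewrite -[1]mulr1 ler_pM.
pose r := (K * D) `^ s^-1; pose B : R := 10 ^+ 3 * 10.
have r1 : 1 <= r by rewrite -(powRr0 (K * D)) ler_powR// invr_ge0 ltW.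
have r0 : 0 < r by apply: lt_le_trans r1.
have B0 : 0 < B by rewrite mulr_gt0// exprn_gt0.
have AB : B <= A by rewrite AE ler_peMr// ltW.
have A0 : 0 < A by apply: lt_le_trans AB.
have [T [J [TA H]]] := growth_time G AB.
exists T; split=> //.
rewrite (sobolev_norm_two_modes s (fourier_initial G)).
apply: le_trans (sobolev_norm_ge s J (fourier_line G T)).
rewrite /= -EFinM lee_fin.
have K0 : 0 <= K by rewrite (le_trans _ K1).
rewrite -[K]ger0_norm// -sqrtr_sqr -sqrtrM ?sqr_ge0// ler_sqrt; last first.
  by apply: sumr_ge0 => l _; rewrite mulr_ge0 ?powR_ge0// addr_ge0// sqr_ge0.
pose M : R := 2 * pi ^+ 2.
pose W l := japanese_bracket ((2 * l + 1)%:Z, 0) `^ (2 * s) : R.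
have -> : \sum_(l < J) W l * ((2 * pi ^+ 2 * coef_re p l T) ^+ 2 + (2 * pi ^+ 2 * coef_im q l T) ^+ 2)
    = M ^+ 2 * \sum_(l < J) W l * coef2 p q l T.
  by rewrite mulr_sumr; apply: eq_bigr => l _; rewrite /coef2 /M; ring.
rewrite (_ : K ^+ 2 * _ = M ^+ 2 * ((2 * japanese_bracket (1, 0) `^ (2 * s)) * K ^+ 2 * A ^+ 2));
  last by rewrite /M; ring.
rewrite ler_wpM2l ?sqr_ge0//.
have rs : r `^ (2 * s - 2) * r ^+ 2 = (D * K) ^+ 2.
  rewrite -[r ^+ 2]powR_mulrn ?(ltW r0)// -powRD ?(gt_eqF r0) ?implybT//.
  rewrite (_ : 2 * s - 2 + 2%:R = s * 2%:R); last by ring.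
  have rK : r `^ s = K * D.
    by rewrite /r -powRrM mulVf ?gt_eqF// powRr1 ?(le_trans _ KD1).
  by rewrite powRrM rK powR_mulrn ?(le_trans _ KD1)// mulrC.
apply: (@le_trans _ _ (r `^ (2 * s - 2) * (r ^+ 2 * A ^+ 2))).
  rewrite mulrA rs exprMn ler_wpM2r ?sqr_ge0// ler_wpM2r ?sqr_ge0//.
(* The kinetic energy gives [50 r^2 A^2], and the frequencies below [r] take away at most
   [r^2 A^2]. *)
apply: (@le_trans _ _ (r `^ (2 * s - 2) *
    (\sum_(l < J) freq l ^+ 2 * coef2 p q l T - r ^+ 2 * \sum_(l < J) coef2 p q l T))).
  rewrite ler_wpM2l ?powR_ge0// lerBrDr; apply: le_trans H.
  have m := ler_wpM2l (sqr_ge0 r) (coef2_mass G J T).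
  apply: le_trans (lerD (lexx _) m) _.
  have AE' : A = B * r by [].
  pose E : R := 10 ^+ 6; have E0 : 0 < E by rewrite exprn_gt0.
  have BE : B ^+ 2 = E * 100.
    by rewrite exprMn -exprM; congr (_ * _); ring.
  have -> : A ^+ 4 / 10 ^+ 6 / 2 = 50 * (r ^+ 2 * A ^+ 2).
    rewrite -/E (_ : A ^+ 4 = B ^+ 2 * r ^+ 2 * A ^+ 2); last by rewrite AE'; ring.
    by rewrite BE; field; rewrite gt_eqF.
  have : 0 <= r ^+ 2 * A ^+ 2 by rewrite mulr_ge0 ?sqr_ge0.
  lra.
rewrite mulrBr mulrA !mulr_sumr -sumrB.
apply: ler_sum => l _; rewrite mulrA -mulrBl -mulrBr.
by rewrite ler_wpM2r ?coef2_ge0// bracket_weight_ge.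
Qed.

End Growth.

Theorem theorem1 (R : realType) (s : R) (hs : 1 < s) :
  exists2 c : R, 0 < c &
  exists K0 : R, forall K : R, K0 <= K ->
  exists (u : R -> R * R -> R[i]) (T : R),
    [/\ global_solution_NLS u,
        exists (t : R) (x : R * R), u t x != 0,
        0 < T <= K `^ c,
        (K%:E * sobolev_norm s (u 0%R) <= sobolev_norm s (u T))%E &
        (L2_norm (u 0%R) <= (K `^ (- ((s - 1) * c / 4) + 2 / (s - 1)))%R%:E)%E].
Proof.
have s0 : 0 < s by rewrite (lt_trans _ hs).
have sm : 0 < s - 1 by rewrite subr_gt0.
pose c : R := 4 / (s - 1) ^+ 2.
have c0 : 0 < c by rewrite divr_gt0// exprn_gt0.
exists c => //.
pose J : R := 2 * japanese_bracket (1, 0) `^ (2 * s).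
have J0 : 0 <= J by rewrite mulr_ge0// powR_ge0.
pose D := J + 1; have D1 : 1 <= D by rewrite lerDr.
have DJ : J <= D ^+ 2 by have := sqr_ge0 J; rewrite /D; nra.
pose B : R := 10 ^+ 3 * 10; have B0 : 0 < B by rewrite mulr_gt0// exprn_gt0.
pose E := 2 * pi * B * D `^ s^-1.
have E0 : 0 <= E by rewrite !mulr_ge0 ?pi_ge0 ?powR_ge0// ltW.
(* The bound on the datum is [2 pi A = E K^(1/s)], and the allowed exponent is
   [1/(s-1) = 1/s + 1/(s(s-1))], so the requirement is [E <= K^(1/(s(s-1)))]. *)
exists (Num.max 1 (E `^ (s * (s - 1)))) => K; rewrite ge_max => /andP[K1 KE].
have K0 : 0 < K by apply: lt_le_trans K1.
have KD1 : 1 <= K * D by rewrite -[1]mulr1 ler_pM.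
pose A := B * (K * D) `^ s^-1.
have r1 : 1 <= (K * D) `^ s^-1 by rewrite -(powRr0 (K * D)) ler_powR// invr_ge0 ltW.
have A1 : 1 <= A.
  by rewrite -[1]mulr1 ler_pM// -[1]mulr1 ler_pM ?exprn_ege1// ler1n.
have A0 : 0 < A by apply: lt_le_trans A1.
have [p /choice[q G]] := choice (fun n => galerkin_exists A (ltn0Sn n)).
have [T [/andP[T0 TA] growth]] := sobolev_growth G hs K1 D1 DJ erefl.
exists (line_solution p q), T; split => //.
- exact: line_solution_global G.
- exists 0, (0, 0); rewrite (line_initial G) /= cos0 mulr1 eq_complex /= eqxx andbT.
  by rewrite gt_eqF.
(* [T <= 1/A <= 1 <= K^c]. *)
- rewrite T0 (le_trans TA)// (@le_trans _ _ 1)//; first by rewrite invf_le1.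
  by rewrite -(powRr0 K) ler_powR// ltW.
apply: le_trans (L2_norm_cos (ltW A0) (line_initial G)) _; rewrite lee_fin.
have -> : 2 * pi * A = E * K `^ s^-1.
  by rewrite /A /E powRM ?(le_trans _ K1) ?(le_trans _ D1)//; ring.
have -> : - ((s - 1) * c / 4) + 2 / (s - 1) = (s * (s - 1))^-1 + s^-1.
  by rewrite /c; field; rewrite !gt_eqF.
rewrite powRD; last by rewrite (gt_eqF K0) implybT.
rewrite ler_wpM2r ?powR_ge0//.
have ss : 0 < s * (s - 1) by rewrite mulr_gt0.
have -> : E = (E `^ (s * (s - 1))) `^ (s * (s - 1))^-1.
  by rewrite -powRrM mulfV ?gt_eqF// powRr1.
by apply: ge0_ler_powR; rewrite ?nnegrE ?powR_ge0 ?invr_ge0 ?(ltW K0) ?(ltW ss).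
Qed.
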